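(* For $\phi\in C_c^\infty(\mathbb{R})$ define $$\widehat{\mathcal{P}_\phi}(z):=\int_{-\infty}^\infty\mathfrak{S}_t^\sharp(z)\,\phi(t)\,dt=\int_{-\infty}^\infty\overline{\mathfrak{S}_t(\bar z)}\,\phi(t)\,dt .$$ Then $\widehat{\mathcal{P}_\phi}$ belongs to $L^2(\mathbb{R})$ as a function of $z$ (unconditionally).
   Context: $C_c^\infty(\mathbb{R})$ is the space of smooth compactly supported complex-valued functions. Let $\xi(s)=\frac12 s(s-1)\pi^{-s/2}\Gamma(s/2)\zeta(s)$ be the Riemann xi-function, $F^\sharp(z):=\overline{F(\bar z)}$, $E_\xi(z):=\xi(1/2-iz)+\xi'(1/2-iz)$ ($\xi'$ = derivative in $s$), and $\Theta_\xi:=E_\xi^\sharp/E_\xi$ (a meromorphic function on $\mathbb{C}$). Let $\Lambda$ be the von Mangoldt function and $\Phi(z,s,a)=\sum_{n\ge0}z^n(n+a)^{-s}$ the Hurwitz–Lerch zeta-function. For $t\ge0$ define the meromorphic function of $z$ $$\begin{aligned}\mathfrak{P}_t(z):={}&\frac{4(e^{t/2}-1)}{1+2iz}+\frac{4(e^{-t/2}-1)}{1-2iz}+\frac{e^{-izt}-1}{iz}\frac{\zeta'}{\zeta}\Bigl(\frac12-iz\Bigr)+\sum_{n\le e^t}\frac{\Lambda(n)}{\sqrt n}\frac{e^{-iz(t-\log n)}-1}{iz}\\&-\frac1{2iz}\Bigl[\frac{\Gamma'}{\Gamma}\Bigl(\frac14-\frac{iz}2\Bigr)-\frac{\Gamma'}{\Gamma}\Bigl(\frac14\Bigr)\Bigr]-\frac{1}{2iz}e^{-t/2}\Bigl[\Phi(e^{-2t},1,\tfrac12(\tfrac12-iz))-\Phi(e^{-2t},1,\tfrac14)\Bigr],\end{aligned}$$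 where for $t=0$ the last bracket is understood as the limit $t\to0^+$. For $t\ge0$ put $$\mathfrak{S}_t(z):=\frac{i(1+\Theta_\xi^\sharp(z))}{2}\,\mathfrak{P}_t(z),$$ a meromorphic function of $z$ (removable singularities are filled in). For $t<0$ put $\mathfrak{S}_t(z):=\mathfrak{S}_{-t}(z)$. *)

(* Defs.v *)
From HB Require Import structures.
From mathcomp Require Import all_boot all_order all_algebra.
From mathcomp Require Import all_classical all_reals all_analysis.
From mathcomp Require Import complex.
Set Implicit Arguments.
Unset Strict Implicit.
Unset Printing Implicit Defensive.
Import Order.TTheory GRing.Theory Num.Theory.
Import numFieldNormedType.Exports.
Local Open Scope classical_set_scope.
Local Open Scope ring_scope.
Local Open Scope complex_scope.

Local Notation Re := complex.Re.
Local Notation Im := complex.Im.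

(* R[i] carries the topology of its modulus and is a normed module over
   itself, so that [derive1 f] for f : R[i] -> R[i] is the complex derivative. *)
#[non_forgetful_inheritance]
HB.instance Definition _ (R : rcfType) := NormedModule.copy R[i] R[i]^o.

Section ComplexFunctions.
Context {R : realType}.
Implicit Types (s z : R[i]) (f : R[i] -> R[i]) (g : R -> R[i]).

Definition cexp s : R[i] :=
  (expR (Re s) * cos (Im s)) +i* (expR (Re s) * sin (Im s)).

(* x^s for real x > 0, with the real logarithm of x *)
Definition cpow (x : R) s : R[i] := cexp (s * (ln x)%:C).

Definition sharp f : R[i] -> R[i] := fun z => (f z^*)^*.

Definition cintegrable (D : set R) g : Prop :=
  (@lebesgue_measure R).-integrable D (fun x => (Re (g x))%:E) /\
  (@lebesgue_measure R).-integrable D (fun x => (Im (g x))%:E).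

Definition cintegral (D : set R) g : R[i] :=
  (\int[@lebesgue_measure R]_(x in D) Re (g x)) +i*
  (\int[@lebesgue_measure R]_(x in D) Im (g x)).

Definition square_integrable g : Prop :=
  [/\ measurable_fun setT (fun x => Re (g x)),
      measurable_fun setT (fun x => Im (g x)) &
      (\int[@lebesgue_measure R]_x (Re (g x) ^+ 2 + Im (g x) ^+ 2)%:E
        < +oo)%E].

Definition smooth g : Prop :=
  forall (n : nat) (x : R),
    derivable (derive1n n (fun t => Re (g t))) x 1 /\
    derivable (derive1n n (fun t => Im (g t))) x 1.

Definition compactly_supported g : Prop :=
  compact (closure [set t | g t != 0]).

(* The formulas below use division by 0 as a total operation, so they take
   arbitrary values on a discrete set of points. The limit along the punctured
   neighbourhoods of z ignores these values: it is the value at z of the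
   meromorphic function represented by f, removable singularities filled in. *)
Definition fill_removable f : R[i] -> R[i] := fun z => lim (f w @[w --> z^']).

Definition analytic_at f z : Prop :=
  exists c : nat -> R[i], \forall w \near z,
    series (fun n => c n * (w - z) ^+ n) @ \oo --> f w.

(* Euler's integral for 0 < Re s, extended to the left by
   Gamma s = Gamma (s + n) / (s (s + 1) ... (s + n - 1)), where n is the least
   natural number with 0 < Re s + n. *)
Definition Gamma_integral s : R[i] :=
  cintegral `]0, +oo[ (fun x => cpow x (s - 1) * (expR (- x))%:C).

Definition Gamma s : R[i] :=
  let n := Num.truncn (1 - Re s) in
  Gamma_integral (s + n%:R) / \prod_(k < n) (s + k%:R).

Definition digamma s : R[i] := derive1 Gamma s / Gamma s.

Definition dirichlet_zeta s : R[i] :=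
  lim (series (fun n : nat => cpow n.+1%:R (- s)) @ \oo).

Definition zeta_continuation (sigma : R) f : Prop :=
  (forall w, sigma < Re w -> w != 1 -> analytic_at f w) /\
  (forall w, 1 < Re w -> f w = dirichlet_zeta w).

(* The value at s of the analytic continuation of the Dirichlet series to a
   punctured half-plane {w | sigma < Re w, w != 1} containing s; by the identity
   theorem it does not depend on the half-plane. The value at the pole s = 1
   is arbitrary. *)
Definition zeta s : R[i] :=
  get [set v | exists (sigma : R) (f : R[i] -> R[i]),
    [/\ sigma < Re s, zeta_continuation sigma f & f s = v]].

Definition xi : R[i] -> R[i] := fill_removable (fun s =>
  2^-1 * s * (s - 1) * cpow pi (- s / 2) * Gamma (s / 2) * zeta s).

Definition E_xi z : R[i] :=
  xi (1 / 2 - 'i%C * z) + derive1 xi (1 / 2 - 'i%C * z).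

Definition Theta_xi z : R[i] := sharp E_xi z / E_xi z.

Definition von_Mangoldt (n : nat) : R :=
  if primes n is [:: p] then ln p%:R else 0.

(* Hurwitz-Lerch zeta-function, for an integral exponent s *)
Definition lerch (x : R[i]) (s : nat) (a : R[i]) : R[i] :=
  lim (series (fun n : nat => x ^+ n / (n%:R + a) ^+ s) @ \oo).

Definition lerch_bracket (t : R) z : R[i] :=
  lerch (expR (- 2 * t))%:C 1 (1 / 2 * (1 / 2 - 'i%C * z)) -
  lerch (expR (- 2 * t))%:C 1 (1 / 4).

Definition lerch_bracket0 (t : R) z : R[i] :=
  if t == 0 then lim (lerch_bracket u z @[u --> 0^'+]) else lerch_bracket t z.

Definition frakP (t : R) z : R[i] :=
  (4 * (expR (t / 2) - 1))%:C / (1 + 2 * 'i%C * z)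
  + (4 * (expR (- t / 2) - 1))%:C / (1 - 2 * 'i%C * z)
  + (cexp (- 'i%C * z * t%:C) - 1) / ('i%C * z)
    * (derive1 zeta (1 / 2 - 'i%C * z) / zeta (1 / 2 - 'i%C * z))
  + \sum_(1 <= n < (Num.truncn (expR t)).+1)
      (von_Mangoldt n / Num.sqrt n%:R)%:C
      * ((cexp (- 'i%C * z * (t - ln n%:R)%:C) - 1) / ('i%C * z))
  - 1 / (2 * 'i%C * z) * (digamma (1 / 4 - 'i%C * z / 2) - digamma (1 / 4))
  - 1 / (2 * 'i%C * z) * (expR (- t / 2))%:C * lerch_bracket0 t z.

(* Both t >= 0 and t < 0, through S_t = S_(-t). *)
Definition frakS (t : R) : R[i] -> R[i] := fill_removable (fun z =>
  'i%C * (1 + sharp Theta_xi z) / 2 * frakP `|t| z).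

Definition hatP_integrand (phi : R -> R[i]) z (t : R) : R[i] :=
  sharp (frakS t) z * phi t.

Definition hatP (phi : R -> R[i]) z : R[i] :=
  cintegral setT (hatP_integrand phi z).

End ComplexFunctions.

(* Main.v *)
Require Import Defs.
From mathcomp Require Import all_boot all_order all_algebra.
From mathcomp Require Import all_classical all_reals all_analysis.
From mathcomp Require Import complex measurable_realfun.
From mathcomp Require Import ring lra zify.
Set Implicit Arguments.
Unset Strict Implicit.
Unset Printing Implicit Defensive.
Import Order.TTheory GRing.Theory Num.Theory.
Import numFieldNormedType.Exports.
Local Open Scope classical_set_scope.
Local Open Scope ring_scope.
Local Open Scope complex_scope.
Local Notation Re := complex.Re.
Local Notation Im := complex.Im.

(* On the critical line s = 1/2 - iz, z real, the functional equation makes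
   xi(s) real and xi'(s) imaginary. Hence H := (1 + Theta#)/2 = xi / (xi - xi')
   satisfies |H| <= 1 and |H - 1| <= 1. Off the zeros of xi,
   zeta'/zeta = xi'/xi - A with A the logarithmic derivative of the factor of
   zeta in xi, and H xi'/xi = H - 1; so with e_t(z) = (e^(-izt) - 1)/(iz) and
   P_t = R_t + e_t zeta'/zeta one gets S_t = i (H R_t + (H - 1) e_t - H A e_t).
   The factors R_t and e_t are continuous on the real line and, like A e_t,
   they are O(|z|^(-3/4)) uniformly for t in the support of phi, because A is
   O(|z|^(1/4)). Integrating against phi gives a continuous function of size
   O(|z|^(-3/4)).
   On the strip 0 < Re s < 1, up to the factor s (s - 1)/2, xi is the Mellin
   transform at s/2 of omega(x) - x^(-1/2)/2, where
   omega(x) = sum_(n >= 1) exp(-pi n^2 x). The functional equation of omega is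
   obtained by Polya's argument: the discrete Fourier transform of the binomial
   coefficients 'C(2m, k) is a finite identity, and the local limit theorem
   turns it into the theta identity as m tends to infinity. *)

(** * Complex modulus, limits and derivatives *)

(** The obstacle is the factor zeta'/zeta, which has poles at the zeros of zeta on the critical
    line. It is met by working with punctured limits: at every real z, S_t is a limit equal to a
    combination of continuous functions with three weights that do not depend on t. This gives
    bounds uniform in t and measurability in t; and a function given by punctured limits at every
    point is automatically continuous, zeros of xi included. The case of xi vanishing identically
    near a point is treated rather than excluded. The exponent 3/4 comes from writing |n + a| as |n
    + a|^(1/4) |n + a|^(3/4), which leaves a convergent sum of n^(-5/4); what counts is 2 * 3/4 > 1.
    In 0 < Re s < 1 the Dirichlet series of zeta diverges and omega has no Mellin transform at s/2.
    Both defects disappear for the alternating series (1 - 2^(1-s)) zeta(s), that is, for omega(x) -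
    2 omega(4x): the terms x^(-1/2)/2 cancel, and the partial sums of the kernel are dominated by
    exp(-pi x). *)

Section ComplexModulus.
Context {R : realType}.
Local Notation C := R[i].
Implicit Types z w : C.

(** The norm of [R[i]] takes its values in [R[i]], whose order is partial. [cabs] is the same number
    in [R], where [lra], squeezing and integrals are available. *)
Definition cabs z : R := Num.sqrt (Re z ^+ 2 + Im z ^+ 2).

Lemma cabsE z : `|z| = (cabs z)%:C.
Proof. exact: normc_def. Qed.

Lemma cabs_ge0 z : 0 <= cabs z. Proof. exact: sqrtr_ge0. Qed.

Lemma cabs0 : cabs 0 = 0.
Proof. by apply: complexI; rewrite -cabsE normr0. Qed.

Lemma cabs1 : cabs 1 = 1.
Proof. by apply: complexI; rewrite -cabsE normr1. Qed.

Lemma cabsM z w : cabs (z * w) = cabs z * cabs w.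
Proof. by apply: complexI; rewrite rmorphM /= -!cabsE normrM. Qed.

Lemma cabsN z : cabs (- z) = cabs z.
Proof. by apply: complexI; rewrite -!cabsE normrN. Qed.

Lemma cabs_sub z w : cabs (z - w) = cabs (w - z).
Proof. by rewrite -cabsN opprB. Qed.

Lemma cabsV z : cabs z^-1 = (cabs z)^-1.
Proof. by apply: complexI; rewrite fmorphV /= -!cabsE normfV. Qed.

Lemma cabsX z n : cabs (z ^+ n) = cabs z ^+ n.
Proof. by apply: complexI; rewrite rmorphXn /= -!cabsE normrX. Qed.

Lemma cabsD z w : cabs (z + w) <= cabs z + cabs w.
Proof. by rewrite -lecR rmorphD /= -!cabsE ler_normD. Qed.

Lemma cabsB z w : cabs (z - w) <= cabs z + cabs w.
Proof. by rewrite -lecR rmorphD /= -!cabsE ler_normB. Qed.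

Lemma cabs_dist z w : `|cabs z - cabs w| <= cabs (z - w).
Proof.
rewrite ler_norml lerBlDr lerNl opprB; apply/andP; split.
  by rewrite lerBlDr addrC -[X in X <= _]cabsN -[in leRHS](cabsN z);
     have := cabsD (z - w) (- z); rewrite addrAC subrr add0r cabsN addrC.
by have := cabsD (z - w) w; rewrite subrK.
Qed.

Lemma cabs_real (x : R) : cabs x%:C = `|x|.
Proof. by rewrite /cabs /= expr0n addr0 sqrtr_sqr. Qed.

Lemma cabs_nat n : cabs n%:R = n%:R.
Proof. by rewrite -(rmorph_nat (real_complex R)) cabs_real normr_nat. Qed.

Lemma cabsJ z : cabs z^* = cabs z.
Proof. by case: z => a b; rewrite /cabs /= sqrrN. Qed.

Lemma cabs_eq0 z : (cabs z == 0) = (z == 0).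
Proof. by rewrite -(inj_eq (@complexI R)) -cabsE normr_eq0. Qed.

Lemma cabs_gt0 z : (0 < cabs z) = (z != 0).
Proof. by rewrite lt_def cabs_ge0 andbT cabs_eq0. Qed.

Lemma cabs_Re z : `|Re z| <= cabs z.
Proof. by rewrite -sqrtr_sqr ler_wsqrtr // lerDl sqr_ge0. Qed.

Lemma cabs_Im z : `|Im z| <= cabs z.
Proof. by rewrite -sqrtr_sqr ler_wsqrtr // lerDr sqr_ge0. Qed.

Lemma cabs_ReIm z : cabs z <= `|Re z| + `|Im z|.
Proof.
rewrite {1}[z]complexE; apply: (le_trans (cabsD _ _)).
by rewrite cabsM !cabs_real /cabs /= expr0n expr1n add0r sqrtr1 mul1r.
Qed.

Lemma cabs_i : cabs 'i%C = 1.
Proof. by rewrite /cabs /= expr0n expr1n add0r sqrtr1. Qed.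

Lemma cabs_sum (I : Type) (r : seq I) (P : pred I) (F : I -> C) :
  cabs (\sum_(i <- r | P i) F i) <= \sum_(i <- r | P i) cabs (F i).
Proof.
elim/big_rec2: _ => [|i x y _ h]; first by rewrite cabs0.
by apply: (le_trans (cabsD _ _)); rewrite lerD2l.
Qed.

Lemma cabs_sqr z : cabs z ^+ 2 = Re z ^+ 2 + Im z ^+ 2.
Proof. by rewrite sqr_sqrtr // addr_ge0 ?sqr_ge0. Qed.

Lemma ReD z w : Re (z + w) = Re z + Re w. Proof. by case: z; case: w. Qed.
Lemma ImD z w : Im (z + w) = Im z + Im w. Proof. by case: z; case: w. Qed.
Lemma ReN z : Re (- z) = - Re z. Proof. by case: z. Qed.
Lemma ImN z : Im (- z) = - Im z. Proof. by case: z. Qed.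
Lemma ReM z w : Re (z * w) = Re z * Re w - Im z * Im w.
Proof. by case: z; case: w. Qed.
Lemma ImM z w : Im (z * w) = Re z * Im w + Im z * Re w.
Proof. by case: z; case: w. Qed.
Lemma ReZ (x : R) w : Re (x%:C * w) = x * Re w.
Proof. by rewrite ReM /= mul0r subr0. Qed.
Lemma ImZ (x : R) w : Im (x%:C * w) = x * Im w.
Proof. by rewrite ImM /= mul0r addr0. Qed.
Lemma ReJ z : Re z^* = Re z. Proof. by case: z. Qed.
Lemma ImJ z : Im z^* = - Im z. Proof. by case: z. Qed.
Lemma Re_sum (I : Type) (r : seq I) (P : pred I) (F : I -> C) :
  Re (\sum_(i <- r | P i) F i) = \sum_(i <- r | P i) Re (F i).
Proof. by elim/big_rec2: _ => // i x y _ <-; rewrite ReD. Qed.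
Lemma Im_sum (I : Type) (r : seq I) (P : pred I) (F : I -> C) :
  Im (\sum_(i <- r | P i) F i) = \sum_(i <- r | P i) Im (F i).
Proof. by elim/big_rec2: _ => // i x y _ <-; rewrite ImD. Qed.
Lemma complexP z w : Re z = Re w -> Im z = Im w -> z = w.
Proof. by case: z => a b; case: w => c d /= -> ->. Qed.
Lemma ReImE (z : C) : z = Re z +i* Im z. Proof. by case: z. Qed.

(** Balls of [R[i]] have radii in [R[i]]. A positive element there has zero imaginary part, so real
    radii describe the same neighbourhoods. *)
Lemma nbhsCP z (P : set C) : nbhs z P <->
  exists2 e : R, 0 < e & forall w, cabs (w - z) < e -> P w.
Proof.
rewrite nbhs_ballP; split=> [[e /= e0 h]|[e e0 h]].
  have := e0; rewrite ltcE /= => /andP[/eqP ei er]; exists (Re e) => // w hw.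
  apply: h; rewrite -ball_normE /= distrC cabsE [e in _ < e]ReImE ei complexr0.
  by rewrite ltcR.
exists e%:C; first by rewrite /= ltcR.
by move=> w; rewrite -ball_normE /= distrC cabsE ltcR; exact: h.
Qed.

Lemma dnbhsCP z (P : set C) : nbhs z^' P <->
  exists2 e : R, 0 < e & forall w, w != z -> cabs (w - z) < e -> P w.
Proof.
rewrite /dnbhs /within /=.
split; first by move=> /nbhsCP[e e0 h]; exists e => // w wz hw; exact: h.
by move=> [e e0 h]; apply/nbhsCP; exists e => // w hw wz; exact: h.
Qed.

Lemma cvgCP {T : Type} (F : set_system T) {FF : Filter F} (f : T -> C) (l : C) :
  f @ F --> l <-> forall e : R, 0 < e -> \forall x \near F, cabs (f x - l) < e.
Proof.
rewrite cvgrPdist_lt; split => h e e0.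
  have /h : 0 < e%:C by rewrite ltcR.
  by apply: filterS => x; rewrite distrC cabsE ltcR.
have := e0; rewrite ltcE /= => /andP[/eqP ei er].
have := h _ er; apply: filterS => x hx.
by rewrite distrC cabsE [e]ReImE ei complexr0 ltcR.
Qed.

Lemma cvgC_dist {T : Type} (F : set_system T) {FF : Filter F} (f : T -> C) (l : C) :
  f @ F --> l <-> cabs (f x - l) @[x --> F] --> (0 : R).
Proof.
rewrite cvgCP cvgrPdist_lt; split => h e /h; apply: filterS => x;
  by rewrite sub0r normrN ger0_norm ?cabs_ge0.
Qed.

Lemma cvgC_ReIm {T : Type} (F : set_system T) {FF : Filter F} (f : T -> C) (l : C) :
  f @ F --> l <->
  (Re (f x) @[x --> F] --> Re l) /\ (Im (f x) @[x --> F] --> Im l).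
Proof.
rewrite cvgC_dist; split => [h|[h1 h2]].
  split; apply/cvgrPdist_lt => e e0; move/cvgrPdist_lt : h => /(_ e e0);
  apply: filterS => x; rewrite sub0r normrN (ger0_norm (cabs_ge0 _)) => h;
  rewrite distrC; apply: le_lt_trans h.
    by rewrite -ReN -ReD cabs_Re.
  by rewrite -ImN -ImD cabs_Im.
apply/cvgrPdist_lt => e e0; have e20 : 0 < e / 2 by rewrite divr_gt0.
move/cvgrPdist_lt : h1 => /(_ _ e20) h1; move/cvgrPdist_lt : h2 => /(_ _ e20) h2.
near=> x; rewrite sub0r normrN (ger0_norm (cabs_ge0 _)).
apply: (le_lt_trans (cabs_ReIm _)); rewrite ReD ImD ReN ImN.
rewrite [e]splitr ltrD // distrC; near: x; [exact: h1|exact: h2].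
Unshelve. all: by end_near. Qed.

Lemma cvgC_Re {T : Type} (F : set_system T) {FF : Filter F} (f : T -> C) (l : C) :
  f @ F --> l -> Re (f x) @[x --> F] --> Re l.
Proof. by move/cvgC_ReIm => []. Qed.

Lemma cvgC_Im {T : Type} (F : set_system T) {FF : Filter F} (f : T -> C) (l : C) :
  f @ F --> l -> Im (f x) @[x --> F] --> Im l.
Proof. by move/cvgC_ReIm => []. Qed.

Lemma cvgC_cabs {T : Type} (F : set_system T) {FF : Filter F} (f : T -> C) (l : C) :
  f @ F --> l -> cabs (f x) @[x --> F] --> cabs l.
Proof.
move/cvgCP => h; apply/cvgrPdist_lt => e /h; apply: filterS => x hx.
by apply: le_lt_trans hx; rewrite distrC cabs_dist.
Qed.

Lemma cvgC_conj {T : Type} (F : set_system T) {FF : Filter F} (f : T -> C) (l : C) :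
  f @ F --> l -> (f x)^* @[x --> F] --> l^*.
Proof.
by move/cvgCP => h; apply/cvgCP => e /h; apply: filterS => x; rewrite -rmorphB cabsJ.
Qed.

Lemma cvgC_real {T : Type} (F : set_system T) {FF : Filter F} (f : T -> R) (l : R) :
  f @ F --> l -> (f x)%:C @[x --> F] --> l%:C.
Proof.
by move=> h; apply/cvgC_ReIm; split => //=; exact: cvg_cst.
Qed.

Lemma limC {T : Type} (F : set_system T) {FF : ProperFilter F} (f : T -> C) (l : C) :
  f @ F --> l -> lim (f @ F) = l.
Proof. by move=> h; exact: cvg_lim. Qed.

Lemma cvgC_uniq {T : Type} (F : set_system T) {FF : ProperFilter F} (f : T -> C)
  (l l' : C) : f @ F --> l -> f @ F --> l' -> l = l'.
Proof. by move=> /limC<- /limC. Qed.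

Lemma cvgC_squeeze {T : Type} (F : set_system T) {FF : Filter F} (f : T -> C) (l : C)
  (g : T -> R) : (\forall x \near F, cabs (f x - l) <= g x) ->
  g @ F --> (0 : R) -> f @ F --> l.
Proof.
move=> h /cvgrPdist_lt g0; apply/cvgCP => e e0.
apply: filterS2 h (g0 e e0) => x h1; rewrite sub0r normrN => h2.
by apply: le_lt_trans h1 _; apply: le_lt_trans h2; exact: ler_norm.
Qed.

Lemma cvgC_eq_near {T : Type} (F : set_system T) {FF : Filter F} (f g : T -> C) (l : C) :
  (\forall x \near F, f x = g x) -> f @ F --> l -> g @ F --> l.
Proof.
move=> h /cvgCP fl; apply/cvgCP => e e0; apply: filterS2 h (fl e e0) => x -> //.
Qed.

#[global] Instance dnbhsC_proper z : ProperFilter z^'.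
Proof. exact: Proper_dnbhs_numFieldType. Qed.

#[global] Instance dnbhsC_filter z : Filter z^'.
Proof. exact: dnbhsC_proper. Qed.

Lemma cvgC_nbhs (f : C -> C) z l : f w @[w --> z] --> l <->
  forall e : R, 0 < e -> exists2 r : R, 0 < r &
    forall w, cabs (w - z) < r -> cabs (f w - l) < e.
Proof.
split=> [/(@cvgCP _ (nbhs z) _ f l).1 h e /h /nbhsCP|h]; first exact.
by apply: (@cvgCP _ (nbhs z) _ f l).2 => e /h /nbhsCP.
Qed.

Lemma cvgC_dnbhs (f : C -> C) z l : f w @[w --> z^'] --> l <->
  forall e : R, 0 < e -> exists2 r : R, 0 < r &
    forall w, w != z -> cabs (w - z) < r -> cabs (f w - l) < e.
Proof.
split=> [/(@cvgCP _ z^' _ f l).1 h e /h /dnbhsCP|h]; first exact.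
by apply: (@cvgCP _ z^' _ f l).2 => e /h /dnbhsCP.
Qed.

Lemma cvgCD {T : Type} {F : set_system T} {FF : Filter F} (f g : T -> C) (a b : C) :
  f @ F --> a -> g @ F --> b -> (f x + g x) @[x --> F] --> a + b.
Proof. by move=> h1 h2; exact: (cvgD h1 h2). Qed.

Lemma cvgCN {T : Type} {F : set_system T} {FF : Filter F} (f : T -> C) (a : C) :
  f @ F --> a -> (- f x) @[x --> F] --> - a.
Proof. by move=> h1; exact: (cvgN h1). Qed.

Lemma cvgCB {T : Type} {F : set_system T} {FF : Filter F} (f g : T -> C) (a b : C) :
  f @ F --> a -> g @ F --> b -> (f x - g x) @[x --> F] --> a - b.
Proof. by move=> h1 h2; exact: (cvgB h1 h2). Qed.

Lemma cvgCM {T : Type} {F : set_system T} {FF : Filter F} (f g : T -> C) (a b : C) :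
  f @ F --> a -> g @ F --> b -> (f x * g x) @[x --> F] --> a * b.
Proof. by move=> h1 h2; exact: (cvgM h1 h2). Qed.

Lemma cvgCc {T : Type} {F : set_system T} {FF : Filter F} (a : C) :
  (fun _ : T => a) @ F --> a.
Proof. exact: cvg_cst. Qed.
Arguments cvgCc {T F FF} a.

Lemma cvgCV {T : Type} {F : set_system T} {FF : Filter F} (f : T -> C) (a : C) :
  f @ F --> a -> a != 0 -> (f x)^-1 @[x --> F] --> a^-1.
Proof. by move=> h1 h2; exact: (cvgV h2 h1). Qed.

Lemma cvgC_ext {T : Type} {F : set_system T} {FF : Filter F} (f g : T -> C) (l : C) :
  f =1 g -> f @ F --> l -> g @ F --> l.
Proof. by move=> /funext ->. Qed.

Lemma cabs_lim_le {T : Type} {F : set_system T} {FF : ProperFilter F} (f : T -> C)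
    (l : C) (M : R) :
  f @ F --> l -> (\forall x \near F, cabs (f x) <= M) -> cabs l <= M.
Proof.
move=> /cvgCP h fM; rewrite leNgt; apply/negP => Ml.
have e0 : 0 < cabs l - M by rewrite subr_gt0.
have [x [h1 h2]] := filter_ex (filterI (h _ e0) fM).
have := cabs_dist (f x) l; rewrite distrC => /(le_trans (ler_norm _)) /le_lt_trans.
by move=> /(_ _ h1); rewrite ltrD2l ltrN2 ltNge h2.
Qed.

Lemma near_dnbhs z (P : set C) : (\forall w \near z, P w) -> \forall w \near z^', P w.
Proof. by move=> /nbhsCP[e e0 h]; apply/dnbhsCP; exists e => // w _; exact: h. Qed.

(** A relation asserting that the derivative exists and equals [d], whereas [derive1] is a total
    function defined by [lim]; [cderive_val] passes from the former to the latter. *)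
Definition cder (f : C -> C) (z d : C) : Prop :=
  ((f w - f z) / (w - z)) @[w --> z^'] --> d.

Lemma near_dnbhs_neq z : \forall w \near z^', w - z != 0.
Proof. by apply/dnbhsCP; exists 1 => // w; rewrite subr_eq0. Qed.

Lemma cvg_sub0 z : (w - z) @[w --> z^'] --> (0 : C).
Proof. by apply/cvgC_dnbhs => e e0; exists e => // w _; rewrite subr0. Qed.

Lemma cvg_id_dnbhs z : w @[w --> z^'] --> z.
Proof. by apply/cvgC_dnbhs => e e0; exists e. Qed.

Lemma cderive_val (f : C -> C) z d : cder f z d -> derive1 f z = d.
Proof.
move/cvgC_dnbhs => h; rewrite /derive1; apply: limC; apply/cvgC_dnbhs => e e0.
have [r r0 hr] := h _ e0; exists r => // w w0 wr.
have := hr (w + z); rewrite addrK -subr_eq0 addrK => /(_ w0).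
by rewrite subr0 in wr; move=> /(_ wr); rewrite mulrC.
Qed.

Lemma cder_cvg (f : C -> C) z d : cder f z d -> f w @[w --> z^'] --> f z.
Proof.
move=> h; pose proof (cvgCD (cvgCM h (cvg_sub0 z)) (cvgCc (f z))) as H.
move: H; rewrite mulr0 add0r; apply: cvgC_eq_near.
by apply: filterS (near_dnbhs_neq z) => w wz; rewrite mulfVK // subrK.
Qed.

Lemma cvgC_at (f : C -> C) z : f w @[w --> z^'] --> f z -> f w @[w --> z] --> f z.
Proof.
move=> /cvgC_dnbhs h; apply/cvgC_nbhs => e e0.
have [r r0 hr] := h _ e0; exists r => // w wr.
by have [->|wz] := eqVneq w z; [rewrite subrr cabs0|exact: hr].
Qed.

Lemma cder_continuous (f : C -> C) z d : cder f z d -> f w @[w --> z] --> f z.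
Proof. by move/cder_cvg/cvgC_at. Qed.

Lemma cder_near (f g : C -> C) z d : (\forall w \near z, f w = g w) ->
  cder f z d -> cder g z d.
Proof.
move=> h; have [r r0 hr] := (nbhsCP _ _).1 h.
have fg : f z = g z by apply: hr; rewrite subrr cabs0.
apply: cvgC_eq_near; apply/dnbhsCP; exists r => // w _ /hr ->.
by rewrite fg.
Qed.

Lemma cder_cst (a : C) z : cder (fun=> a) z 0.
Proof.
apply: (cvgC_eq_near _ (cvgCc 0)).
by apply: filterS (near_dnbhs_neq z) => w _; rewrite subrr mul0r.
Qed.

Lemma cder_id z : cder (fun w => w) z 1.
Proof.
rewrite /cder; apply: (cvgC_eq_near _ (cvgCc 1)).
by apply: filterS (near_dnbhs_neq z) => w wz; rewrite mulfV.
Qed.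

Lemma cderD (f g : C -> C) z a b : cder f z a -> cder g z b ->
  cder (fun w => f w + g w) z (a + b).
Proof.
move=> h1 h2; apply: cvgC_eq_near (cvgCD h1 h2).
by apply: filterS (near_dnbhs_neq z) => w wz; rewrite -mulrDl opprD addrACA.
Qed.

Lemma cderM (f g : C -> C) z a b : cder f z a -> cder g z b ->
  cder (fun w => f w * g w) z (a * g z + f z * b).
Proof.
move=> h1 h2; pose proof (cvgCD (cvgCM h1 (cder_cvg h2)) (cvgCM (cvgCc (f z)) h2)) as H; move: H.
apply: cvgC_eq_near; apply: filterS (near_dnbhs_neq z) => w wz.
by move: (_^-1) => v; ring.
Qed.

Lemma cderZ (f : C -> C) z a (c : C) : cder f z a -> cder (fun w => c * f w) z (c * a).
Proof. by move=> h; have := cderM (cder_cst c z) h; rewrite mul0r add0r. Qed.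

Lemma cderN (f : C -> C) z a : cder f z a -> cder (fun w => - f w) z (- a).
Proof.
move=> /(@cderZ _ _ _ (-1)); rewrite mulN1r; congr (cder _ _ _).
by apply/funext => w; rewrite mulN1r.
Qed.

Lemma cderB (f g : C -> C) z a b : cder f z a -> cder g z b ->
  cder (fun w => f w - g w) z (a - b).
Proof. by move=> h1 h2; exact: (cderD h1 (cderN h2)). Qed.

Lemma cvgC_neq0 {T : Type} (F : set_system T) {FF : Filter F} (f : T -> C) (l : C) :
  f @ F --> l -> l != 0 -> \forall x \near F, f x != 0.
Proof.
move=> h l0; move/cvgCP : h => /(_ (cabs l)); rewrite cabs_gt0 => /(_ l0).
by apply: filterS => w; apply: contraTneq => ->; rewrite sub0r cabsN ltxx.
Qed.

Lemma cderV (f : C -> C) z a : cder f z a -> f z != 0 ->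
  cder (fun w => (f w)^-1) z (- a / f z ^+ 2).
Proof.
move=> h fz0.
have cf := cder_cvg h.
pose proof (cvgC_neq0 cf fz0) as nz.
have ff0 : f z * f z != 0 by rewrite mulf_neq0.
have : (- ((f w - f z) / (w - z)) * (f w * f z)^-1) @[w --> z^'] --> - a / f z ^+ 2.
  rewrite expr2; apply: cvgCM; first exact: (cvgCN h).
  exact: (cvgCV (cvgCM cf (cvgCc (f z))) ff0).
apply: cvgC_eq_near; apply: filterS2 nz (near_dnbhs_neq z) => w wnz wz.
by field; rewrite fz0 wnz wz.
Qed.

Lemma cderMV (f g : C -> C) z a b : cder f z a -> cder g z b -> g z != 0 ->
  cder (fun w => f w / g w) z (a / g z - f z * b / g z ^+ 2).
Proof.
move=> h1 h2 g0; have := cderM h1 (cderV h2 g0).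
by rewrite mulNr mulrN mulrA.
Qed.

Lemma cder_affine (f : C -> C) (a b : C) z d : cder f (a * z + b) d ->
  cder (fun w => f (a * w + b)) z (a * d).
Proof.
have [-> _|a0] := eqVneq a 0.
  rewrite mul0r; have -> : (fun w => f (0 * w + b)) = (fun=> f b).
    by apply/funext => w; rewrite mul0r add0r.
  exact: cder_cst.
move=> /cvgC_dnbhs h; apply/cvgC_dnbhs => e e0.
have ea : 0 < e / cabs a by rewrite divr_gt0 // cabs_gt0.
have [r r0 hr] := h _ ea.
 exists (r / cabs a); first by rewrite divr_gt0 // cabs_gt0.
move=> w wz; rewrite ltr_pdivlMr ?cabs_gt0 // => wr.
have wz' : w - z != 0 by rewrite subr_eq0.
have E : a * w + b - (a * z + b) = a * (w - z) by ring.
have := hr (a * w + b); rewrite -subr_eq0 E cabsM [cabs a * _]mulrC mulf_neq0 // => /(_ isT wr).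
rewrite ltr_pdivlMr ?cabs_gt0 // -cabsM => h3.
suff -> : (f (a * w + b) - f (a * z + b)) / (w - z) - a * d =
  ((f (a * w + b) - f (a * z + b)) / (a * (w - z)) - d) * a by [].
by field; rewrite a0 wz'.
Qed.

End ComplexModulus.

Arguments cvgCc {R T F FF} a.

(** * Complex series *)

Section ComplexSeries.
Context {R : realType}.
Local Notation C := R[i].
Implicit Types (u v : nat -> C) (b : nat -> R).

Definition csum u : C := lim (series u @ \oo).

Lemma seriesC_sum u n : series u n = \sum_(k < n) u k.
Proof. by rewrite /series /= big_mkord. Qed.

Lemma Re_series u n : Re (series u n) = series (fun k => Re (u k)) n.
Proof. by rewrite !seriesEnat /= Re_sum. Qed.

Lemma Im_series u n : Im (series u n) = series (fun k => Im (u k)) n.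
Proof. by rewrite !seriesEnat /= Im_sum. Qed.

Lemma csum_cvg u b : (forall n, cabs (u n) <= b n) -> cvgn (series b) ->
  series u @ \oo --> csum u.
Proof.
move=> ub cb.
have cf (f : C -> R) : (forall z, `|f z| <= cabs z) -> cvgn (series (f \o u)).
  move=> fz; apply: normed_cvg; apply: series_le_cvg cb => n //=.
    by apply: (le_trans _ (ub n)); exact: cabs_ge0.
  exact: le_trans (fz _) (ub n).
have /cvg_ex[a ha] := cf _ (@cabs_Re R).
have /cvg_ex[c hc] := cf _ (@cabs_Im R).
suff h : series u @ \oo --> (a +i* c) by rewrite /csum (limC h).
apply/cvgC_ReIm; split => /=.
  by under eq_fun do rewrite Re_series.
by under eq_fun do rewrite Im_series.
Qed.

Lemma csum_tail u b N : (forall n, cabs (u n) <= b n) -> cvgn (series b) ->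
  cabs (csum u - series u N) <= limn (series b) - series b N.
Proof.
move=> ub cb.
have h1 : cabs (series u n - series u N) @[n --> \oo] --> cabs (csum u - series u N).
  by apply: cvgC_cabs; apply: cvgCB; [exact: (csum_cvg ub cb)|exact: cvgCc].
have h2 : (series b n - series b N) @[n --> \oo] --> limn (series b) - series b N.
  by apply: cvgB; [exact: cb|exact: cvg_cst].
apply: (ler_cvg_to h1 h2); near=> n.
have nN : (N <= n)%N by near: n; exact: nbhs_infty_ge.
rewrite !sub_series_geq //; apply: le_trans (cabs_sum _ _ _) _.
exact: ler_sum.
Unshelve. all: by end_near. Qed.

Lemma csum_le u b : (forall n, cabs (u n) <= b n) -> cvgn (series b) ->
  cabs (csum u) <= limn (series b).
Proof.
move=> ub cb; have := csum_tail 0 ub cb.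
by rewrite /series /= !big_geq // !subr0.
Qed.

Lemma csum_eq u (l : C) : series u @ \oo --> l -> csum u = l.
Proof. exact: limC. Qed.

Lemma csumZ u b (a : C) : (forall n, cabs (u n) <= b n) -> cvgn (series b) ->
  csum (fun n => a * u n) = a * csum u.
Proof.
move=> ub cb; apply: csum_eq; apply: cvgC_ext (cvgCM (cvgCc a) (csum_cvg ub cb)) => n.
by rewrite !seriesEnat /= big_distrr.
Qed.

Lemma csumB u v b b' : (forall n, cabs (u n) <= b n) -> cvgn (series b) ->
  (forall n, cabs (v n) <= b' n) -> cvgn (series b') ->
  csum (fun n => u n - v n) = csum u - csum v.
Proof.
move=> ub cb vb cb'; apply: csum_eq.
apply: cvgC_ext (cvgCB (csum_cvg ub cb) (csum_cvg vb cb')) => n.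
by rewrite !seriesEnat /= sumrB.
Qed.

Lemma csum_recl u b : (forall n, cabs (u n) <= b n) -> cvgn (series b) ->
  csum u = u 0%N + csum (fun n => u n.+1).
Proof.
move=> ub cb.
have h : series (fun n => u n.+1) @ \oo --> csum u - u 0%N.
  have h := csum_cvg ub cb; rewrite -cvg_shiftS /= in h.
  apply: cvgC_ext (cvgCB h (cvgCc (u 0%N))) => n.
  by rewrite !seriesEnat /= big_nat_recl // addrAC subrr add0r.
by rewrite (csum_eq h) addrC subrK.
Qed.

(** Tannery's theorem: a common summable bound reduces the limit to that of finitely many terms, at
    the cost of two tails. It serves to differentiate power series, for the continuity of [Msum]
    and, through [rsum_dominated], for theta. *)
Lemma csum_dominated {T : Type} (F : set_system T) {FF : ProperFilter F}
    (a : T -> nat -> C) (l : nat -> C) b :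
  (\forall x \near F, forall n, cabs (a x n) <= b n) -> cvgn (series b) ->
  (forall n, a x n @[x --> F] --> l n) ->
  csum (a x) @[x --> F] --> csum l.
Proof.
move=> ab cb al.
have lb n : cabs (l n) <= b n.
  by apply: (cabs_lim_le (al n)); apply: filterS ab => x.
apply/cvgCP => e e0; have e30 : 0 < e / 3 by rewrite divr_gt0.
have [N _ /(_ N (leqnn N)) /= hN] :
    \forall N \near \oo, limn (series b) - series b N < e / 3.
  have /cvgrPdist_lt/(_ _ e30) := cb; apply: filterS => N.
  exact: le_lt_trans (ler_norm _).
have sl : series (a x) N @[x --> F] --> series l N.
  elim: N {hN} => [|n IH].
    rewrite /series /=; under eq_fun do rewrite big_geq //.
    by rewrite big_geq //; exact: cvgCc.
  rewrite seriesSr; under eq_fun do rewrite seriesSr.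
  by apply: cvgCD; [exact: IH|exact: al].
move/cvgCP : sl => /(_ _ e30) sl.
apply: filterS2 ab sl => x abx slx.
have -> : csum (a x) - csum l = (csum (a x) - series (a x) N) +
   (series (a x) N - series l N) - (csum l - series l N) by ring.
have -> : e = e / 3 + e / 3 + e / 3 by field.
apply: (le_lt_trans (cabsB _ _)); apply: ltrD.
  apply: (le_lt_trans (cabsD _ _)); apply: ltrD => //.
  exact: le_lt_trans (csum_tail N abx cb) hN.
exact: le_lt_trans (csum_tail N lb cb) hN.
Qed.

Lemma cvg_series_geometric2 (M : R) : cvgn (series (fun n => M * 2^-1 ^+ n)).
Proof.
by apply: is_cvg_geometric_series; rewrite ger0_norm ?invr_ge0 // invf_lt1 // ltr1n.
Qed.

End ComplexSeries.

Arguments cvg_series_geometric2 {R} M [t] _.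

(** * Power series and analytic functions *)

Section PowerSeries.
Context {R : realType}.
Local Notation C := R[i].
Implicit Types (c : nat -> C) (r M : R) (h z w : C).

Definition pser c h : C := csum (fun n => c n * h ^+ n).

(** A Cauchy-type estimate that replaces the radius of convergence: on the disc of radius [r / 2]
    the terms are dominated by [M * 2^-n], whatever the point. *)
Definition pbound c r M : Prop := 0 < r /\ forall n, cabs (c n) * r ^+ n <= M.

Lemma pbound_ge0 c r M : pbound c r M -> 0 <= M.
Proof. by move=> [r0 /(_ 0%N)]; apply: le_trans; rewrite mulr_ge0 ?cabs_ge0 // exprn_ge0 // ltW. Qed.

Lemma pser_term c r M h n : pbound c r M -> cabs h <= r / 2 ->
  cabs (c n * h ^+ n) <= M * 2^-1 ^+ n.
Proof.
move=> [r0 cM] hr; rewrite cabsM cabsX.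
apply: (@le_trans _ _ (cabs (c n) * (r / 2) ^+ n)).
  by rewrite ler_wpM2l ?cabs_ge0 // lerXn2r // nnegrE ?cabs_ge0 // divr_ge0 // ltW.
by rewrite exprMn mulrA ler_wpM2r // exprn_ge0 // invr_ge0.
Qed.

Lemma pser_cvg c r M h : pbound c r M -> cabs h <= r / 2 ->
  series (fun n => c n * h ^+ n) @ \oo --> pser c h.
Proof.
move=> cM hr; exact: (csum_cvg (fun n => pser_term n cM hr) (cvg_series_geometric2 M)).
Qed.

Lemma pser0 c : pser c 0 = c 0%N.
Proof.
apply: csum_eq; rewrite -cvg_shiftS /=.
apply: cvgC_ext (cvgCc (c 0%N)) => n.
rewrite seriesEnat /= big_nat_recl // expr0 mulr1 big1 ?addr0 // => i _.
by rewrite expr0n mulr0.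
Qed.

Lemma pbound_shift c r M m : pbound c r M ->
  pbound (fun n => c (m + n)%N) r (M / r ^+ m).
Proof.
move=> [r0 cM]; split => // n.
by rewrite ler_pdivlMr ?exprn_gt0 // -mulrA -exprD addnC.
Qed.

Lemma natr_le_exp2 n : n%:R <= 2 ^+ n :> R.
Proof. by rewrite -natrX ler_nat ltnW // ltn_expl. Qed.

Definition dcoef c n : C := n.+1%:R * c n.+1.

(** Halving the radius absorbs the factor [n + 1], since [n + 1 <= 2 ^ (n + 1)]. *)
Lemma pbound_deriv c r M : pbound c r M -> pbound (dcoef c) (r / 2) (2 * M / r).
Proof.
move=> [r0 cM]; split=> [|n]; first by rewrite divr_gt0.
rewrite cabsM cabs_nat exprMn.
have -> : n.+1%:R * cabs (c n.+1) * (r ^+ n * 2^-1 ^+ n) =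
  (n.+1%:R / 2 ^+ n.+1) * 2 * (cabs (c n.+1) * r ^+ n.+1) / r.
  rewrite exprVn !exprS; field.
  by rewrite gt_eqF //= expf_neq0.
rewrite ler_pM2r ?invr_gt0 //; apply: ler_pM => //.
  by rewrite mulr_ge0 ?cabs_ge0 // exprn_ge0 // ltW.
by rewrite ler_piMl // ler_pdivrMr ?exprn_gt0 // mul1r natr_le_exp2.
Qed.

Lemma cder_exp n z : cder (fun w => w ^+ n) z (n%:R * z ^+ n.-1).
Proof.
elim: n => [|n IH].
  rewrite mul0r; apply: (cder_near _ (cder_cst 1 z)).
  by apply/nbhsCP; exists 1.
have := cderM (cder_id z) IH.
rewrite /= mul1r; have -> : z ^+ n + z * (n%:R * z ^+ n.-1) = n.+1%:R * z ^+ n.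
  case: n {IH} => [|n] /=; first by rewrite mul0r mulr0 addr0 mul1r.
  by rewrite -[n.+2%:R]natr1 mulrDl mul1r addrC [z ^+ n.+1]exprS; ring.
apply: cder_near; apply/nbhsCP; exists 1 => // w _.
by rewrite exprS.
Qed.

Lemma cabs_divX w z n (r : R) : w - z != 0 -> cabs w <= r -> cabs z <= r ->
  cabs ((w ^+ n - z ^+ n) / (w - z)) <= n%:R * r ^+ n.-1.
Proof.
move=> wz wr zr; rewrite subrXX mulrAC divff // mul1r.
apply: (le_trans (cabs_sum _ _ _)).
have -> : n%:R * r ^+ n.-1 = \sum_(i < n) r ^+ n.-1.
  by rewrite sumr_const card_ord -[RHS]mulr_natl.
apply: ler_sum => i _; rewrite cabsM !cabsX.
have ni : (n.-1 = n.-1 - i + i)%N by rewrite subnK //; case: n i => [[]|n i] //=; rewrite -ltnS.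
rewrite [in leRHS]ni exprD; have r0 : 0 <= r by apply: le_trans wr; exact: cabs_ge0.
by apply: ler_pM; rewrite ?exprn_ge0 ?cabs_ge0 // lerXn2r ?nnegrE ?cabs_ge0.
Qed.

(** Tannery's theorem applied to difference quotients: on the disc of radius [r / 4] the quotient of
    [h ^ n] is at most [n (r / 4) ^ (n - 1)] by [cabs_divX]. Of the two factors [2^-n] contained in
    [4^-n], one pays for [n] and the other makes the bound summable. *)
Lemma pser_cder c r M h : pbound c r M -> cabs h < r / 4 ->
  cder (pser c) h (pser (dcoef c) h).
Proof.
move=> cM hr; have r0 := cM.1.
have r4 : 0 < r / 4 by rewrite divr_gt0.
have r42 x : x < r / 4 -> x <= r / 2.
  by move=> /ltW xr; apply: (le_trans xr); rewrite ler_pM2l // lef_pV2 ?posrE // ler_nat.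
pose a w n := c n * ((w ^+ n - h ^+ n) / (w - h)).
pose l n := c n * (n%:R * h ^+ n.-1).
pose b n := 4 * M / r * 2^-1 ^+ n.
have cb : cvgn (series b) := cvg_series_geometric2 (4 * M / r).
have bn n : cabs (c n) * (n%:R * (r / 4) ^+ n.-1) <= b n.
  case: n => [|n]; first by rewrite mul0r mulr0 /b expr0 mulr1 divr_ge0 ?mulr_ge0 ?(pbound_ge0 cM) ?ltW.
  have -> : cabs (c n.+1) * (n.+1%:R * (r / 4) ^+ n.+1.-1) =
    4 / r * (cabs (c n.+1) * r ^+ n.+1 * (n.+1%:R / 2 ^+ n.+1)) * 2^-1 ^+ n.+1.
    rewrite /= !exprMn !exprVn !exprS.
    have -> : (4 : R) = 2 * 2 by rewrite -natrM.
    rewrite exprMn; have t0 : (2 : R) ^+ n != 0 by rewrite expf_neq0.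
    move: t0; set t := 2 ^+ n => t0.
    by field; rewrite ?t0 ?gt_eqF.
  rewrite /b ler_wpM2r ?exprn_ge0 ?invr_ge0 // [4 * M / r]mulrAC ler_wpM2l //.
    by rewrite divr_ge0 // ltW.
  apply: (@le_trans _ _ (M * 1)); last by rewrite mulr1.
  apply: ler_pM; [|by rewrite divr_ge0|exact: cM.2|].
    by rewrite mulr_ge0 ?cabs_ge0 // exprn_ge0 // ltW.
  by rewrite ltW // ltr_pdivrMr ?exprn_gt0 // mul1r -natrX ltr_nat ltn_expl.
have ab : \forall w \near h^', forall n, cabs (a w n) <= b n.
  apply/dnbhsCP; exists (r / 4 - cabs h); first by rewrite subr_gt0.
  move=> w wh whr n; rewrite -subr_eq0 in wh.
  have wr : cabs w <= r / 4.
    have -> : w = (w - h) + h by rewrite subrK.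
    by apply: (le_trans (cabsD _ _)); rewrite -lerBrDr ltW.
  rewrite /a cabsM; apply: le_trans (bn n); rewrite ler_wpM2l ?cabs_ge0 //.
  by apply: cabs_divX => //; exact: ltW.
have al n : a w n @[w --> h^'] --> l n.
  by apply: cvgCM; [exact: cvgCc|exact: cder_exp].
pose proof (csum_dominated ab cb al) as H; move: H.
have lb n : cabs (l n) <= b n.
  apply: le_trans (bn n); rewrite /l !cabsM cabs_nat cabsX.
  rewrite !ler_wpM2l ?cabs_ge0 // lerXn2r // ?nnegrE ?cabs_ge0 ?ltW //.
have -> : csum l = pser (dcoef c) h.
  rewrite (csum_recl lb cb) {1}/l mul0r mulr0 add0r; congr csum; apply/funext => n.
  by rewrite /l /dcoef /= mulrCA mulrA.
apply: cvgC_eq_near.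
apply/dnbhsCP; exists (r / 4 - cabs h); first by rewrite subr_gt0.
move=> w wh whr; rewrite -subr_eq0 in wh.
have wr : cabs w <= r / 2.
  apply: r42; have -> : w = (w - h) + h by rewrite subrK.
  by apply: (le_lt_trans (cabsD _ _)); rewrite -ltrBrDr.
have hr2 := r42 _ hr.
rewrite /pser -(csumB (fun n => pser_term n cM wr) (cvg_series_geometric2 M)
  (fun n => pser_term n cM hr2) (cvg_series_geometric2 M)) mulrC.
rewrite -(@csumZ _ _ (fun n => M * 2^-1 ^+ n + M * 2^-1 ^+ n)).
- by congr csum; apply/funext => n; rewrite /a -mulrBr; ring.
- move=> n; apply: (le_trans (cabsB _ _)).
  by rewrite lerD // (pser_term n cM).
- under eq_fun do rewrite -mulrDl.
  exact: cvg_series_geometric2.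
Qed.

Lemma pser_pbound (f : C -> C) z c :
  (\forall w \near z, series (fun n => c n * (w - z) ^+ n) @ \oo --> f w) ->
  exists r M, pbound c r M /\ forall h, cabs h <= r / 2 -> f (z + h) = pser c h.
Proof.
move=> /nbhsCP[e e0 he].
(* Convergence at the single point [z + r] bounds the partial sums there, hence the terms
   [c n * r ^ n]. *)
pose r := e / 2; have r0 : 0 < r by rewrite divr_gt0.
have rr : cabs (z + r%:C - z) < e.
  by rewrite addrAC subrr add0r cabs_real gtr0_norm // gtr_pMr // invf_lt1 // ltr1n.
have := he _ rr; rewrite addrAC subrr add0r => hc.
have /cvg_seq_bounded[N [Nr hN]] : cvgn (fun n => cabs (series (fun n => c n * r%:C ^+ n) n)).
  by apply/cvg_ex; eexists; exact: cvgC_cabs hc.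
pose B := N + 1.
have Bn n : cabs (series (fun n => c n * r%:C ^+ n) n) <= B.
  have /hN/(_ n I) /= : N < B by rewrite ltrDl.
  by rewrite ger0_norm // cabs_ge0.
exists r, (2 * B); split.
  split=> // n.
  have -> : cabs (c n) * r ^+ n = cabs (c n * r%:C ^+ n).
    by rewrite cabsM cabsX cabs_real gtr0_norm.
  have -> : c n * r%:C ^+ n = series (fun n => c n * r%:C ^+ n) n.+1 - series (fun n => c n * r%:C ^+ n) n.
    by rewrite !seriesEnat /= big_nat_recr //= addrAC subrr add0r.
  by apply: (le_trans (cabsB _ _)); rewrite mulr_natl mulr2n lerD.
move=> h hr; have : cabs (z + h - z) < e.
  rewrite addrAC subrr add0r; apply: (le_lt_trans hr).
  rewrite /r -mulrA gtr_pMr // -invfM invf_lt1 //.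
  by rewrite -natrM ltr1n.
by move=> /he; rewrite addrAC subrr add0r => /csum_eq <-.
Qed.

Lemma analyticP (f : C -> C) z : analytic_at f z <->
  exists c r M, pbound c r M /\ forall h, cabs h <= r / 2 -> f (z + h) = pser c h.
Proof.
split=> [[c /pser_pbound[r [M h]]]|[c [r [M [cM fc]]]]]; first by exists c, r, M.
exists c; apply/nbhsCP; exists (r / 2); first by rewrite divr_gt0 // cM.1.
move=> w wr; have := fc _ (ltW wr); rewrite subrKC => ->.
exact: pser_cvg cM (ltW wr).
Qed.

Lemma pser_cder_center (f : C -> C) z c r M : pbound c r M ->
  (forall h, cabs h <= r / 2 -> f (z + h) = pser c h) ->
  forall w, cabs (w - z) < r / 4 -> cder f w (pser (dcoef c) (w - z)).
Proof.
move=> cM fc w wr; have r0 := cM.1; have := pser_cder cM wr.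
have E : w - z = 1 * w + - z by rewrite mul1r.
rewrite {1}E => /cder_affine; rewrite mul1r; apply: cder_near.
apply/nbhsCP; exists (r / 4) => [|v vw]; first by rewrite divr_gt0.
rewrite mul1r -fc ?subrKC //.
have -> : v - z = (v - w) + (w - z) by rewrite addrA subrK.
apply: (le_trans (cabsD _ _)); have -> : r / 2 = r / 4 + r / 4 by field.
by rewrite lerD // ltW.
Qed.

Lemma analytic_cder (f : C -> C) z : analytic_at f z ->
  (\forall w \near z, cder f w (derive1 f w)) /\ analytic_at (derive1 f) z.
Proof.
move=> /analyticP[c [r [M [cM fc]]]]; have r0 := cM.1.
have H := pser_cder_center cM fc.
split.
  apply/nbhsCP; exists (r / 4); first by rewrite divr_gt0.
  by move=> w /H h; rewrite (cderive_val h).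
apply/analyticP; exists (dcoef c), (r / 4), (2 * M / r); split.
  have [q q2] := pbound_deriv cM; split=> [|n]; first by rewrite divr_gt0.
  apply: le_trans (q2 n); rewrite ler_wpM2l ?cabs_ge0 // lerXn2r ?nnegrE ?divr_ge0 ?ltW //.
  by rewrite ltr_pM2l // ltf_pV2 ?posrE // ltr_nat.
move=> h hr.
have E : z + h - z = h by rewrite addrAC subrr add0r.
have /H : cabs (z + h - z) < r / 4.
  rewrite E; apply: (le_lt_trans hr); rewrite gtr_pMr ?divr_gt0 //.
  by rewrite invf_lt1 // ltr1n.
by move/cderive_val ->; rewrite E.
Qed.

Lemma analytic_coef1 (f : C -> C) z c :
  (\forall w \near z, series (fun n => c n * (w - z) ^+ n) @ \oo --> f w) ->
  cder f z (c 1%N).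
Proof.
move=> /pser_pbound[r [M [cM fc]]].
have zr : cabs (z - z) < r / 4 by rewrite subrr cabs0 divr_gt0 // cM.1.
by have := pser_cder_center cM fc zr; rewrite subrr pser0 /dcoef mul1r.
Qed.

Lemma analytic_continuous (f : C -> C) z : analytic_at f z -> f w @[w --> z] --> f z.
Proof.
by move=> /analytic_cder[/nbhsCP[e e0 he] _]; apply: cder_continuous (he z _);
  rewrite subrr cabs0.
Qed.

Lemma analytic_cder_at (f : C -> C) z : analytic_at f z -> cder f z (derive1 f z).
Proof. by move=> /analytic_cder[/nbhsCP[e e0 he] _]; apply: he; rewrite subrr cabs0. Qed.

(** The index of the first nonzero coefficient is [m]; factoring out [(w - z) ^ m] leaves the
    shifted series. This provides isolated zeros for the identity theorem and the order of a zero of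
    xi on the critical line. *)
Lemma analytic_dichotomy (f : C -> C) z : analytic_at f z ->
  (\forall w \near z, f w = 0) \/
  exists m g, [/\ analytic_at g z, g z != 0 &
    \forall w \near z, f w = (w - z) ^+ m * g w].
Proof.
move=> /analyticP[c [r [M [cM fc]]]]; have r0 := cM.1.
have [/asboolP ex|/asboolP/forallNP nex] := boolP `[<exists n, c n != 0>]; last first.
  left; apply/nbhsCP; exists (r / 2); first by rewrite divr_gt0.
  move=> w wr; rewrite -[w](subrKC z) fc; last exact: ltW.
  apply: csum_eq; apply: cvgC_ext (cvgCc 0) => n.
  rewrite seriesC_sum big1 // => i _.
  by have /negP := nex i; rewrite negbK => /eqP ->; rewrite mul0r.
right; pose m := ex_minn ex.
have [cm hm] : c m != 0 /\ forall n, c n != 0 -> (m <= n)%N by rewrite /m; case: ex_minnP.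
have c0 n : (n < m)%N -> c n = 0.
  by move=> nm; apply/eqP; apply: contraTT nm => /hm; rewrite -leqNgt.
pose d n := c (m + n)%N; have dM := pbound_shift m cM.
have fE h : z + h - z = h by rewrite addrAC subrr add0r.
exists m, (fun w => pser d (w - z)); split.
- apply/analyticP; exists d, r, (M / r ^+ m); split=> [|h _]; first exact: dM.
  by rewrite (fE h).
- by rewrite /= (subrr z) (pser0 d) /d addn0.
apply/nbhsCP; exists (r / 2); first by rewrite divr_gt0.
move=> w wr; rewrite -{1}[w](subrKC z) fc; last exact: ltW.
set h := w - z in wr *; apply: csum_eq.
have H := pser_cvg dM (ltW wr).
have : series (fun n => c n * h ^+ n) (n + m)%N @[n --> \oo] --> h ^+ m * pser d h.
  apply: cvgC_ext (cvgCM (cvgCc (h ^+ m)) H) => n.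
  rewrite !seriesC_sum addnC big_split_ord /= [X in _ = X + _]big1 ?add0r; last first.
    by move=> i _; rewrite c0 // mul0r.
  rewrite big_distrr /=; apply: eq_bigr => i _.
  by rewrite exprD; ring.
by rewrite (cvg_shiftn m).
Qed.

Lemma analytic_ext (f g : C -> C) z : f =1 g -> analytic_at f z -> analytic_at g z.
Proof. by move=> /funext ->. Qed.

Lemma analyticD (f g : C -> C) z : analytic_at f z -> analytic_at g z ->
  analytic_at (fun w => f w + g w) z.
Proof.
move=> [c hc] [d hd]; exists (fun n => c n + d n).
have [e1 e10 h1] := (nbhsCP _ _).1 hc; have [e2 e20 h2] := (nbhsCP _ _).1 hd.
apply/nbhsCP; exists (Num.min e1 e2); first by rewrite lt_min e10.
move=> w; rewrite lt_min => /andP[/h1 w1 /h2 w2].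
apply: cvgC_ext (cvgCD w1 w2) => n.
by rewrite !seriesEnat /= -big_split /=; apply: eq_bigr => i _; rewrite mulrDl.
Qed.

Lemma analyticZ (f : C -> C) (a : C) z : analytic_at f z ->
  analytic_at (fun w => a * f w) z.
Proof.
move=> [c hc]; exists (fun n => a * c n).
have [e1 e10 h1] := (nbhsCP _ _).1 hc.
apply/nbhsCP; exists e1; first exact: e10.
move=> w /h1 w1.
apply: cvgC_ext (cvgCM (cvgCc a) w1) => n.
by rewrite !seriesEnat /= big_distrr /=; apply: eq_bigr => i _; rewrite mulrA.
Qed.

Lemma analyticB (f g : C -> C) z : analytic_at f z -> analytic_at g z ->
  analytic_at (fun w => f w - g w) z.
Proof.
move=> hf /(analyticZ (-1)) hg; apply: analytic_ext (analyticD hf hg).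
by move=> w; rewrite mulN1r.
Qed.

Lemma analyticX (f : C -> C) z : analytic_at f z ->
  analytic_at (fun w => (w - z) * f w) z.
Proof.
move=> [c hc]; exists (fun n => if n is m.+1 then c m else 0).
have [e1 e10 h1] := (nbhsCP _ _).1 hc.
apply/nbhsCP; exists e1; first exact: e10.
move=> w /h1 w1.
rewrite -cvg_shiftS /=.
apply: cvgC_ext (cvgCM (cvgCc (w - z)) w1) => n.
rewrite !seriesEnat /= big_nat_recl // mul0r add0r big_distrr /=.
by apply: eq_bigr => i _; rewrite exprS; ring.
Qed.

Lemma analytic_mulid (f : C -> C) z : analytic_at f z ->
  analytic_at (fun w => w * f w) z.
Proof.
move=> hf; apply: analytic_ext (analyticD (analyticX hf) (analyticZ z hf)).
by move=> w; rewrite -mulrDl subrK.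
Qed.

Lemma analytic_inv (a z : C) : z != a -> analytic_at (fun w => (w - a)^-1) z.
Proof.
rewrite -subr_eq0 => za; set b := z - a in za.
exists (fun n => (-1) ^+ n / b ^+ n.+1).
apply/nbhsCP; exists (cabs b); first by rewrite cabs_gt0.
move=> w wb; set h := w - z in wb *.
pose q := - (h / b).
have q1 : cabs q < 1 by rewrite cabsN cabsM cabsV ltr_pdivrMr ?cabs_gt0 // mul1r.
have E n : series (fun n => (-1) ^+ n / b ^+ n.+1 * h ^+ n) n = (1 - q ^+ n) / (w - a).
  have wa : w - a = b * (1 - q).
    rewrite /q opprK mulrDr mulr1 mulrCA mulfV // mulr1 /b /h.
    by rewrite [RHS]addrC addrA subrK.
  have q0 : 1 - q != 0.
    by apply: contraTneq q1 => /subr0_eq <-; rewrite cabs1 ltxx.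
  rewrite wa seriesEnat /=; elim: n => [|n IH].
    by rewrite big_nil expr0 subrr mul0r.
  rewrite big_nat_recr //= IH.
  have -> : (-1) ^+ n / b ^+ n.+1 * h ^+ n = q ^+ n / b.
    have -> : q ^+ n = (-1) ^+ n * (h ^+ n / b ^+ n) by rewrite -expr_div_n -exprNn.
    rewrite [b ^+ n.+1]exprS.
    have bn : b ^+ n != 0 by rewrite expf_neq0.
    by field; rewrite bn za.
  rewrite [q ^+ n.+1]exprS; field.
  by rewrite q0 za.
have -> : (w - a)^-1 = (1 - 0) / (w - a) by rewrite subr0 mul1r.
suff q0 : (fun n => q ^+ n) @ \oo --> (0 : C).
  apply: cvgC_ext (cvgCM (cvgCB (cvgCc 1) q0) (cvgCc (w - a)^-1)) => n.
  by rewrite E.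
apply/cvgC_dist; under eq_fun do rewrite subr0 cabsX.
by apply: cvg_expr; rewrite ger0_norm ?cabs_ge0.
Qed.

End PowerSeries.

(** * The complex exponential *)

Section ComplexExponential.
Context {R : realType}.
Local Notation C := R[i].
Implicit Types (z w : C) (t x : R) (f g : R -> C).

Lemma cexp0 : cexp 0 = 1 :> C.
Proof. by rewrite /cexp /= expR0 cos0 sin0 mul1r mulr0. Qed.

Lemma cexpD z w : cexp (z + w) = cexp z * cexp w.
Proof.
by apply: complexP; rewrite ?ReM ?ImM /cexp /= ReD ImD expRD ?cosD ?sinD; ring.
Qed.

Lemma cexpN z : cexp (- z) * cexp z = 1.
Proof. by rewrite -cexpD addNr cexp0. Qed.

Lemma cabs_cexp z : cabs (cexp z) = expR (Re z).
Proof.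
rewrite /cabs /cexp /= !exprMn -mulrDr cos2Dsin2 mulr1 sqrtr_sqr.
by rewrite ger0_norm // expR_ge0.
Qed.

Lemma cexp_neq0 z : cexp z != 0.
Proof. by rewrite -cabs_eq0 cabs_cexp gt_eqF // expR_gt0. Qed.

Lemma cexpNV z : cexp (- z) = (cexp z)^-1.
Proof. by apply: (mulIf (cexp_neq0 z)); rewrite cexpN mulVf // cexp_neq0. Qed.

Lemma cexpJ z : cexp z^* = (cexp z)^*.
Proof. by apply: complexP; rewrite ?ReJ ?ImJ /cexp /= ReJ ImJ ?cosN ?sinN ?mulrN. Qed.

Lemma cexp_real x : cexp x%:C = (expR x)%:C.
Proof. by rewrite /cexp /= cos0 sin0 mulr1 mulr0. Qed.

Definition rder f t (d : C) : Prop :=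
  is_derive t 1 (fun x => Re (f x)) (Re d) /\
  is_derive t 1 (fun x => Im (f x)) (Im d).

Lemma is_derive_eq' (f : R -> R) (a b x : R) : is_derive x 1 f a -> a = b -> is_derive x 1 f b.
Proof. by move=> h <-. Qed.

Lemma is_derive_ext (f g : R -> R) (a x : R) : f =1 g -> is_derive x 1 f a -> is_derive x 1 g a.
Proof. by move=> /funext ->. Qed.

Lemma is_deriveMR (f g : R -> R) (a b x : R) : is_derive x 1 f a -> is_derive x 1 g b ->
  is_derive x 1 (fun y => f y * g y) (a * g x + f x * b).
Proof.
move=> h1 h2; apply: (is_derive_eq' (is_deriveM h1 h2)).
by rewrite /GRing.scale /= addrC [a * _]mulrC.
Qed.

Lemma is_deriveDR (f g : R -> R) (a b x : R) : is_derive x 1 f a -> is_derive x 1 g b ->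
  is_derive x 1 (fun y => f y + g y) (a + b).
Proof. by move=> h1 h2; exact: (is_deriveD h1 h2). Qed.

Lemma is_deriveBR (f g : R -> R) (a b x : R) : is_derive x 1 f a -> is_derive x 1 g b ->
  is_derive x 1 (fun y => f y - g y) (a - b).
Proof. by move=> h1 h2; exact: (is_deriveB h1 h2). Qed.

Lemma is_derive_compR (f g : R -> R) (a b x : R) : is_derive (g x) 1 f a -> is_derive x 1 g b ->
  is_derive x 1 (fun y => f (g y)) (a * b).
Proof. by move=> h1 h2; exact: (is_derive1_comp h1 h2). Qed.

Lemma is_derive_cstR (a x : R) : is_derive x 1 (fun=> a) 0.
Proof. exact: is_derive_cst. Qed.

Lemma is_derive_idR (x : R) : is_derive x 1 (fun y : R => y) 1.
Proof. exact: is_derive_id. Qed.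

Lemma rder_cst z t : rder (fun=> z) t 0.
Proof. by split => /=; exact: is_derive_cstR. Qed.

Lemma rder_ext f g t d : f =1 g -> rder f t d -> rder g t d.
Proof. by move=> /funext ->. Qed.

Lemma rder_val f t d d' : d = d' -> rder f t d -> rder f t d'.
Proof. by move=> ->. Qed.

Lemma rder_real (f : R -> R) t (a : R) : is_derive t 1 f a -> rder (fun x => (f x)%:C) t a%:C.
Proof. by move=> h; split => //=; exact: is_derive_cstR. Qed.

Lemma rderD f g t a b : rder f t a -> rder g t b -> rder (fun x => f x + g x) t (a + b).
Proof.
move=> [h1 h2] [h3 h4]; split; rewrite ?ReD ?ImD.
  by apply: is_derive_ext (is_deriveDR h1 h3) => x; rewrite ReD.
by apply: is_derive_ext (is_deriveDR h2 h4) => x; rewrite ImD.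
Qed.

Lemma rderM f g t a b : rder f t a -> rder g t b ->
  rder (fun x => f x * g x) t (a * g t + f t * b).
Proof.
move=> [h1 h2] [h3 h4]; split.
  apply: is_derive_eq'; last first.
    rewrite ReD !ReM; reflexivity.
  apply: (@is_derive_ext (fun x => Re (f x) * Re (g x) - Im (f x) * Im (g x))).
    by move=> x; rewrite ReM.
  apply: is_derive_eq' (is_deriveBR (is_deriveMR h1 h3) (is_deriveMR h2 h4)) _.
  by ring.
apply: is_derive_eq'; last first.
  rewrite ImD !ImM; reflexivity.
apply: (@is_derive_ext (fun x => Re (f x) * Im (g x) + Im (f x) * Re (g x))).
  by move=> x; rewrite ImM.
apply: is_derive_eq' (is_deriveDR (is_deriveMR h1 h4) (is_deriveMR h2 h3)) _.
by ring.
Qed.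

Lemma rderZ f t a z : rder f t a -> rder (fun x => z * f x) t (z * a).
Proof. by move=> h; have := rderM (rder_cst z t) h; rewrite mul0r add0r. Qed.

Lemma rderN f t a : rder f t a -> rder (fun x => - f x) t (- a).
Proof.
move=> /(@rderZ _ _ _ (-1)); rewrite mulN1r; apply: rder_ext => x.
by rewrite mulN1r.
Qed.

Lemma rderB f g t a b : rder f t a -> rder g t b -> rder (fun x => f x - g x) t (a - b).
Proof. by move=> h1 h2; exact: (rderD h1 (rderN h2)). Qed.

Lemma rder_cexp f t a : rder f t a -> rder (fun x => cexp (f x)) t (a * cexp (f t)).
Proof.
move=> [h1 h2]; split; rewrite ?ReM ?ImM /cexp /=.
  apply: is_derive_eq' (is_deriveMR (is_derive_compR (is_derive_expR _) h1)
    (is_derive_compR (is_derive_cos _) h2)) _.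
  by ring.
apply: is_derive_eq' (is_deriveMR (is_derive_compR (is_derive_expR _) h1)
    (is_derive_compR (is_derive_sin _) h2)) _.
by ring.
Qed.

Lemma rder_sum (I : Type) (r : seq I) (F : I -> R -> C) (G : I -> C) t :
  (forall i, rder (F i) t (G i)) ->
  rder (fun x => \sum_(i <- r) F i x) t (\sum_(i <- r) G i).
Proof.
move=> h; elim: r => [|i r IH].
  by rewrite big_nil; apply: rder_ext (rder_cst 0 t) => x; rewrite big_nil.
rewrite big_cons; apply: rder_ext (rderD (h i) IH) => x.
by rewrite big_cons.
Qed.

Lemma is_derive_exp (n : nat) t : is_derive t 1 (fun x => x ^+ n) (n%:R * t ^+ n.-1).
Proof.
elim: n => [|n IH].
  by rewrite mul0r; apply: is_derive_ext (is_derive_cstR 1 t) => x; rewrite expr0.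
apply: (@is_derive_ext (fun x => x * x ^+ n)) => [x|]; first by rewrite exprS.
apply: is_derive_eq' (is_deriveMR (is_derive_idR t) IH) _.
case: n {IH} => [|n] /=; first by rewrite mul0r mulr0 addr0.
by rewrite mulrCA -exprS mul1r -[n.+2%:R]natr1 mulrDl mul1r addrC.
Qed.

Lemma is_derive_cont (f : R -> R) a x : is_derive x 1 f a -> {for x, continuous f}.
Proof. by move=> [h _]; apply: differentiable_continuous; exact/derivable1_diffP. Qed.

(** The increment [d] is rotated onto the positive real axis by a unimodular [k]; then
    [b - Re (k * f)] is a real function with nonnegative derivative. *)
Lemma cmean_value f (b : R -> R) (df : R -> C) (db : R -> R) (u v : R) : u <= v ->
  (forall t, u <= t <= v -> rder f t (df t)) ->
  (forall t, u <= t <= v -> is_derive t 1 b (db t)) ->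
  (forall t, u <= t <= v -> cabs (df t) <= db t) ->
  cabs (f v - f u) <= b v - b u.
Proof.
move=> uv hf hb hle; set d := f v - f u.
have [d0|d0] := eqVneq d 0.
  rewrite d0 cabs0 subr_ge0.
  apply: (@ger0_derive1_ndecr _ b u v) => //.
  - by move=> t /[!in_itv]/= /andP[/ltW ut /ltW tv]; have [] := hb t; rewrite ?ut.
  - move=> t /[!in_itv]/= /andP[/ltW ut /ltW tv]; rewrite derive1E.
    have tt : u <= t <= v by rewrite ut.
    by have [_ ->] := hb t tt; apply: le_trans (hle t tt); exact: cabs_ge0.
  - apply: continuous_in_subspaceT => t; rewrite inE /= in_itv /= => tt.
    exact: is_derive_cont (hb t tt).
pose k := d^* / (cabs d)%:C.
have kd : k * d = (cabs d)%:C.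
  have E : d^* * d = (cabs d ^+ 2)%:C.
    rewrite cabs_sqr mulrC; apply: complexP; rewrite ?ReM ?ImM ReJ ImJ /=; ring.
  rewrite /k mulrAC E expr2 rmorphM /= mulfK //.
  by rewrite (inj_eq (@complexI R)) // cabs_eq0.
have ck : cabs k = 1.
  by rewrite /k cabsM cabsV cabsJ cabs_real ger0_norm ?cabs_ge0 // divff // cabs_eq0.
pose g t := b t - Re (k * f t).
have hg t : u <= t <= v -> is_derive t 1 g (db t - Re (k * df t)).
  by move=> tt; apply: is_deriveBR; [exact: hb|exact: (rderZ k (hf t tt)).1].
suff : g u <= g v.
  rewrite /g lerBlDr addrAC lerBrDr -subr_ge0 => h.
  rewrite -subr_ge0; apply: le_trans h _.
  have -> : cabs d = Re (k * f v) - Re (k * f u).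
    by rewrite -ReN -ReD -mulrBr kd.
  rewrite le_eqVlt; apply/orP; left; apply/eqP; ring.
apply: (@ger0_derive1_ndecr _ g u v) => //.
- by move=> t /[!in_itv]/= /andP[/ltW ut /ltW tv]; have [] := hg t; rewrite ?ut.
- move=> t /[!in_itv]/= /andP[/ltW ut /ltW tv]; rewrite derive1E.
  have tt : u <= t <= v by rewrite ut.
  have [_ ->] := hg t tt; rewrite subr_ge0; apply: le_trans (hle t tt).
  apply: le_trans (ler_norm _) _; apply: le_trans (cabs_Re _) _.
  by rewrite cabsM ck mul1r.
- apply: continuous_in_subspaceT => t; rewrite inE /= in_itv /= => tt.
  exact: is_derive_cont (hg t tt).
Qed.

Definition cexp_coeff z (n : nat) : C := z ^+ n / n`!%:R.

(** Since [cexp] is defined from [expR], [cos] and [sin], its power series has to be proved. Along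
    the segment [t z] the derivative of the remainder of order [n + 1] is [z] times the remainder of
    order [n], so the mean value inequality gives the bound by induction. *)
Lemma cexp_remainder z n : cabs (cexp z - \sum_(k < n) cexp_coeff z k) <=
  expR (cabs z) * (cabs z ^+ n / n`!%:R).
Proof.
pose g n t := cexp (t%:C * z) - \sum_(k < n) cexp_coeff (t%:C * z) k.
pose b n t : R := expR (cabs z) * ((t * cabs z) ^+ n / n`!%:R).
have dtz (t : R) : rder (fun x : R => x%:C * z) t z.
  apply: rder_val (rderM (rder_real (is_derive_idR t)) (rder_cst z t)).
  by rewrite mul1r mulr0 addr0.
have fn0 (T : numDomainType) m : (m`!%:R : T) != 0 by rewrite pnatr_eq0 -lt0n fact_gt0.
have nS (T : numDomainType) m : (m.+1%:R : T) != 0 by rewrite pnatr_eq0.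
have dco k (t : R) : rder (fun x : R => cexp_coeff (x%:C * z) k.+1) t (z * cexp_coeff (t%:C * z) k).
  have h : rder (fun x : R => (z ^+ k.+1 / k.+1`!%:R) * (x ^+ k.+1)%:C) t
      ((z ^+ k.+1 / k.+1`!%:R) * (k.+1%:R * t ^+ k)%:C).
    by apply: rderZ; apply: rder_real; exact: is_derive_exp.
  apply: rder_ext (rder_val _ h).
    by move=> x; rewrite /cexp_coeff exprMn rmorphXn /=; ring.
  rewrite /cexp_coeff factS natrM exprMn rmorphM rmorphXn /= rmorph_nat exprS.
  move: (fn0 C k) (nS C k); move: (k`!%:R) (k.+1%:R) => p q p0 q0.
  by field; rewrite p0 q0.
suff H t : 0 <= t <= 1 -> cabs (g n t) <= b n t.
  by have := H 1; rewrite ler01 lexx => /(_ isT); rewrite /g /b !mul1r.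
elim: n t => [|n IH] t /andP[t0 t1].
  rewrite /g /b big_ord0 subr0 cabs_cexp expr0 fact0 divr1 mulr1 ler_expR.
  rewrite ReZ; apply: le_trans (ler_norm _) _; rewrite normrM ger0_norm //.
  apply: le_trans (ler_wpM2l t0 (cabs_Re z)) _.
  by rewrite ler_piMl // cabs_ge0.
have -> : b n.+1 t = b n.+1 t - b n.+1 0.
  by rewrite /b mul0r expr0n mul0r mulr0 subr0.
have -> : g n.+1 t = g n.+1 t - g n.+1 0.
  rewrite [g n.+1 0]/g mul0r cexp0 big_ord_recl /= {1}/cexp_coeff expr0 fact0 divr1.
  rewrite big1 ?addr0 ?subrr ?subr0 // => i _.
  by rewrite /cexp_coeff /= expr0n mul0r.
apply: (@cmean_value (g n.+1) (b n.+1) (fun s => z * g n s) (fun s => cabs z * b n s)) => //.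
- move=> s _; rewrite mulrBr; apply: rderB; first exact: rder_cexp.
  rewrite big_distrr /=.
  have h := rder_sum (index_enum 'I_n) (fun k => dco k s).
  apply: rder_ext (rder_val _ (rderD (rder_cst 1 s) h)).
    move=> x; rewrite big_ord_recl /=; congr (_ + _).
    by rewrite /cexp_coeff expr0 fact0 divr1.
  by rewrite add0r.
- move=> s _; rewrite /b.
  have h : is_derive s 1 (fun t => (expR (cabs z) * (cabs z ^+ n.+1 / n.+1`!%:R)) * t ^+ n.+1)
     ((expR (cabs z) * (cabs z ^+ n.+1 / n.+1`!%:R)) * (n.+1%:R * s ^+ n)).
    apply: is_derive_eq' (is_deriveMR (is_derive_cstR _ s) (is_derive_exp n.+1 s)) _.
    by rewrite mul0r add0r.
  apply: is_derive_ext (is_derive_eq' h _).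
    by move=> x; rewrite exprMn; ring.
  rewrite factS natrM exprMn exprS.
  move: (fn0 R n) (nS R n); move: (n`!%:R) (n.+1%:R) => p q p0 q0.
  by field; rewrite p0 q0.
- move=> s /andP[s0 st]; rewrite cabsM ler_wpM2l ?cabs_ge0 //.
  by apply: IH; rewrite s0 (le_trans st).
Qed.

Lemma cexp_partial_le z n : cabs (\sum_(k < n) cexp_coeff z k) <= expR (cabs z).
Proof.
apply: (le_trans (cabs_sum _ _ _)).
have -> : \sum_(k < n) cabs (cexp_coeff z k) = series (exp_coeff (cabs z)) n.
  rewrite seriesEnat /= big_mkord; apply: eq_bigr => i _.
  by rewrite /cexp_coeff /exp_coeff cabsM cabsV cabsX cabs_nat.
apply: nondecreasing_cvgn_le (is_cvg_series_exp_coeff _) _.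
apply/nondecreasing_seqP => m; rewrite !seriesEnat /= big_nat_recr //= lerDl.
by rewrite exp_coeff_ge0 // cabs_ge0.
Qed.

Lemma cexp_series z : (fun n => \sum_(k < n) cexp_coeff z k) @ \oo --> cexp z.
Proof.
apply: (@cvgC_squeeze _ _ _ _ _ _ (fun n => expR (cabs z) * (cabs z ^+ n / n`!%:R))).
  by near=> n; rewrite cabs_sub; exact: cexp_remainder.
rewrite -[X in _ --> X](mulr0 (expR (cabs z))).
by apply: cvgM; [exact: cvg_cst|exact: cvg_exp_coeff].
Unshelve. all: by end_near. Qed.

End ComplexExponential.

(** * Complex integrals *)

Section ComplexIntegral.
Context {R : realType}.
Local Notation C := R[i].
Local Notation mu := (@lebesgue_measure R).
Implicit Types (D : set R) (f g : R -> C) (z : C) (G : R -> R).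

Definition cmeas D g : Prop :=
  measurable_fun D (fun x => Re (g x)) /\ measurable_fun D (fun x => Im (g x)).

Lemma cmeas_ext D f g : {in D, f =1 g} -> cmeas D f -> cmeas D g.
Proof.
by move=> fg [h1 h2]; split; [apply: eq_measurable_fun h1|apply: eq_measurable_fun h2] => x xD;
  rewrite fg.
Qed.

Lemma cmeas_cst D z : cmeas D (fun=> z).
Proof. by split; exact: measurable_cst. Qed.

Lemma cmeas_real D G : measurable_fun D G -> cmeas D (fun x => (G x)%:C).
Proof. by move=> h; split => //=; exact: measurable_cst. Qed.

Lemma cmeasD D f g : cmeas D f -> cmeas D g -> cmeas D (fun x => f x + g x).
Proof.
move=> [h1 h2] [h3 h4]; split.
  by under eq_fun do rewrite ReD; exact: measurable_funD.
by under eq_fun do rewrite ImD; exact: measurable_funD.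
Qed.

Lemma cmeasM D f g : cmeas D f -> cmeas D g -> cmeas D (fun x => f x * g x).
Proof.
move=> [h1 h2] [h3 h4]; split.
  by under eq_fun do rewrite ReM; apply: measurable_funB; exact: measurable_funM.
by under eq_fun do rewrite ImM; apply: measurable_funD; exact: measurable_funM.
Qed.

Lemma cmeasN D f : cmeas D f -> cmeas D (fun x => - f x).
Proof.
move=> h; apply: cmeas_ext (cmeasM (cmeas_cst D (-1)) h) => x _.
by rewrite mulN1r.
Qed.

Lemma cmeasB D f g : cmeas D f -> cmeas D g -> cmeas D (fun x => f x - g x).
Proof. by move=> h1 h2; exact: cmeasD h1 (cmeasN h2). Qed.

Lemma cmeasJ D f : cmeas D f -> cmeas D (fun x => (f x)^*).
Proof.
move=> [h1 h2]; split; first by under eq_fun do rewrite ReJ.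
by under eq_fun do rewrite ImJ; exact: measurable_funN.
Qed.

Lemma cmeasX D f n : cmeas D f -> cmeas D (fun x => f x ^+ n).
Proof.
move=> h; elim: n => [|n IH]; first by under eq_fun do rewrite expr0; exact: cmeas_cst.
by under eq_fun do rewrite exprS; exact: cmeasM.
Qed.

Lemma cmeas_sum D (I : Type) (r : seq I) (F : I -> R -> C) :
  (forall i, cmeas D (F i)) -> cmeas D (fun x => \sum_(i <- r) F i x).
Proof.
move=> h; elim: r => [|i r IH]; first by under eq_fun do rewrite big_nil; exact: cmeas_cst.
by under eq_fun do rewrite big_cons; exact: cmeasD.
Qed.

Lemma cmeas_cexp D f : cmeas D f -> cmeas D (fun x => cexp (f x)).
Proof.
move=> [h1 h2]; rewrite /cexp; split => /=; apply: measurable_funM.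
- by apply: measurableT_comp h1; exact: measurable_expR.
- by apply: measurableT_comp h2; apply: continuous_measurable_fun; exact: continuous_cos.
- by apply: measurableT_comp h1; exact: measurable_expR.
- by apply: measurableT_comp h2; apply: continuous_measurable_fun; exact: continuous_sin.
Qed.

Lemma cmeasS D E f : measurable E -> D `<=` E -> cmeas E f -> cmeas D f.
Proof. by move=> mE DE [h1 h2]; split; exact: measurable_funS DE _. Qed.

Lemma cmeas_cvg D (f_ : nat -> R -> C) f : (forall n, cmeas D (f_ n)) ->
  (forall x, D x -> f_ n x @[n --> \oo] --> f x) -> cmeas D f.
Proof.
move=> mf fc; split.
  apply: (@measurable_fun_cvg _ _ _ D (fun n x => Re (f_ n x))) => [n|x Dx].
    exact: (mf n).1.
  by have /cvgC_Re := fc x Dx.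
apply: (@measurable_fun_cvg _ _ _ D (fun n x => Im (f_ n x))) => [n|x Dx].
  exact: (mf n).2.
by have /cvgC_Im := fc x Dx.
Qed.

Lemma cintegrable_cmeas D f : cintegrable D f -> cmeas D f.
Proof.
by move=> [h1 h2]; split; [move: h1|move: h2] => /integrableP[/measurable_EFinP].
Qed.

Lemma cintegrable_dom D f G : measurable D -> cmeas D f ->
  mu.-integrable D (EFin \o G) -> (forall x, D x -> cabs (f x) <= G x) ->
  cintegrable D f.
Proof.
move=> mD [h1 h2] iG fG; split; apply: (le_integrable _ _ _ iG) => //.
- exact/measurable_EFinP.
- move=> x Dx /=; rewrite lee_fin; apply: (le_trans (cabs_Re _)).
  by apply: (le_trans (fG x Dx)); exact: ler_norm.
- exact/measurable_EFinP.
- move=> x Dx /=; rewrite lee_fin; apply: (le_trans (cabs_Im _)).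
  by apply: (le_trans (fG x Dx)); exact: ler_norm.
Qed.

Lemma eq_cintegral D f g : {in D, f =1 g} -> cintegral D f = cintegral D g.
Proof.
by move=> fg; rewrite /cintegral; congr (_ +i* _); apply: eq_Rintegral => x xD; rewrite fg.
Qed.

Lemma cintegrable_ext D f g : measurable D -> {in D, f =1 g} -> cintegrable D f -> cintegrable D g.
Proof.
by move=> mD fg [h1 h2]; split; [apply: eq_integrable h1|apply: eq_integrable h2] => // x xD /=;
  rewrite fg.
Qed.

Lemma cintegrableD D f g : measurable D -> cintegrable D f -> cintegrable D g ->
  cintegrable D (fun x => f x + g x).
Proof.
move=> mD [h1 h2] [h3 h4]; split.
  by under eq_fun do rewrite ReD EFinD; exact: integrableD.
by under eq_fun do rewrite ImD EFinD; exact: integrableD.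
Qed.

Lemma cintegralD D f g : measurable D -> cintegrable D f -> cintegrable D g ->
  cintegral D (fun x => f x + g x) = cintegral D f + cintegral D g.
Proof.
move=> mD [h1 h2] [h3 h4]; rewrite /cintegral; apply: complexP; rewrite ?ReD ?ImD /=.
  by rewrite -RintegralD //; apply: eq_Rintegral => x _; rewrite ReD.
by rewrite -RintegralD //; apply: eq_Rintegral => x _; rewrite ImD.
Qed.

Lemma cintegrableZ D f z : measurable D -> cintegrable D f ->
  cintegrable D (fun x => z * f x).
Proof.
move=> mD [h1 h2]; have Z k (u : R -> R) : mu.-integrable D (fun x => (u x)%:E) ->
    mu.-integrable D (fun x => (k * u x)%:E).
  by move=> h; under eq_fun do rewrite EFinM; exact: integrableZl.
split.
  under eq_fun do rewrite ReM EFinB.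
  by apply: integrableB => //; exact: Z.
under eq_fun do rewrite ImM EFinD.
by apply: integrableD => //; exact: Z.
Qed.

Lemma cintegralZ D f z : measurable D -> cintegrable D f ->
  cintegral D (fun x => z * f x) = z * cintegral D f.
Proof.
move=> mD [h1 h2]; have Z k (u : R -> R) : mu.-integrable D (fun x => (u x)%:E) ->
    mu.-integrable D (fun x => (k * u x)%:E).
  by move=> h; under eq_fun do rewrite EFinM; exact: integrableZl.
rewrite /cintegral; apply: complexP; rewrite ?ReM ?ImM /=.
  rewrite -!RintegralZl // -RintegralB //; [|exact: Z|exact: Z].
  by apply: eq_Rintegral => x _; rewrite ReM.
rewrite -!RintegralZl // -RintegralD //; [|exact: Z|exact: Z].
by apply: eq_Rintegral => x _; rewrite ImM.
Qed.

Lemma cintegrableN D f : measurable D -> cintegrable D f -> cintegrable D (fun x => - f x).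
Proof.
move=> mD h; apply: cintegrable_ext mD _ (cintegrableZ (-1) mD h) => x _.
by rewrite mulN1r.
Qed.

Lemma cintegrableB D f g : measurable D -> cintegrable D f -> cintegrable D g ->
  cintegrable D (fun x => f x - g x).
Proof. by move=> mD h1 h2; exact: cintegrableD mD h1 (cintegrableN mD h2). Qed.

Lemma cintegralB D f g : measurable D -> cintegrable D f -> cintegrable D g ->
  cintegral D (fun x => f x - g x) = cintegral D f - cintegral D g.
Proof.
move=> mD h1 h2; rewrite cintegralD //; last exact: cintegrableN.
congr (_ + _); rewrite -mulN1r -cintegralZ //.
by apply: eq_cintegral => x _; rewrite mulN1r.
Qed.

Lemma cintegral0 D : cintegral D (fun=> 0) = 0.
Proof. by rewrite /cintegral; apply: complexP => /=; rewrite /Rintegral integral0. Qed.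

Lemma cintegrable0 D : cintegrable D (fun=> 0).
Proof. by split; exact: integrable0. Qed.

Lemma cintegrable_sum D (I : Type) (r : seq I) (F : I -> R -> C) : measurable D ->
  (forall i, cintegrable D (F i)) -> cintegrable D (fun x => \sum_(i <- r) F i x).
Proof.
move=> mD h; elim: r => [|i r IH].
  by under eq_fun do rewrite big_nil; exact: cintegrable0.
by under eq_fun do rewrite big_cons; exact: cintegrableD.
Qed.

Lemma cintegral_sum D (I : Type) (r : seq I) (F : I -> R -> C) : measurable D ->
  (forall i, cintegrable D (F i)) ->
  cintegral D (fun x => \sum_(i <- r) F i x) = \sum_(i <- r) cintegral D (F i).
Proof.
move=> mD h; elim: r => [|i r IH].
  by under eq_fun do rewrite big_nil; rewrite cintegral0 big_nil.
under eq_fun do rewrite big_cons.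
by rewrite cintegralD // ?IH ?big_cons //; exact: cintegrable_sum.
Qed.

Lemma cintegralJ D f : measurable D -> cintegrable D f ->
  cintegral D (fun x => (f x)^*) = (cintegral D f)^*.
Proof.
move=> mD [h1 h2]; rewrite /cintegral; apply: complexP; rewrite ?ReJ ?ImJ /=.
  by apply: eq_Rintegral => x _; rewrite ReJ.
rewrite -mulN1r -RintegralZl //; apply: eq_Rintegral => x _.
by rewrite ImJ mulN1r.
Qed.

(** The factor 2 comes from estimating the real and imaginary parts separately. *)
Lemma cabs_cintegral_le D f G : measurable D -> cintegrable D f ->
  mu.-integrable D (EFin \o G) -> (forall x, D x -> cabs (f x) <= G x) ->
  cabs (cintegral D f) <= 2 * \int[mu]_(x in D) G x.
Proof.
move=> mD [h1 h2] iG fG; apply: (le_trans (cabs_ReIm _)).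
rewrite /cintegral /= mulr_natl mulr2n; apply: lerD.
  apply: (le_trans (le_normr_Rintegral _ _ )) => //.
  apply: le_Rintegral => //; first exact: integrable_norm.
  by move=> x Dx; apply: le_trans (fG x Dx); exact: cabs_Re.
apply: (le_trans (le_normr_Rintegral _ _ )) => //.
apply: le_Rintegral => //; first exact: integrable_norm.
by move=> x Dx; apply: le_trans (fG x Dx); exact: cabs_Im.
Qed.

Lemma Rintegral_dominated D (f_ : nat -> R -> R) (f : R -> R) G : measurable D ->
  (forall n, measurable_fun D (f_ n)) ->
  (forall x, D x -> f_ n x @[n --> \oo] --> f x) ->
  mu.-integrable D (EFin \o G) ->
  (forall n x, D x -> `|f_ n x| <= G x) ->
  (\int[mu]_(x in D) f_ n x) @[n --> \oo] --> \int[mu]_(x in D) f x.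
Proof.
move=> mD mf fc iG fG.
have mlim : measurable_fun D f by exact: measurable_fun_cvg mf fc.
have m1 n : measurable_fun D (fun x => (f_ n x)%:E) by exact/measurable_EFinP.
have m2 : measurable_fun D (fun x => (f x)%:E) by exact/measurable_EFinP.
have c : {ae mu, forall x, D x -> (f_ n x)%:E @[n --> \oo] --> (f x)%:E}.
  apply: aeW => x Dx; apply: cvg_EFin; first by apply: nearW.
  exact: fc.
have d : {ae mu, forall x n, D x -> (`|(f_ n x)%:E| <= (G x)%:E)%E}.
  by apply: aeW => x n Dx; rewrite lee_fin; exact: fG.
have [i1 _ h] := @dominated_convergence _ _ R mu D mD (fun n x => (f_ n x)%:E)
  (fun x => (f x)%:E) (fun x => (G x)%:E) m1 m2 c iG d.
rewrite /Rintegral; apply: fine_cvg; rewrite fineK //.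
exact: integrable_fin_num.
Qed.

Lemma cintegral_dominated D (f_ : nat -> R -> C) f G : measurable D ->
  (forall n, cmeas D (f_ n)) ->
  (forall x, D x -> f_ n x @[n --> \oo] --> f x) ->
  mu.-integrable D (EFin \o G) ->
  (forall n x, D x -> cabs (f_ n x) <= G x) ->
  cintegral D (f_ n) @[n --> \oo] --> cintegral D f.
Proof.
move=> mD mf fc iG fG; apply/cvgC_ReIm; split => /=.
  apply: (Rintegral_dominated mD (fun n => (mf n).1) _ iG) => [x Dx|n x Dx].
    exact: cvgC_Re (fc x Dx).
  exact: le_trans (cabs_Re _) (fG n x Dx).
apply: (Rintegral_dominated mD (fun n => (mf n).2) _ iG) => [x Dx|n x Dx].
  exact: cvgC_Im (fc x Dx).
exact: le_trans (cabs_Im _) (fG n x Dx).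
Qed.

(** Monotone convergence. It turns antiderivatives on compact pieces into integrability up to the
    singular end of an interval. *)
Lemma integrable_incr (E : nat -> set R) G (M : R) :
  (forall n, measurable (E n)) -> nondecreasing_seq E ->
  (forall n, measurable_fun (E n) G) -> (forall n x, E n x -> 0 <= G x) ->
  (forall n, (\int[mu]_(x in E n) (G x)%:E <= M%:E)%E) ->
  mu.-integrable (\bigcup_n E n) (EFin \o G).
Proof.
move=> mE ndE mG G0 GM.
have mU : measurable (\bigcup_n E n) by exact: bigcupT_measurable.
have mGU : measurable_fun (\bigcup_n E n) G by apply/measurable_fun_bigcup.
apply/integrableP; split; first exact/measurable_EFinP.
have -> : (\int[mu]_(x in \bigcup_n E n) `|(EFin \o G) x| =
   \int[mu]_(x in \bigcup_n E n) (G x)%:E)%E.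
  apply: eq_integral => x; rewrite inE => -[n _ Enx] /=.
  by rewrite ger0_norm // (G0 n).
apply: (@le_lt_trans _ _ M%:E); last exact: ltry.
have h := @ge0_nondecreasing_set_cvg_integral _ (measurableTypeR R) R E (EFin \o G) mu ndE mE
  (fun n => (measurable_EFinP _ _).2 (mG n)) (fun n x Ex => (G0 n x Ex : (0 <= (G x)%:E)%E)).
rewrite -(cvg_lim _ h) //; apply: lime_le.
  by apply/cvg_ex; eexists; exact: h.
by near=> n; exact: GM.
Unshelve. all: by end_near. Qed.

Lemma cintegral_restrict D (E : set R) f : E `<=` D ->
  cintegral E f = cintegral D (fun x => if x \in E then f x else 0).
Proof.
move=> ED; rewrite /cintegral; congr (_ +i* _); rewrite [LHS]Rintegral_mkcond [RHS]Rintegral_mkcond;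
  congr Rintegral; apply/funext => x; rewrite /patch; case: ifPn => xE; try (by case: ifP);
  have -> : x \in D by rewrite inE; apply: ED; move: xE; rewrite inE.
all: by [].
Qed.

Lemma cmeas_restrict D (E : set R) f : measurable D -> measurable E ->
  cmeas E f -> E `<=` D -> cmeas D (fun x => if x \in E then f x else 0).
Proof.
move=> mD mE mf ED; have mi : measurable_fun D (fun x => x \in E).
  apply: measurable_funTS; apply: (measurable_fun_bool true).
  rewrite setTI (_ : _ @^-1` _ = E) //.
  by apply/seteqP; split => x /=; [move/set_mem|move/mem_set].
have mf1 (u : R -> R) : measurable_fun E u ->
    measurable_fun D (fun x => if x \in E then u x else 0).
  move=> mu1; apply: measurable_fun_if => //.
  apply: measurable_funS mu1 => // x [_] /=.
  by move=> /set_mem.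
split; [apply: eq_measurable_fun (mf1 _ mf.1)|apply: eq_measurable_fun (mf1 _ mf.2)] => x _;
  by case: ifP.
Qed.

(** Dominated convergence along an exhaustion. It transfers to the whole domain what the fundamental
    theorem of calculus gives on segments. *)
Lemma cintegral_incr (E : nat -> set R) D f G : measurable D ->
  (forall n, measurable (E n)) -> (forall n, E n `<=` D) ->
  (forall x, D x -> \forall n \near \oo, E n x) ->
  cmeas D f -> mu.-integrable D (EFin \o G) -> (forall x, D x -> cabs (f x) <= G x) ->
  cintegral (E n) f @[n --> \oo] --> cintegral D f.
Proof.
move=> mD mE ED DE mf iG fG.
rewrite (_ : (fun n => _) = fun n => cintegral D (fun x => if x \in E n then f x else 0)); last first.
  by apply/funext => n; exact: cintegral_restrict.
apply: (cintegral_dominated mD _ _ iG).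
- by move=> n; apply: cmeas_restrict => //; exact: cmeasS (ED n) mf.
- move=> x Dx; have /DE h := Dx; apply: (cvgC_eq_near _ (cvgCc (f x))).
  by apply: filterS h => n Enx; rewrite mem_set.
- move=> n x Dx; case: ifP => _; first exact: fG.
  by rewrite cabs0; apply: le_trans (fG x Dx); exact: cabs_ge0.
Qed.

End ComplexIntegral.

(** * Laplace and Mellin transforms *)

Section Mellin.
Context {R : realType}.
Local Notation C := R[i].
Local Notation mu := (@lebesgue_measure R).
Implicit Types (D : set R) (k : R -> C) (l : R -> R) (s z : C) (G : R -> R).

(** Every use takes [l = ln], with the factor [1 / x] of the Mellin measure included in [k]. *)
Definition laplace D k l s : C := cintegral D (fun x => k x * cexp (s * (l x)%:C)).

Lemma cexp_coeff_le z n : cabs (cexp_coeff z n) <= expR (cabs z).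
Proof.
have -> : cabs (cexp_coeff z n) = exp_coeff (cabs z) n.
  by rewrite /cexp_coeff /exp_coeff cabsM cabsV cabsX cabs_nat.
apply: (@le_trans _ _ (series (exp_coeff (cabs z)) n.+1)).
  rewrite seriesEnat /= big_nat_recr //= lerDr.
  by apply: sumr_ge0 => i _; rewrite exp_coeff_ge0 // cabs_ge0.
apply: nondecreasing_cvgn_le (is_cvg_series_exp_coeff _) _.
apply/nondecreasing_seqP => m; rewrite !seriesEnat /= big_nat_recr //= lerDl.
by rewrite exp_coeff_ge0 // cabs_ge0.
Qed.

Lemma cmeas_laplace D k l s : cmeas D k -> measurable_fun D l ->
  cmeas D (fun x => k x * cexp (s * (l x)%:C)).
Proof.
move=> mk ml; apply: cmeasM => //; apply: cmeas_cexp.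
by apply: cmeasM; [exact: cmeas_cst|exact: cmeas_real].
Qed.

(** The Taylor coefficient of order [n] at [s], obtained by expanding the exponential of
    [(w - s) * l x] under the integral sign. *)
Definition lcoef D k l s n : C :=
  cintegral D (fun x => k x * cexp (s * (l x)%:C) * cexp_coeff (l x)%:C n).

Lemma cmeas_lcoef D k l s n : cmeas D k -> measurable_fun D l ->
  cmeas D (fun x => k x * cexp (s * (l x)%:C) * cexp_coeff (l x)%:C n).
Proof.
move=> mk ml; apply: cmeasM; first exact: cmeas_laplace.
apply: cmeasM; last exact: cmeas_cst.
by apply: cmeasX; exact: cmeas_real.
Qed.

Lemma cabs_laplace k l s x : cabs (k x * cexp (s * (l x)%:C)) = cabs (k x) * expR (Re s * l x).
Proof. by rewrite cabsM cabs_cexp; congr (_ * expR _); rewrite ReM /= mulr0 subr0. Qed.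

Lemma cexp_coeff_scale (a : C) z n : cexp_coeff (a * z) n = a ^+ n * cexp_coeff z n.
Proof. by rewrite /cexp_coeff exprMn mulrA. Qed.

Lemma lcoef_integrable D k l s r G n : measurable D -> cmeas D k -> measurable_fun D l ->
  0 < r -> mu.-integrable D (EFin \o G) ->
  (forall x, D x -> cabs (k x) * expR (Re s * l x) * expR (r * `|l x|) <= G x) ->
  cintegrable D (fun x => k x * cexp (s * (l x)%:C) * cexp_coeff (l x)%:C n).
Proof.
move=> mD mk ml r0 iG kG.
apply: (@cintegrable_dom _ D _ (fun x => (r ^+ n)^-1 * G x)) => //.
- exact: cmeas_lcoef.
- rewrite (_ : _ \o _ = fun x => ((r ^+ n)^-1%:E * (EFin \o G) x)%E); first exact: integrableZl.
  by apply/funext => x /=; rewrite EFinM.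
move=> x Dx; rewrite cabsM cabs_laplace.
have -> : cabs (cexp_coeff (l x)%:C n) = (r ^+ n)^-1 * cabs (cexp_coeff (r%:C * (l x)%:C) n).
  by rewrite cexp_coeff_scale cabsM cabsX cabs_real gtr0_norm // mulKf // expf_neq0 // gt_eqF.
rewrite mulrCA; apply: ler_wpM2l; first by rewrite invr_ge0 exprn_ge0 // ltW.
apply: le_trans (kG x Dx); rewrite ler_wpM2l ?mulr_ge0 ?cabs_ge0 ?expR_ge0 //.
apply: le_trans (cexp_coeff_le _ _) _.
by rewrite cabsM !cabs_real gtr0_norm.
Qed.

(** For [|w - s| < r] every partial sum of the exponential of [(w - s) * l x] is bounded by exp(r |l
    x|); this is why the majorant [G] has to carry that extra factor. *)
Lemma laplace_series D k l s r G : measurable D -> cmeas D k -> measurable_fun D l ->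
  0 < r -> mu.-integrable D (EFin \o G) ->
  (forall x, D x -> cabs (k x) * expR (Re s * l x) * expR (r * `|l x|) <= G x) ->
  \forall w \near s, series (fun n => lcoef D k l s n * (w - s) ^+ n) @ \oo --> laplace D k l w.
Proof.
move=> mD mk ml r0 iG kG; apply/nbhsCP; exists r => // w wr; set h := w - s.
have ci n := lcoef_integrable n mD mk ml r0 iG kG.
pose F n x := k x * cexp (s * (l x)%:C) * \sum_(j < n) cexp_coeff (h * (l x)%:C) j.
have FE n x : F n x = \sum_(j < n) h ^+ j *
    (k x * cexp (s * (l x)%:C) * cexp_coeff (l x)%:C j).
  by rewrite /F big_distrr /=; apply: eq_bigr => j _; rewrite cexp_coeff_scale; ring.
have SE n : series (fun n => lcoef D k l s n * h ^+ n) n = cintegral D (F n).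
  rewrite (_ : F n = fun x => \sum_(j < n) h ^+ j *
    (k x * cexp (s * (l x)%:C) * cexp_coeff (l x)%:C j)); last exact/funext.
  rewrite cintegral_sum //; last by move=> i; exact: cintegrableZ.
  rewrite seriesC_sum; apply: eq_bigr => j _.
  by rewrite cintegralZ // mulrC.
rewrite (_ : series _ = fun n => cintegral D (F n)); last exact/funext.
apply: (@cintegral_dominated _ D F _ G) => //.
- move=> n; rewrite /F; apply: cmeasM; first exact: cmeas_laplace.
  apply: cmeas_sum => i; apply: cmeasM; last exact: cmeas_cst.
  by apply: cmeasX; apply: cmeasM; [exact: cmeas_cst|exact: cmeas_real].
- move=> x Dx; rewrite /F.
  have -> : k x * cexp (w * (l x)%:C) = k x * cexp (s * (l x)%:C) * cexp (h * (l x)%:C).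
    by rewrite -mulrA -cexpD -mulrDl /h subrKC.
  by apply: cvgCM; [exact: cvgCc|exact: cexp_series].
- move=> n x Dx; rewrite cabsM cabs_laplace; apply: le_trans (kG x Dx).
  rewrite ler_wpM2l ?mulr_ge0 ?cabs_ge0 ?expR_ge0 //.
  apply: le_trans (cexp_partial_le _ _) _; rewrite ler_expR cabsM cabs_real.
  by rewrite ler_wpM2r // ltW.
Qed.

Lemma cconjM z (w : C) : conjc (z * w) = conjc z * conjc w.
Proof. exact: rmorphM. Qed.

Lemma cexp_coeff1 z : cexp_coeff z 1 = z.
Proof. by rewrite /cexp_coeff expr1 factS fact0 muln1 divr1. Qed.

Lemma laplaceJ D k l s : measurable D -> (forall x, D x -> (k x)^* = k x) ->
  cintegrable D (fun x => k x * cexp (s * (l x)%:C)) ->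
  laplace D k l s^* = (laplace D k l s)^*.
Proof.
move=> mD kJ ci; rewrite /laplace -cintegralJ //; apply: eq_cintegral => x.
rewrite inE => Dx; rewrite cconjM -cexpJ cconjM kJ //.
by congr (_ * cexp (_ * _)); rewrite conjc_real.
Qed.

(** * Real powers and their integrals *)

Definition rpw (p x : R) : R := expR (p * ln x).

Lemma rpw_gt0 p x : 0 < rpw p x. Proof. exact: expR_gt0. Qed.
Lemma rpw_ge0 p x : 0 <= rpw p x. Proof. exact: expR_ge0. Qed.
Lemma rpwD p q x : rpw (p + q) x = rpw p x * rpw q x.
Proof. by rewrite /rpw mulrDl expRD. Qed.
Lemma rpw1 x : 0 < x -> rpw 1 x = x.
Proof. by move=> x0; rewrite /rpw mul1r lnK. Qed.
Lemma rpw0 x : rpw 0 x = 1. Proof. by rewrite /rpw mul0r expR0. Qed.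
Lemma rpwN1 x : 0 < x -> rpw (-1) x = x^-1.
Proof. by move=> x0; rewrite /rpw mulN1r expRN lnK. Qed.

Lemma ler_rpw p q x : 1 <= x -> p <= q -> rpw p x <= rpw q x.
Proof. by move=> x1 pq; rewrite ler_expR ler_wpM2r // ln_ge0. Qed.

Lemma is_derive_rpw (p x : R) : 0 < x -> is_derive x 1 (rpw p) (p * rpw (p - 1) x).
Proof.
move=> x0; have h := is_derive_compR (g := fun y => p * ln y) (is_derive_expR (p * ln x))
  (is_deriveMR (is_derive_cstR p x) (is_derive1_ln x0)).
apply: is_derive_eq' h _; rewrite rpwD rpwN1 // mul0r add0r /rpw.
by ring.
Qed.

Lemma FTC_closed (f F f' : R -> R) (a b : R) : a < b ->
  (forall x, a <= x <= b -> is_derive x 1 F (f x)) ->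
  (forall x, a <= x <= b -> is_derive x 1 f (f' x)) ->
  mu.-integrable `[a, b] (EFin \o f) /\
  (\int[mu]_(x in `[a, b]) (f x)%:E = (F b)%:E - (F a)%:E)%E.
Proof.
move=> ab hF hf.
have cf : {within `[a, b], continuous f}.
  apply: continuous_in_subspaceT => t; rewrite inE /= in_itv /= => tt.
  exact: is_derive_cont (hf t tt).
split; first by apply: continuous_compact_integrable => //; exact: segment_compact.
apply: continuous_FTC2 => //.
  have sa : a <= a <= b by rewrite lexx ltW.
  have sb : a <= b <= b by rewrite lexx ltW.
  split.
  - move=> x; rewrite in_itv /= => /andP[/ltW ax /ltW xb].
    by have [] := hF x; rewrite ?ax.
  - by apply: cvg_at_right_filter; exact: is_derive_cont (hF a sa).
  - by apply: cvg_at_left_filter; exact: is_derive_cont (hF b sb).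
move=> x; rewrite in_itv /= => /andP[/ltW ax /ltW xb].
by rewrite derive1E; have [|_ ->] := hF x; rewrite ?ax.
Qed.

Lemma cFTC (f F f' : R -> C) (a b : R) : a < b ->
  (forall x, a <= x <= b -> rder F x (f x)) ->
  (forall x, a <= x <= b -> rder f x (f' x)) ->
  cintegrable `[a, b] f /\ cintegral `[a, b] f = F b - F a.
Proof.
move=> ab hF hf.
have [i1 e1] := FTC_closed ab (fun x h => (hF x h).1) (fun x h => (hf x h).1).
have [i2 e2] := FTC_closed ab (fun x h => (hF x h).2) (fun x h => (hf x h).2).
split; first by split.
by rewrite /cintegral /Rintegral e1 e2; apply: complexP; rewrite ?ReD ?ImD ?ReN ?ImN.
Qed.

Lemma measurable_rpw D p : measurable_fun D (rpw p).
Proof.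
apply: measurable_funTS; rewrite /rpw; apply: measurableT_comp; first exact: measurable_expR.
by apply: measurable_funM; [exact: measurable_cst|exact: measurable_ln].
Qed.

Lemma rpw_FTC p (a b : R) : 0 < a -> a < b -> p != 0 ->
  (\int[mu]_(x in `[a, b]) (rpw (p - 1) x)%:E = ((rpw p b - rpw p a) / p)%:E)%E.
Proof.
move=> a0 ab p0.
have pos x : a <= x <= b -> 0 < x by move=> /andP[ax _]; exact: lt_le_trans ax.
have [|//|_ ->] := @FTC_closed (rpw (p - 1)) (fun x => p^-1 * rpw p x)
  (fun x => (p - 1) * rpw (p - 1 - 1) x) a b ab.
- move=> x /pos x0; apply: is_derive_eq' (is_deriveMR (is_derive_cstR _ _) (is_derive_rpw p x0)) _.
  by rewrite mul0r add0r mulKf.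
- by move=> x /pos x0; exact: is_derive_rpw.
by rewrite -EFinB; congr EFin; field.
Qed.

Lemma rpw_integrable01 a : 0 < a -> mu.-integrable `]0, 1] (EFin \o rpw (a - 1)).
Proof.
(* With [n + 2] the left end is less than 1: [rpw_FTC] requires a nondegenerate interval. *)
move=> a0; pose E (n : nat) : set R := `[n.+2%:R^-1, 1]%classic.
have -> : `]0, 1]%classic = \bigcup_n E n.
  apply/seteqP; split => x /=; rewrite in_itv /=.
    move=> /andP[x0 x1]; exists (Num.truncn x^-1) => //=.
    rewrite /E /= in_itv /= x1 andbT invf_ple ?posrE //.
    by apply: (le_trans (ltW (truncnS_gt _))); rewrite ler_nat.
  move=> [n _]; rewrite /E /= in_itv /= => /andP[nx ->]; rewrite andbT.
  by apply: lt_le_trans nx; rewrite invr_gt0.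
have n1 (n : nat) : (n.+2%:R^-1 : R) < 1 by rewrite invf_lt1 // ltr1n.
apply: (@integrable_incr _ E _ a^-1).
- by move=> n; exact: measurable_itv.
- move=> m n mn; rewrite /E; apply/subsetPset => x /=; rewrite !in_itv /= => /andP[h ->].
  rewrite andbT; apply: le_trans h; rewrite lef_pV2 ?posrE // ler_nat.
  by rewrite !ltnS.
- by move=> n; exact: measurable_rpw.
- by move=> n x _; exact: rpw_ge0.
move=> n; rewrite rpw_FTC ?gt_eqF // lee_fin /rpw ln1 mulr0 expR0 ler_pdivrMr // mulVf ?gt_eqF //.
Qed.

Lemma rpw_integrable1y b : 0 < b -> mu.-integrable `]1, +oo[ (EFin \o rpw (- 1 - b)).
Proof.
move=> b0; pose E (n : nat) : set R := `[1, n.+2%:R]%classic.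
have n1 (n : nat) : 1 < (n.+2%:R : R) by rewrite ltr1n.
have EU : `[1, +oo[%classic = \bigcup_n E n.
  apply/seteqP; split => x /=; rewrite in_itv /= ?andbT.
    move=> x1; exists (Num.truncn x) => //=; rewrite /E /= in_itv /= x1 /=.
    by apply: (le_trans (ltW (truncnS_gt _))); rewrite ler_nat.
  by move=> [n _]; rewrite /E /= in_itv /= => /andP[].
apply: (@integrableS _ _ _ mu `[1, +oo[%classic) => //.
  by move=> x /=; rewrite !in_itv /= !andbT; exact: ltW.
rewrite EU; apply: (@integrable_incr _ E _ b^-1).
- by move=> n; exact: measurable_itv.
- move=> m n mn; rewrite /E; apply/subsetPset => x /=; rewrite !in_itv /= => /andP[-> h] /=.
  by apply: le_trans h _; rewrite ler_nat !ltnS.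
- by move=> n; exact: measurable_rpw.
- by move=> n x _; exact: rpw_ge0.
move=> n; rewrite addrC rpw_FTC ?oppr_eq0 ?gt_eqF // lee_fin {2}/rpw ln1 mulr0 expR0.
rewrite invrN mulrN -mulNr opprB ler_pdivrMr // mulVf ?gt_eqF //.
by rewrite gerBl expR_ge0.
Qed.

(** The majorant of Mellin integrands, integrable on the half-line for positive [a] and [b]. These
    will be the distances from [Re s] to the edges of the strip, diminished by the radius of the
    expansion. *)
Definition mker (a b x : R) : R :=
  (rpw (a - 1) \_ `]0, 1]) x + (rpw (- 1 - b) \_ `]1, +oo[) x.

Lemma mker_integrable D (a b : R) : measurable D -> 0 < a -> 0 < b ->
  mu.-integrable D (EFin \o mker a b).
Proof.
move=> mD a0 b0; apply: (@integrableS _ _ _ mu setT) => //.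
pose f1 := rpw (a - 1) \_ `]0, 1]; pose f2 := rpw (- 1 - b) \_ `]1, +oo[.
rewrite (_ : _ \o _ = ((EFin \o f1) \+ (EFin \o f2))%E).
  apply: integrableD => //.
    have /(integrable_mkcond _ _).1 := rpw_integrable01 a0.
    by rewrite restrict_EFin; apply.
  have /(integrable_mkcond _ _).1 := rpw_integrable1y b0.
  by rewrite restrict_EFin; apply.
by apply/funext => x /=; rewrite /mker EFinD.
Qed.

Lemma mkerE1 a b x : 0 < x <= 1 -> mker a b x = rpw (a - 1) x.
Proof.
move=> x01; rewrite /mker /patch ifT ?ifF ?addr0 //; last by rewrite inE /= in_itv.
by apply/negP; rewrite inE /= in_itv /= andbT ltNge; case/andP: x01 => _ ->.
Qed.

Lemma mkerE2 a b x : 1 < x -> mker a b x = rpw (- 1 - b) x.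
Proof.
move=> x1; rewrite /mker /patch ifF ?ifT ?add0r //; first by rewrite inE /= in_itv /= x1.
by apply/negP; rewrite inE /= in_itv /= leNgt x1 andbF.
Qed.

(** [al] and [be] are the edges of the strip of convergence, and the shift by -1 is the factor
    [1 / x] of the measure. When the domain misses 0 or infinity, the corresponding edge can be
    moved away at will. *)
Definition mellin_bound D k (al be M : R) : Prop := forall x, D x -> 0 < x /\
  ((x <= 1 -> cabs (k x) <= M * rpw (- 1 - al) x) /\
   (1 < x -> cabs (k x) <= M * rpw (- 1 - be) x)).

Lemma mellin_dom D k al be M (sg r : R) : mellin_bound D k al be M -> forall x, D x ->
  cabs (k x) * expR (sg * ln x) * expR (r * `|ln x|) <=
  M * mker (sg - al - r) (be - sg - r) x.
Proof.
move=> h x Dx; have [x0 [h1 h2]] := h x Dx.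
have [x1|x1] := leP x 1.
  have x01 : 0 < x <= 1 by rewrite x0.
  rewrite mkerE1 // (ler0_norm (ln_le0 x1)) mulrN -mulNr.
  apply: (@le_trans _ _ (M * rpw (- 1 - al) x * expR (sg * ln x) * expR (- r * ln x))).
    by rewrite !ler_wpM2r ?expR_ge0 //; exact: h1.
  rewrite -!mulrA -/(rpw sg x) -/(rpw (- r) x) -!rpwD.
  have -> : - 1 - al + (sg - r) = sg - al - r - 1 by ring.
  exact: lexx.
rewrite mkerE2 // (ger0_norm (ln_ge0 (ltW x1))).
apply: (@le_trans _ _ (M * rpw (- 1 - be) x * expR (sg * ln x) * expR (r * ln x))).
  by rewrite !ler_wpM2r ?expR_ge0 //; exact: h2.
rewrite -!mulrA -/(rpw sg x) -/(rpw r x) -!rpwD.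
have -> : - 1 - be + (sg + r) = - 1 - (be - sg - r) by ring.
exact: lexx.
Qed.

(** * Mellin transforms in their strip *)

Section MellinTransform.
Variables (D : set R) (k : R -> C) (al be M : R).
Hypotheses (mD : measurable D) (mk : cmeas D k) (kb : mellin_bound D k al be M).

Definition mellin s : C := laplace D k (@ln R) s.

Let mln : measurable_fun D (@ln R). Proof. exact: measurable_funTS (@measurable_ln R). Qed.

Let iM (a b : R) : 0 < a -> 0 < b -> mu.-integrable D (EFin \o (fun x => M * mker a b x)).
Proof.
move=> a0 b0.
rewrite (_ : _ \o _ = fun x => (M%:E * (EFin \o mker a b) x)%E).
  by apply: integrableZl => //; exact: mker_integrable.
by apply/funext => x /=; rewrite EFinM.
Qed.

Lemma mellin_integrable s : al < Re s < be ->
  cintegrable D (fun x => k x * cexp (s * (ln x)%:C)).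
Proof.
move=> /andP[s1 s2]; have i := iM (a := Re s - al) (b := be - Re s).
rewrite !subr_gt0 in i; apply: (cintegrable_dom mD (cmeas_laplace _ mk mln) (i s1 s2)).
move=> x Dx; have := mellin_dom (Re s) 0 kb Dx.
by rewrite cabs_laplace mul0r expR0 mulr1 !subr0.
Qed.

(** Half the distance to the nearer edge leaves room for the factor exp(r |ln x|) of the
    expansion. *)
Let rad s := Num.min (Re s - al) (be - Re s) / 2.

Let rad_spec s : al < Re s < be -> [/\ 0 < rad s, 0 < Re s - al - rad s & 0 < be - Re s - rad s].
Proof.
move=> /andP[s1 s2]; rewrite /rad; set m := Num.min _ _.
have m0 : 0 < m by rewrite lt_min !subr_gt0 s1.
have m1 : m <= Re s - al by rewrite ge_min lexx.
have m2 : m <= be - Re s by rewrite ge_min lexx orbT.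
by split; lra.
Qed.

Lemma mellin_series s : al < Re s < be ->
  \forall w \near s, series (fun n => lcoef D k (@ln R) s n * (w - s) ^+ n) @ \oo --> mellin w.
Proof.
move=> /rad_spec[r0 a0 b0].
exact: (laplace_series mD mk mln r0 (iM a0 b0) (mellin_dom (Re s) (rad s) kb)).
Qed.

Lemma mellin_analytic s : al < Re s < be -> analytic_at mellin s.
Proof. by move=> /mellin_series h; eexists; exact: h. Qed.

Lemma mellin_integrable_ln s : al < Re s < be ->
  cintegrable D (fun x => k x * cexp (s * (ln x)%:C) * (ln x)%:C).
Proof.
move=> /rad_spec[r0 a0 b0].
apply: cintegrable_ext mD _ (lcoef_integrable 1 mD mk mln r0 (iM a0 b0)
  (mellin_dom (Re s) (rad s) kb)) => x _.
by rewrite cexp_coeff1.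
Qed.

Lemma mellin_cder s : al < Re s < be ->
  cder mellin s (cintegral D (fun x => k x * cexp (s * (ln x)%:C) * (ln x)%:C)).
Proof.
move=> /mellin_series /analytic_coef1; congr (cder _ _ _).
by apply: eq_cintegral => x _; rewrite cexp_coeff1.
Qed.

End MellinTransform.

End Mellin.

(** * The zeta function to the right of the imaginary axis *)

Section Zeta.
Context {R : realType}.
Local Notation C := R[i].
Local Notation mu := (@lebesgue_measure R).
Implicit Types (s z w : C) (x y : R).

Lemma analytic_neq0_near (f : C -> C) z : analytic_at f z ->
  (\forall w \near z, f w = 0) \/ (\forall w \near z^', f w != 0).
Proof.
move=> /analytic_dichotomy[|[m [g [ga gz E]]]]; first by left.
right; pose proof (near_dnbhs (cvgC_neq0 (analytic_continuous ga) gz)) as g0.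
apply: filterS3 (near_dnbhs E) g0 (near_dnbhs_neq z) => w -> gw wz.
by rewrite mulf_neq0 // expf_neq0.
Qed.

Lemma analytic_cst (a : C) z : analytic_at (fun=> a) z.
Proof.
exists (fun n => if n is 0%N then a else 0); apply/nbhsCP; exists 1 => // w _.
rewrite -cvg_shiftS /=; apply: cvgC_ext (cvgCc a) => n.
by rewrite seriesEnat /= big_nat_recl // expr0 mulr1 big1 ?addr0 // => i _; rewrite mul0r.
Qed.

Lemma analytic_opp (f : C -> C) z : analytic_at f (- z) -> analytic_at (fun w => f (- w)) z.
Proof.
move=> [c hc]; exists (fun n => (-1) ^+ n * c n).
have [e e0 he] := (nbhsCP _ _).1 hc; apply/nbhsCP; exists e; first exact: e0.
move=> w wz; have : cabs (- w - - z) < e by rewrite opprK addrC -cabs_sub.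
move=> /he; apply: cvgC_ext => n; rewrite !seriesEnat /=; apply: eq_bigr => i _.
have -> : - w - - z = - (w - z) by ring.
by rewrite (exprNn (w - z)); ring.
Qed.

(** The horizontal lines off the real axis avoid the puncture at 1. On such a line the supremum of
    the points where [f] and [g] differ contradicts [analytic_neq0_near]; real points follow by
    continuity. *)
Lemma identity_halfplane (f g : C -> C) (sg : R) s :
  (forall w, sg < Re w -> w != 1 -> analytic_at f w) ->
  (forall w, sg < Re w -> w != 1 -> analytic_at g w) ->
  (forall w, 1 < Re w -> f w = g w) ->
  sg < Re s -> s != 1 -> f s = g s.
Proof.
move=> fa ga fg ss s1; pose d w := f w - g w.
have da w : sg < Re w -> w != 1 -> analytic_at d w.
  by move=> h1 h2; apply: analyticB; [exact: fa|exact: ga].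
have d0 w : 1 < Re w -> d w = 0 by move=> /fg h; rewrite /d h subrr.
suff H w : sg < Re w -> w != 1 -> Im w != 0 -> d w = 0.
  apply/eqP; rewrite -subr_eq0 -/(d s).
  have [s0|/(H _ ss s1) -> //] := eqVneq (Im s) 0.
  apply/negPn/negP => ds.
  pose proof (cvgC_neq0 (analytic_continuous (da s ss s1)) ds) as nz.
  have /nbhsCP[e e0 he] := nz.
  (* If [d] were nonzero at a real [s], it would be nonzero at this point just above the axis. *)
  pose w : C := Re s +i* (e / 2).
  have : cabs (w - s) < e.
    apply: (le_lt_trans (cabs_ReIm _)); rewrite ReD ImD ReN ImN /= s0 subr0 subrr normr0 add0r.
    by rewrite gtr0_norm ?divr_gt0 // ltr_pdivrMr // ltr_pMr // ltr1n.
  move=> /he /negP; apply; apply/eqP/H => //=; last by rewrite gt_eqF // divr_gt0.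
  by rewrite eq_complex /= negb_and orbC gt_eqF // divr_gt0.
move=> wsg w1 iw0; apply/eqP/negPn/negP => dw; set y := Im w.
pose p x : C := x +i* y.
have p1 x : p x != 1 by rewrite eq_complex /= negb_and iw0 orbT.
pose S : set R := [set x | Re w <= x /\ d (p x) != 0].
have Sw : S (Re w) by split => //; rewrite /p -ReImE.
have Sub : ubound S 1.
  move=> x [_ dx]; rewrite leNgt; apply/negP => x1.
  by rewrite d0 ?eqxx in dx.
have Shas : has_sup S by split; [exists (Re w)|exists 1].
pose m := sup S.
have wm : Re w <= m by apply: sup_upper_bound.
have ap : analytic_at d (p m) by apply: da => //=; exact: lt_le_trans wm.
have gtm x : m < x -> d (p x) = 0.
  move=> mx; apply/eqP/negPn/negP => dx.
  have : S x by split => //; apply: ltW; exact: le_lt_trans mx.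
  by move=> /(sup_upper_bound Shas); rewrite leNgt mx.
have px (x : R) : cabs (p x - p m) = `|x - m|.
  have -> : p x - p m = (x - m)%:C by apply: complexP; rewrite ?ReD ?ImD ?ReN ?ImN //= subrr.
  by rewrite cabs_real.
(* Near [p m] the difference either vanishes, against the choice of [m] as a supremum, or has no
   zero except possibly at [p m], against [gtm]. *)
have [/nbhsCP[e e0 he]|/dnbhsCP[e e0 he]] := analytic_neq0_near ap; last first.
  have := he (p (m + e / 2)); rewrite px addrAC subrr add0r gtr0_norm ?divr_gt0 //.
  rewrite ltr_pdivrMr // ltr_pMr // ltr1n => h.
  have : p (m + e / 2) != p m.
    by rewrite eq_complex /= negb_and -subr_eq0 addrAC subrr add0r gt_eqF ?divr_gt0.
  by move=> /h /(_ isT); rewrite gtm ?eqxx // ltrDl divr_gt0.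
have [x Sx xm] := sup_adherent e0 Shas.
have xlem : x <= m by apply: sup_upper_bound.
case: Sx => _; rewrite he ?eqxx // px ler0_norm ?subr_le0 // opprB.
by rewrite ltrBlDr addrC -ltrBlDr.
Qed.

(** * Continuation of zeta by Abel summation *)

Definition fracpart x : R := x - (Num.truncn x)%:R.

Definition zeta_kernel x : C := (fracpart x / x)%:C.

Lemma measurable_fracpart D : measurable_fun D fracpart.
Proof.
apply: measurable_funTS; apply: measurable_funB; first exact: measurable_id.
apply: nondecreasing_measurable => // a b ab.
by rewrite ler_nat; exact: le_truncn.
Qed.

Lemma fracpart_ge0 x : 0 <= x -> 0 <= fracpart x < 1.
Proof.
by move=> /truncn_itv/andP[h1 h2]; rewrite subr_ge0 h1 /= ltrBlDr addrC natr1.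
Qed.

Lemma fracpartE x (n : nat) : n%:R <= x < n.+1%:R -> fracpart x = x - n%:R.
Proof. by move=> /truncn_def h; rewrite /fracpart h. Qed.

Let D1 : set R := `]1, +oo[%classic.
Let mD1 : measurable D1. Proof. exact: measurable_itv. Qed.

Lemma zeta_kernel_bound al : mellin_bound D1 zeta_kernel al 0 1.
Proof.
move=> x; rewrite /D1 /= in_itv /= andbT => x1; have x0 : 0 < x by exact: lt_trans x1.
split => //; split => [|_]; first by rewrite leNgt x1.
have /andP[h1 h2] := fracpart_ge0 (ltW x0).
have h3 : 0 <= fracpart x / x by rewrite divr_ge0 // ltW.
rewrite subr0 rpwN1 // mul1r cabs_real ger0_norm //.
by apply: ler_piMl; [rewrite invr_ge0|]; exact: ltW.
Qed.

Lemma cmeas_zeta_kernel : cmeas D1 zeta_kernel.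
Proof.
apply: cmeas_real; apply: measurable_funM; first exact: measurable_fracpart.
apply: open_continuous_measurable_fun; first exact: interval_open.
move=> x; rewrite inE /D1 /= in_itv /= andbT => x1.
by apply: inv_continuous; rewrite gt_eqF // (lt_trans _ x1).
Qed.

Definition zetaJ s : C := mellin D1 zeta_kernel (- s).

(* The continuation of zeta to 0 < Re s given by Abel summation. *)
Definition zt s : C := 1 + (s - 1)^-1 - s * zetaJ s.

Let Jrange s : 0 < Re s -> - Re s - 1 < Re (- s) < 0.
Proof. by move=> s0; rewrite ReN; apply/andP; split; lra. Qed.

Lemma zt_analytic s : 0 < Re s -> s != 1 -> analytic_at zt s.
Proof.
move=> s0 s1; apply: analyticB.
  by apply: analyticD; [exact: analytic_cst|exact: analytic_inv].
apply: analytic_mulid; apply: analytic_opp.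
exact: (mellin_analytic mD1 cmeas_zeta_kernel (zeta_kernel_bound _) (Jrange s0)).
Qed.

Definition npow (n : nat) s : C := cexp (- s * (ln n%:R)%:C).

Lemma rder_cpow (p : C) x : 0 < x ->
  rder (fun u : R => cexp (p * (ln u)%:C)) x (p * cexp ((p - 1) * (ln x)%:C)).
Proof.
move=> x0; have h := rder_cexp (rderZ p (rder_real (is_derive1_ln x0))).
apply: rder_val h; rewrite mulrBl mul1r cexpD cexpNV cexp_real lnK //.
by rewrite fmorphV /=; ring.
Qed.

Lemma cexp_succ (p : C) x : 0 < x -> cexp ((p + 1) * (ln x)%:C) = cexp (p * (ln x)%:C) * x%:C.
Proof. by move=> x0; rewrite mulrDl mul1r cexpD cexp_real lnK. Qed.

(** Between consecutive integers the fractional part is [x - n], so the integrand has an explicit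
    primitive. *)
Lemma zetaJ_cell s (n : nat) : 0 < Re s -> s != 1 -> (0 < n)%N ->
  s * cintegral `]n%:R, n.+1%:R] (fun x => zeta_kernel x * cexp (- s * (ln x)%:C)) =
  (n.+1%:R * npow n.+1 s - n%:R * npow n s) / (1 - s) - npow n.+1 s.
Proof.
move=> s0 s1 n0; have sn0 : s != 0 by apply: contraTneq s0 => ->; rewrite ltxx.
have nR : 0 < n%:R :> R by rewrite ltr0n.
have n1R : 0 < n.+1%:R :> R by rewrite ltr0n.
have nn : n%:R < n.+1%:R :> R by rewrite ltr_nat.
have s1' : 1 - s != 0 by rewrite subr_eq0 eq_sym.
pose F (x : R) : C := (1 - s)^-1 * cexp ((1 - s) * (ln x)%:C) +
   n%:R / s * cexp (- s * (ln x)%:C).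
pose f (x : R) : C := cexp (- s * (ln x)%:C) - n%:R * cexp ((- s - 1) * (ln x)%:C).
have pos x : n%:R <= x <= n.+1%:R -> 0 < x by move=> /andP[h _]; exact: lt_le_trans h.
have [i1 e1] : cintegrable `[n%:R, n.+1%:R] f /\
   cintegral `[n%:R, n.+1%:R] f = F n.+1%:R - F n%:R.
  apply: (@cFTC _ f F (fun x => (- s * cexp ((- s - 1) * (ln x)%:C)) -
      n%:R * ((- s - 1) * cexp ((- s - 1 - 1) * (ln x)%:C)))) => // x /pos x0.
    apply: rder_val (rderD (rderZ _ (rder_cpow _ x0)) (rderZ _ (rder_cpow _ x0))).
    rewrite mulrA mulVf // mul1r mulrA mulrN divfK // mulNr /f.
    have -> : 1 - s - 1 = - s by ring.
    by [].
  by apply: rderB; [exact: rder_cpow|apply: rderZ; exact: rder_cpow].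
have fE x : n%:R < x < n.+1%:R -> zeta_kernel x * cexp (- s * (ln x)%:C) = f x.
  move=> /andP[x1 x2]; have x0 : 0 < x by exact: lt_trans x1.
  rewrite /zeta_kernel (fracpartE (n := n)) ?ltW ?x1 // /f.
  have -> : cexp ((- s - 1) * (ln x)%:C) = cexp (- s * (ln x)%:C) / x%:C.
    by rewrite mulrBl mul1r cexpD cexpNV cexp_real lnK.
  rewrite rmorphM rmorphB fmorphV /= rmorph_nat; field.
  by rewrite (inj_eq (@complexI R)) // gt_eqF.
have -> : cintegral `]n%:R, n.+1%:R] (fun x => zeta_kernel x * cexp (- s * (ln x)%:C)) =
   F n.+1%:R - F n%:R.
  rewrite -e1; have [if1 if2] := i1.
  (* The two integrands differ at the right end, where the fractional part jumps to 0; the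
     comparison is therefore made on the open interval. *)
  have E (u v : R -> R) : mu.-integrable (`[n%:R, n.+1%:R]%classic : set R) (EFin \o v) ->
     (forall x, n%:R < x < n.+1%:R -> u x = v x) ->
     (\int[mu]_(x in `]n%:R, n.+1%:R]) u x) = \int[mu]_(x in `[n%:R, n.+1%:R]) v x.
    move=> iv uv.
    have ivo : mu.-integrable (`]n%:R, n.+1%:R[%classic : set R) (EFin \o v).
      apply: integrableS iv => //.
      by move=> x /=; rewrite !in_itv /= => /andP[/ltW -> /ltW ->].
    have iuo : mu.-integrable (`]n%:R, n.+1%:R[%classic : set R) (EFin \o u).
      apply: eq_integrable ivo => // x; rewrite inE /= in_itv /= => h.
      by rewrite uv.
    rewrite -Rintegral_itv_bndo_bndc // -[RHS]Rintegral_itv_obnd_cbnd; last first.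
      apply: integrableS iv => //.
      by move=> x /=; rewrite !in_itv /= => /andP[/ltW -> ->].
    rewrite -[RHS]Rintegral_itv_bndo_bndc //.
    by apply: eq_Rintegral => x; rewrite inE /= in_itv /= => /uv.
  by rewrite /cintegral; congr (_ +i* _); apply: E => // x h; rewrite fE.
rewrite /F /npow.
have c1 (m : nat) : (0 < m)%N -> cexp ((1 - s) * (ln (m%:R : R))%:C) = m%:R * cexp (- s * (ln (m%:R : R))%:C).
  move=> m0; rewrite addrC cexp_succ ?ltr0n // mulrC; congr (_ * _).
  by rewrite rmorph_nat.
rewrite !c1 // -[n.+1%:R]natr1; field.
by rewrite s1' sn0.
Qed.

Lemma zetaJ_partial s (N : nat) : 0 < Re s -> s != 1 ->
  \sum_(n < N.+1) npow n.+1 s = N.+1%:R * npow N.+1 s / (1 - s) + s / (s - 1) -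
    s * cintegral `]1, N.+1%:R] (fun x => zeta_kernel x * cexp (- s * (ln x)%:C)).
Proof.
move=> s0 s1; have s1' : 1 - s != 0 by rewrite subr_eq0 eq_sym.
have s1'' : s - 1 != 0 by rewrite subr_eq0.
elim: N => [|N IH].
  rewrite big_ord_recl big_ord0 addr0 /npow ln1 mulr0 cexp0 mul1r.
  have -> : cintegral `]1, 1] (fun x => zeta_kernel x * cexp (- s * (ln x)%:C)) = 0.
    by rewrite set_itv_ge ?bnd_simp ?ltxx // /cintegral !Rintegral_set0.
  by field; rewrite s1' s1''.
rewrite big_ord_recr /= IH.
have ci : cintegrable D1 (fun x => zeta_kernel x * cexp (- s * (ln x)%:C)).
  exact: (mellin_integrable mD1 cmeas_zeta_kernel (zeta_kernel_bound _) (Jrange s0)).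
have sub (a b : R) : 1 <= a -> `]a, b]%classic `<=` D1.
  by move=> a1 x; rewrite /D1 /= !in_itv /= andbT => /andP[+ _]; exact: le_lt_trans.
have U : `]1, N.+2%:R]%classic = `]1, N.+1%:R]%classic `|` `]N.+1%:R, N.+2%:R]%classic :> set R.
  by rewrite -itv_bndbnd_setU // ?bnd_simp ?ler_nat // ler1n.
have dis : [disjoint `]1, N.+1%:R]%classic & `]N.+1%:R, N.+2%:R]%classic : set R].
  apply/disj_setPS => x [] /=; rewrite !in_itv /= => /andP[_ h1] /andP[h2 _].
  by rewrite ltNge h1 in h2.
have E (u : R -> R) : mu.-integrable D1 (EFin \o u) ->
   (\int[mu]_(x in `]1, N.+2%:R]) u x) = (\int[mu]_(x in `]1, N.+1%:R]) u x) +
   \int[mu]_(x in `]N.+1%:R, N.+2%:R]) u x.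
  move=> iu; rewrite U Rintegral_setU //.
  apply: integrableS iu => //; last first.
    by move=> x []; apply: sub => //; rewrite ler1n.
  by apply: measurableU; exact: measurable_itv.
have -> : cintegral `]1, N.+2%:R] (fun x => zeta_kernel x * cexp (- s * (ln x)%:C)) =
  cintegral `]1, N.+1%:R] (fun x => zeta_kernel x * cexp (- s * (ln x)%:C)) +
  cintegral `]N.+1%:R, N.+2%:R] (fun x => zeta_kernel x * cexp (- s * (ln x)%:C)).
  by rewrite /cintegral; apply: complexP; rewrite ?ReD ?ImD /= E //; case: ci.
rewrite [s * (_ + _)]mulrDr zetaJ_cell //.
by field; rewrite s1' s1''.
Qed.

(** For [Re s <= 1] the partial sums of the Dirichlet series do not converge, and the subtracted
    term compensates for this. The same limit identifies [zt] for [1 < Re s] and yields the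
    alternating series in [eta_lim]. *)
Lemma zt_asymp s : 0 < Re s -> s != 1 ->
  (\sum_(n < N.+1) npow n.+1 s - N.+1%:R * npow N.+1 s / (1 - s)) @[N --> \oo] --> zt s.
Proof.
move=> s0 s1; have s1' : 1 - s != 0 by rewrite subr_eq0 eq_sym.
have s1'' : s - 1 != 0 by rewrite subr_eq0.
pose k x : C := zeta_kernel x * cexp (- s * (ln x)%:C).
have h : cintegral `]1, N.+1%:R] k @[N --> \oo] --> zetaJ s.
  apply: (@cintegral_incr _ (fun N => `]1, N.+1%:R]%classic) D1 k (fun x => 1 * mker (Re (- s) - (- Re s - 1)) (0 - Re (- s)) x)) => //.
  - by move=> n x /=; rewrite /D1 /= !in_itv /= andbT => /andP[].
  - move=> x; rewrite /D1 /= in_itv /= andbT => x1; exists (Num.truncn x) => // n /= xn.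
    rewrite in_itv /= x1 /=; apply: le_trans (ltW (truncnS_gt x)) _.
    by rewrite ler_nat ltnS.
  - apply: cmeas_laplace; first exact: cmeas_zeta_kernel.
    exact: measurable_funTS (@measurable_ln R).
  - under eq_fun do rewrite mul1r.
    by apply: mker_integrable => //; rewrite ReN; lra.
  - move=> x Dx; have := mellin_dom (Re (- s)) 0 (zeta_kernel_bound (- Re s - 1)) Dx.
    by rewrite cabs_laplace mul0r expR0 mulr1 !subr0.
pose proof (cvgCB (cvgCc (s / (s - 1))) (cvgCM (cvgCc s) h)) as H.
have E : s / (s - 1) - s * zetaJ s = zt s by rewrite /zt; congr (_ - _); field.
rewrite E in H; apply: cvgC_ext H => N; rewrite zetaJ_partial //.
by rewrite -/k; ring.
Qed.

Lemma cabs_npow n s : cabs (npow n s) = rpw (- Re s) n%:R.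
Proof. by rewrite /npow cabs_cexp ReM /= mulr0 subr0 ReN. Qed.

Lemma rpw_cvg0 (p : R) : p < 0 -> rpw p N.+1%:R @[N --> \oo] --> (0 : R).
Proof.
move=> p0; apply/cvgrPdist_lt => e e0; near=> N.
rewrite sub0r normrN gtr0_norm ?rpw_gt0 // -ltr_ln ?posrE ?rpw_gt0 // /rpw expRK.
rewrite -ltr_ndivrMl // mulrC -ltr_expR lnK ?posrE ?ltr0n //.
apply: lt_le_trans (truncnS_gt _) _; rewrite ler_nat ltnS.
by near: N; exact: nbhs_infty_ge.
Unshelve. all: by end_near. Qed.

Lemma zt_dirichlet s : 1 < Re s -> zt s = dirichlet_zeta s.
Proof.
move=> s1; have s0 : 0 < Re s by exact: lt_trans s1.
have sn1 : s != 1 by apply: contraTneq s1 => ->; rewrite ltxx.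
rewrite /dirichlet_zeta; symmetry; apply: limC.
rewrite -cvg_shiftS /=.
have h0 : N.+1%:R * npow N.+1 s / (1 - s) @[N --> \oo] --> (0 : C).
  rewrite -(mul0r (1 - s)^-1); apply: cvgCM; last exact: cvgCc.
  apply/cvgC_dist; have p : 1 - Re s < 0 by rewrite subr_lt0.
  apply: cvg_trans (rpw_cvg0 p); apply: near_eq_cvg; near=> N.
  by rewrite subr0 cabsM cabs_npow cabs_nat rpwD rpw1 // ltr0n.
pose proof (cvgCD (zt_asymp s0 sn1) h0) as H; rewrite addr0 in H.
apply: cvgC_ext H => N; rewrite subrK seriesC_sum; apply: eq_bigr => n _.
by rewrite /npow /cpow.
Unshelve. all: by end_near. Qed.

(** [zeta] picks by [get] some continuation on some half-plane; the comparison with [zt] takes place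
    on the intersection with [0 < Re w]. *)
Lemma zetaE s : 0 < Re s -> s != 1 -> zeta s = zt s.
Proof.
move=> s0 s1; rewrite /zeta.
set P := [set v | _].
have : P !=set0.
  exists (zt s); exists 0, zt; split => //; split; first exact: zt_analytic.
  exact: zt_dirichlet.
move=> /getPex[sg [f [ss [fa fd] <-]]].
apply: (@identity_halfplane f zt (Num.max sg 0)) => //.
- by move=> w; rewrite gt_max => /andP[w1 w2]; exact: fa.
- by move=> w; rewrite gt_max => /andP[w1 w2]; exact: zt_analytic.
- by move=> w w1; rewrite fd // zt_dirichlet.
- by rewrite gt_max ss.
Qed.

End Zeta.

(** * The Gamma function *)

Section GammaFunction.
Context {R : realType}.
Local Notation C := R[i].
Local Notation mu := (@lebesgue_measure R).
Implicit Types (s z w : C) (x y : R).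

Let D0 : set R := `]0, +oo[%classic.
Let mD0 : measurable D0. Proof. exact: measurable_itv. Qed.

Lemma measurable_invr D : measurable D -> D `<=` D0 -> measurable_fun D (@GRing.inv R).
Proof.
move=> mD DD; apply: measurable_funS DD _ => //.
apply: open_continuous_measurable_fun; first exact: interval_open.
move=> x; rewrite inE /D0 /= in_itv /= andbT => x0.
by apply: inv_continuous; rewrite gt_eqF.
Qed.

Lemma expR_ge_monomial (m : nat) x : 0 <= x -> x ^+ m <= m`!%:R * expR x.
Proof.
move=> x0; have := cexp_coeff_le x%:C m.
rewrite /cexp_coeff cabsM cabsV cabsX cabs_nat cabs_real ger0_norm //.
by rewrite ler_pdivrMr ?ltr0n ?fact_gt0 // mulrC.
Qed.

Lemma rpw_nat (m : nat) x : 0 < x -> rpw m%:R x = x ^+ m.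
Proof.
move=> x0; elim: m => [|m IH]; first by rewrite rpw0.
by rewrite -natr1 rpwD IH rpw1 // exprSr.
Qed.

Lemma rpwN (p x : R) : rpw (- p) x = (rpw p x)^-1.
Proof. by rewrite /rpw mulNr expRN. Qed.

Definition gamma_kernel x : C := (expR (- x) / x)%:C.

Lemma cmeas_gamma_kernel : cmeas D0 gamma_kernel.
Proof.
apply: cmeas_real; apply: measurable_funM; last exact: measurable_invr.
apply: measurableT_comp; first exact: measurable_expR.
exact: oppr_measurable.
Qed.

(** [m] is arbitrary, so the strip extends as far to the right as wanted; the constant comes from
    [x ^ m <= m! exp x]. *)
Lemma gamma_kernel_bound (m : nat) : mellin_bound D0 gamma_kernel 0 m%:R m`!%:R.
Proof.
move=> x; rewrite /D0 /= in_itv /= andbT => x0; split => //.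
have h : 0 <= expR (- x) / x by rewrite divr_ge0 ?expR_ge0 // ltW.
have m1 : 1 <= (m`!%:R : R) by rewrite ler1n fact_gt0.
rewrite cabs_real ger0_norm //; split => [_|x1].
  rewrite subr0 rpwN1 // ler_pM2r ?invr_gt0 //; apply: le_trans m1.
  by rewrite expR_le1 oppr_le0 ltW.
rewrite rpwD rpwN1 // [_^-1 * _]mulrC mulrA ler_pM2r ?invr_gt0 //.
rewrite rpwN rpw_nat // expRN ler_pdivlMr ?exprn_gt0 // ler_pdivrMl ?expR_gt0 // mulrC.
by apply: expR_ge_monomial; exact: ltW.
Qed.

Definition Gm s : C := mellin D0 gamma_kernel s.

Let Gm_range s : 0 < Re s -> 0 < Re s < (Num.truncn (Re s)).+1%:R.
Proof. by move=> ->; rewrite truncnS_gt. Qed.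

Lemma Gm_integrable s : 0 < Re s ->
  cintegrable D0 (fun x => gamma_kernel x * cexp (s * (ln x)%:C)).
Proof.
move=> /Gm_range h.
exact: (mellin_integrable mD0 cmeas_gamma_kernel (gamma_kernel_bound _) h).
Qed.

Definition Gm' s : C :=
  cintegral D0 (fun x => gamma_kernel x * cexp (s * (ln x)%:C) * (ln x)%:C).

Lemma Gm_integrable_ln s : 0 < Re s ->
  cintegrable D0 (fun x => gamma_kernel x * cexp (s * (ln x)%:C) * (ln x)%:C).
Proof.
move=> /Gm_range h.
exact: (mellin_integrable_ln mD0 cmeas_gamma_kernel (gamma_kernel_bound _) h).
Qed.

Lemma Gm_cder s : 0 < Re s -> cder Gm s (Gm' s).
Proof.
move=> /Gm_range h.
exact: (mellin_cder mD0 cmeas_gamma_kernel (gamma_kernel_bound _) h).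
Qed.

(** On this range the shift [n] in the definition of [Gamma] is 0. The points [s / 2] with [s] in
    the critical strip lie in it, and so do the arguments of [digamma] for [z] near the real
    line. *)
Lemma GammaE s : 0 < Re s <= 1 -> Gamma s = Gm s.
Proof.
move=> /andP[s0 s1]; rewrite /Gamma.
have -> : Num.truncn (1 - Re s) = 0%N.
  by apply: truncn_def; rewrite subr_ge0 s1 /= ltrBlDr ltrDl.
rewrite big_ord0 divr1 mulr0n addr0 /Gamma_integral; apply: eq_cintegral => x.
rewrite inE /= in_itv /= andbT => x0.
rewrite /cpow /gamma_kernel mulrBl mul1r cexpD cexpNV cexp_real lnK //.
by rewrite rmorphM fmorphV /=; ring.
Qed.

(** * Euler's truncated Gamma integrals *)

Section Truncated.
Variables (NR : R) (NR1 : 1 <= NR).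
Let NR0 : 0 < NR. Proof. exact: lt_le_trans NR1. Qed.

Let DN : set R := `]0, NR]%classic.
Let mDN : measurable DN. Proof. exact: measurable_itv. Qed.
Let DN0 : DN `<=` D0.
Proof. by move=> x; rewrite /DN /D0 /= !in_itv /= andbT => /andP[]. Qed.

Definition trunc_kernel k x : C := ((1 - x / NR) ^+ k / x)%:C.

Lemma cmeas_trunc_kernel k : cmeas DN (trunc_kernel k).
Proof.
apply: cmeas_real; apply: measurable_funM; last exact: measurable_invr.
apply: measurable_funX; apply: measurable_funB => //.
by apply: measurable_funM => //; exact: measurable_id.
Qed.

Lemma trunc_fac x : DN x -> 0 <= 1 - x / NR <= 1.
Proof.
rewrite /DN /= in_itv /= => /andP[x0 xN]; rewrite subr_ge0 ler_pdivrMr // mul1r xN /=.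
by rewrite gerBl divr_ge0 // ltW.
Qed.

Lemma trunc_kernel_bound k (be : R) : 0 <= be -> mellin_bound DN (trunc_kernel k) 0 be (rpw be NR).
Proof.
move=> be0 x Dx; have /andP[h0 h1] := trunc_fac Dx.
move: Dx; rewrite /DN /= in_itv /= => /andP[x0 xN]; split => //.
have h : 0 <= (1 - x / NR) ^+ k / x by rewrite divr_ge0 ?exprn_ge0 // ltW.
have h2 : (1 - x / NR) ^+ k / x <= x^-1.
  by apply: ler_piMl; [rewrite invr_ge0 ltW|exact: exprn_ile1].
rewrite cabs_real ger0_norm //; split => [_|x1].
  rewrite subr0 rpwN1 //; apply: (le_trans h2); apply: ler_peMl.
    by rewrite invr_ge0 ltW.
  by rewrite /rpw -expR0 ler_expR mulr_ge0 // ln_ge0.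
apply: (le_trans h2); rewrite rpwD rpwN1 // mulrCA ler_pMr ?invr_gt0 //.
rewrite /rpw -expRD -expR0 ler_expR mulNr -mulrBr mulr_ge0 // subr_ge0.
by rewrite ler_ln ?posrE.
Qed.

Definition trunc_mellin k s : C := mellin DN (trunc_kernel k) s.

Let range s : 0 < Re s -> 0 < Re s < Re s + 1.
Proof. by move=> s0; apply/andP; split; lra. Qed.

Let bnd k s : 0 < Re s -> mellin_bound DN (trunc_kernel k) 0 (Re s + 1) (rpw (Re s + 1) NR).
Proof. by move=> s0; apply: trunc_kernel_bound; lra. Qed.

Lemma trunc_integrable k s : 0 < Re s ->
  cintegrable DN (fun x => trunc_kernel k x * cexp (s * (ln x)%:C)).
Proof.
by move=> s0; exact: (mellin_integrable mDN (cmeas_trunc_kernel k) (bnd k s0) (range s0)).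
Qed.

Definition trunc_mellin' k s : C :=
  cintegral DN (fun x => trunc_kernel k x * cexp (s * (ln x)%:C) * (ln x)%:C).

Lemma trunc_integrable_ln k s : 0 < Re s ->
  cintegrable DN (fun x => trunc_kernel k x * cexp (s * (ln x)%:C) * (ln x)%:C).
Proof.
by move=> s0; exact: (mellin_integrable_ln mDN (cmeas_trunc_kernel k) (bnd k s0) (range s0)).
Qed.

Lemma trunc_cder k s : 0 < Re s -> cder (trunc_mellin k) s (trunc_mellin' k s).
Proof.
by move=> s0; exact: (mellin_cder mDN (cmeas_trunc_kernel k) (bnd k s0) (range s0)).
Qed.

Let NC : (NR%:C : C) != 0. Proof. by rewrite (inj_eq (@complexI R)) gt_eqF. Qed.

Let ReS s : 0 < Re s -> 0 < Re (s + 1).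
Proof. by move=> s0; rewrite ReD /= addr_gt0. Qed.

Let kernelS k s x : 0 < x -> trunc_kernel k.+1 x * cexp (s * (ln x)%:C) =
  trunc_kernel k x * cexp (s * (ln x)%:C) -
  NR%:C^-1 * (trunc_kernel k x * cexp ((s + 1) * (ln x)%:C)).
Proof.
move=> x0; rewrite cexp_succ // /trunc_kernel exprS.
rewrite !rmorphM rmorphB rmorph1 fmorphV rmorphM fmorphV /=; field.
by rewrite NC (inj_eq (@complexI R)) gt_eqF.
Qed.

(** The identity (1-u)^(k+1) = (1-u)^k - u (1-u)^k with u = x / [NR] takes the place of integration
    by parts. It survives multiplication by [ln x], which gives the recurrence for the derivative as
    well. *)
Lemma trunc_mellinS k s : 0 < Re s ->
  trunc_mellin k.+1 s = trunc_mellin k s - NR%:C^-1 * trunc_mellin k (s + 1).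
Proof.
move=> s0; have i1 := trunc_integrable k s0; have i2 := trunc_integrable k (ReS s0).
rewrite /trunc_mellin /mellin /laplace -cintegralZ // -cintegralB //; last exact: cintegrableZ.
apply: eq_cintegral => x; rewrite inE => /DN0; rewrite /D0 /= in_itv /= andbT => x0.
exact: kernelS.
Qed.

Lemma trunc_mellin'S k s : 0 < Re s ->
  trunc_mellin' k.+1 s = trunc_mellin' k s - NR%:C^-1 * trunc_mellin' k (s + 1).
Proof.
move=> s0; have i1 := trunc_integrable_ln k s0; have i2 := trunc_integrable_ln k (ReS s0).
rewrite /trunc_mellin' -cintegralZ // -cintegralB //; last exact: cintegrableZ.
apply: eq_cintegral => x; rewrite inE => /DN0; rewrite /D0 /= in_itv /= andbT => x0.
by rewrite kernelS //; ring.
Qed.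

Lemma trunc_mellin0 s : 0 < Re s -> trunc_mellin 0 s = cexp (s * (ln NR)%:C) / s.
Proof.
move=> s0; have sn0 : s != 0 by apply: contraTneq s0 => ->; rewrite ltxx.
pose f x := trunc_kernel 0 x * cexp (s * (ln x)%:C).
have n1 (n : nat) : (n.+2%:R^-1 : R) < NR.
  by apply: (@lt_le_trans _ _ 1); [rewrite invf_lt1 // ltr1n|exact: NR1].
have h : cintegral `[n.+2%:R^-1, NR] f @[n --> \oo] --> trunc_mellin 0 s.
  apply: (@cintegral_incr _ (fun n => `[n.+2%:R^-1, NR]%classic) DN f
     (fun x => rpw (Re s + 1) NR * mker (Re s - 0) (Re s + 1 - Re s) x)) => //.
  - move=> n x; rewrite /DN /= !in_itv /= => /andP[h ->]; rewrite andbT.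
    by apply: lt_le_trans h; rewrite invr_gt0.
  - move=> x; rewrite /DN /= in_itv /= => /andP[x0 xN].
    exists (Num.truncn x^-1) => // n /= xn; rewrite in_itv /= xN andbT invf_ple ?posrE //.
    by apply: (le_trans (ltW (truncnS_gt _))); rewrite ler_nat ltnS (leq_trans xn).
  - apply: cmeas_laplace; first exact: cmeas_trunc_kernel.
    exact: measurable_funTS (@measurable_ln R).
  - rewrite (_ : _ \o _ = fun x => ((rpw (Re s + 1) NR)%:E * (EFin \o mker (Re s - 0) (Re s + 1 - Re s)) x)%E).
      by apply: integrableZl => //; apply: mker_integrable => //; lra.
    by apply/funext => x /=; rewrite EFinM.
  - move=> x Dx; have := mellin_dom (Re s) 0 (bnd 0 s0) Dx.
    by rewrite cabs_laplace mul0r expR0 mulr1 !subr0.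
have E n : cintegral `[n.+2%:R^-1, NR] f =
    cexp (s * (ln NR)%:C) / s - cexp (s * (ln n.+2%:R^-1)%:C) / s.
  pose F x : C := s^-1 * cexp (s * (ln x)%:C).
  pose g x : C := cexp ((s - 1) * (ln x)%:C).
  have pos x : n.+2%:R^-1 <= x <= NR -> 0 < x.
    by move=> /andP[h1 _]; apply: lt_le_trans h1; rewrite invr_gt0.
  have [_ e1] : cintegrable `[n.+2%:R^-1, NR] g /\
     cintegral `[n.+2%:R^-1, NR] g = F NR - F n.+2%:R^-1.
    apply: (@cFTC _ g F (fun x => (s - 1) * cexp ((s - 1 - 1) * (ln x)%:C))) => // x /pos x0.
      by apply: rder_val (rderZ _ (rder_cpow _ x0)); rewrite mulKf.
    exact: rder_cpow.
  rewrite ![_ / s]mulrC -/(F _) -e1; apply: eq_cintegral => x.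
  rewrite inE /= in_itv /= => /pos x0.
  rewrite /f /g /trunc_kernel expr0 mul1r mulrBl mul1r cexpD cexpNV cexp_real lnK //.
  by rewrite fmorphV /= mulrC.
have h2 : cintegral `[n.+2%:R^-1, NR] f @[n --> \oo] --> cexp (s * (ln NR)%:C) / s.
  rewrite -[X in _ --> X]subr0 -[X in _ - X](mul0r s^-1).
  apply: (@cvgC_ext _ _ _ _ (fun n => cexp (s * (ln NR)%:C) / s - cexp (s * (ln n.+2%:R^-1)%:C) / s)).
    by move=> n; rewrite E.
  apply: cvgCB; first exact: cvgCc.
  apply: cvgCM; last exact: cvgCc.
  apply/cvgC_dist.
  have p : - Re s < 0 by rewrite oppr_lt0.
  have := rpw_cvg0 p; rewrite -cvg_shiftS /=; apply: cvg_trans; apply: near_eq_cvg.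
  near=> n; rewrite subr0 cabs_cexp ReM /= mulr0 subr0 lnV ?posrE //.
  by rewrite /rpw mulrN mulNr.
exact: cvgC_uniq h h2.
Unshelve. all: by end_near. Qed.

Lemma cder_cexp (a : C) z : cder (fun w => cexp (w * a)) z (a * cexp (z * a)).
Proof.
have H : \forall w \near z, series (fun n => cexp (z * a) * (a ^+ n / n`!%:R) * (w - z) ^+ n) @ \oo --> cexp (w * a).
  apply/nbhsCP; exists 1 => // w _.
  have -> : cexp (w * a) = cexp (z * a) * cexp ((w - z) * a).
    by rewrite -cexpD -mulrDl subrKC.
  refine (cvgC_ext _ (cvgCM (cvgCc (cexp (z * a))) (@cexp_series _ ((w - z) * a)))) => n.
  rewrite !seriesC_sum big_distrr /=; apply: eq_bigr => i _.
  by rewrite /cexp_coeff exprMn; ring.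
have -> : a * cexp (z * a) = cexp (z * a) * (a ^+ 1 / 1`!%:R).
  by rewrite expr1 factS fact0 muln1 divr1 mulrC.
exact: analytic_coef1 H.
Qed.

(** Both sides are the derivative of [NR^s / s], computed once under the integral sign and once from
    the closed form. *)
Lemma trunc_mellin'0 s : 0 < Re s ->
  trunc_mellin' 0 s = trunc_mellin 0 s * ((ln NR)%:C - s^-1).
Proof.
move=> s0; have sn0 : s != 0 by apply: contraTneq s0 => ->; rewrite ltxx.
have h1 := @trunc_cder 0%N s s0.
have h2 := cderMV (@cder_cexp (ln NR)%:C s) (cder_id s) sn0.
have h3 : cder (trunc_mellin 0) s (cexp (s * (ln NR)%:C) / s * ((ln NR)%:C - s^-1)).
  have E : (ln NR)%:C * cexp (s * (ln NR)%:C) / s - cexp (s * (ln NR)%:C) * 1 / s ^+ 2 =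
           cexp (s * (ln NR)%:C) / s * ((ln NR)%:C - s^-1) by field.
  rewrite E in h2; apply: cder_near h2.
  apply/nbhsCP; exists (Re s) => // w ws; rewrite trunc_mellin0 //.
  have := le_lt_trans (cabs_Re _) ws; rewrite ReD ReN ltr_norml => /andP[h _].
  by lra.
by rewrite -(cderive_val h1) (cderive_val h3) trunc_mellin0.
Qed.

Definition rising s k : C := \prod_(j < k.+1) (s + j%:R).

Lemma rising_neq0 s k : 0 < Re s -> rising s k != 0.
Proof.
move=> s0; apply/prodf_neq0 => j _; apply: contraTneq s0 => /(congr1 (@complex.Re R)).
rewrite ReD -(rmorph_nat (real_complex R)) /= => h.
by rewrite -leNgt -lerN2 oppr0 -[X in _ <= - X](addrK (j%:R : R)) h sub0r opprK.
Qed.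

Lemma rising_shift s k : rising s k.+1 = s * rising (s + 1) k.
Proof.
rewrite /rising big_ord_recl /= addr0; congr (_ * _); apply: eq_bigr => j _.
by rewrite /bump leq0n natrD addrA.
Qed.

Lemma risingS s k : rising s k.+1 = rising s k * (s + k.+1%:R).
Proof. by rewrite /rising big_ord_recr. Qed.

(** Euler's product for Gamma before the passage to the limit. The recurrence shifts [s] by 1, so
    the induction hypothesis is needed for all [s]. *)
Lemma trunc_mellinE k s : 0 < Re s ->
  trunc_mellin k s = cexp (s * (ln NR)%:C) * k`!%:R / rising s k.
Proof.
elim: k s => [|k IH] s s0.
  by rewrite trunc_mellin0 // fact0 mulr1 /rising big_ord_recl big_ord0 mulr1 addr0.
rewrite trunc_mellinS // IH // IH ?ReS // cexp_succ //.
have r0 := rising_neq0 k s0; have r1 := rising_neq0 k (ReS s0).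
have r2 := rising_neq0 k.+1 s0.
have e1 := rising_shift s k; have e2 := risingS s k.
have sn0 : s != 0 by apply: contraTneq s0 => ->; rewrite ltxx.
have sk0 : s + k.+1%:R != 0.
  by move: r2; rewrite e2 mulf_eq0 negb_or => /andP[].
have -> : rising s k = rising s k.+1 / (s + k.+1%:R) by rewrite e2 mulfK.
have -> : rising (s + 1) k = rising s k.+1 / s by rewrite e1 mulrC mulKf.
rewrite factS natrM -[k.+1%:R]natr1 in sk0 *.
by field; rewrite r2 NC sn0 sk0.
Qed.

Definition harm s k : C := \sum_(j < k.+1) (s + j%:R)^-1.

(** The logarithmic derivative of Euler's product, obtained from the recurrence instead of
    differentiating a product. *)
Lemma trunc_mellin'E k s : 0 < Re s ->
  trunc_mellin' k s = trunc_mellin k s * ((ln NR)%:C - harm s k).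
Proof.
elim: k s => [|k IH] s s0.
  by rewrite trunc_mellin'0 // /harm big_ord_recl big_ord0 !addr0.
rewrite trunc_mellin'S // IH // IH ?ReS // !trunc_mellinE ?ReS // cexp_succ //.
have r0 := rising_neq0 k s0; have r1 := rising_neq0 k (ReS s0).
have r2 := rising_neq0 k.+1 s0.
have e1 := rising_shift s k; have e2 := risingS s k.
have sn0 : s != 0 by apply: contraTneq s0 => ->; rewrite ltxx.
have sk0 : s + k.+1%:R != 0.
  by move: r2; rewrite e2 mulf_eq0 negb_or => /andP[].
have h1 : harm s k = harm s k.+1 - (s + k.+1%:R)^-1 by rewrite /harm [in RHS]big_ord_recr /= addrK.
have h2 : harm (s + 1) k = harm s k.+1 - s^-1.
  rewrite /harm [in RHS]big_ord_recl /= addr0 addrAC subrr add0r; apply: eq_bigr => j _.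
  by rewrite /bump leq0n natrD addrA.
rewrite h1 h2; move: (harm s k.+1) => H.
have -> : rising s k = rising s k.+1 / (s + k.+1%:R) by rewrite e2 mulfK.
have -> : rising (s + 1) k = rising s k.+1 / s by rewrite e1 mulrC mulKf.
rewrite factS natrM -[k.+1%:R]natr1 in sk0 *.
by field; rewrite r2 NC sn0 sk0.
Qed.

End Truncated.

Lemma cintegral_factor_lim D (f : R -> C) (c : nat -> R -> R) : measurable D ->
  cintegrable D f -> (forall n, measurable_fun D (c n)) ->
  (forall n x, D x -> `|c n x| <= 1) -> (forall x, D x -> c n x @[n --> \oo] --> (1 : R)) ->
  cintegral D (fun x => (c n x)%:C * f x) @[n --> \oo] --> cintegral D f.
Proof.
move=> mD fi mc c1 cl; have [f1 f2] := cintegrable_cmeas fi.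
apply: (@cintegral_dominated _ D _ _ (fun x => `|Re (f x)| + `|Im (f x)|)) => //.
- by move=> n; apply: cmeasM; [exact: cmeas_real|].
- move=> x Dx; rewrite -[X in _ --> X]mul1r.
  by apply: (cvgCM _ (cvgCc _)); exact: cvgC_real (cl x Dx).
- case: fi => i1 i2; rewrite (_ : _ \o _ = (fun x => `|(Re (f x))%:E| + `|(Im (f x))%:E|)%E) //.
  by apply: integrableD => //; exact: integrable_abse.
- move=> n x Dx; rewrite cabsM cabs_real; apply: le_trans (cabs_ReIm _).
  by rewrite ler_piMl ?c1 // /cabs sqrtr_ge0.
Qed.

Lemma bernoulli x (n : nat) : 0 <= x <= 1 -> 1 - n%:R * x <= (1 - x) ^+ n.
Proof.
move=> /andP[x0 x1]; elim: n => [|n IH]; first by rewrite mul0r subr0 expr0.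
have h : 0 <= 1 - x by rewrite subr_ge0.
rewrite exprS; apply: le_trans (ler_wpM2l h IH).
have := mulr_ge0 (ler0n R n) (sqr_ge0 x); rewrite -natr1; nra.
Qed.

(** The quotient of the truncated kernel with [NR = k = n + 1] by the Gamma kernel, extended by 0.
    It lies in [0, 1] and tends to 1, so the Gamma integrand dominates its own truncations, with or
    without the factor [ln x]. *)
Definition trunc_ratio (n : nat) x : R :=
  if x \in (`]0, n.+1%:R]%classic : set R) then (1 - x / n.+1%:R) ^+ n.+1 * expR x else 0.

Lemma trunc_ratio_le n x : 0 < x -> 0 <= trunc_ratio n x <= 1.
Proof.
move=> x0; rewrite /trunc_ratio; case: ifPn => [|_]; last by rewrite lexx ler01.
rewrite inE /= in_itv /= => /andP[_ xn].
have h : 0 <= 1 - x / n.+1%:R by rewrite subr_ge0 ler_pdivrMr // mul1r.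
rewrite mulr_ge0 ?exprn_ge0 ?expR_ge0 //=.
have -> : expR x = expR (x / n.+1%:R) ^+ n.+1.
  by rewrite -expRM_natl mulrC -mulrA mulVf ?mulr1.
rewrite -exprMn; apply: exprn_ile1; first by rewrite mulr_ge0 ?expR_ge0.
rewrite -[X in _ <= X](expRxMexpNx_1 (x / n.+1%:R)) mulrC ler_pM2l ?expR_gt0 //.
exact: expR_ge1Dx.
Qed.

(** With u = x / (n + 1), [exp u >= 1 + u] gives [(1 - u) exp u >= 1 - u^2], and Bernoulli's
    inequality bounds the power of exponent [n + 1]. *)
Lemma trunc_ratio_ge n x : 0 < x -> x <= n.+1%:R -> 1 - x ^+ 2 / n.+1%:R <= trunc_ratio n x.
Proof.
move=> x0 xn; rewrite /trunc_ratio ifT; last by rewrite inE /= in_itv /= x0.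
set u := x / n.+1%:R.
have u01 : 0 <= u <= 1 by rewrite /u divr_ge0 ?(ltW x0) //= ler_pdivrMr // mul1r.
have -> : expR x = expR u ^+ n.+1 by rewrite -expRM_natl /u mulrC -mulrA mulVf ?mulr1.
have u2 : 0 <= u ^+ 2 <= 1 by rewrite sqr_ge0 /= expr_le1 //; case/andP: u01.
have -> : x ^+ 2 / n.+1%:R = n.+1%:R * u ^+ 2.
  rewrite /u expr_div_n; set m : R := n.+1%:R.
  have m0 : m != 0 by rewrite /m pnatr_eq0.
  by field.
apply: (le_trans (bernoulli n.+1 u2)); rewrite -exprMn; apply: lerXn2r.
- by rewrite nnegrE subr_ge0; case/andP: u2.
- by rewrite nnegrE mulr_ge0 ?expR_ge0 // subr_ge0; case/andP: u01.
rewrite -[1 in X in X <= _](expr1n _ 2) subr_sqr ler_wpM2l ?expR_ge1Dx // subr_ge0.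
by case/andP: u01.
Qed.

Lemma trunc_ratio_lim x : 0 < x -> trunc_ratio n x @[n --> \oo] --> (1 : R).
Proof.
move=> x0; have h : 1 - x ^+ 2 / n.+1%:R @[n --> \oo] --> (1 : R).
  rewrite -[X in _ --> X]subr0 -[X in _ - X](mulr0 (x ^+ 2)).
  apply: cvgB; first exact: cvg_cst.
  by apply: cvgM; [exact: cvg_cst|exact: cvg_harmonic].
apply: squeeze_cvgr; [|exact: h|exact: cvg_cst].
exists (Num.truncn x) => // n /= xn.
have /andP[_ ->] := trunc_ratio_le n x0; rewrite andbT.
apply: trunc_ratio_ge => //; apply: (le_trans (ltW (truncnS_gt _))).
by rewrite ler_nat ltnS.
Qed.

Lemma measurable_trunc_ratio n : measurable_fun D0 (trunc_ratio n).
Proof.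
have mE : measurable (`]0, n.+1%:R]%classic : set R) by exact: measurable_itv.
have m : cmeas D0 (fun x => if x \in (`]0, n.+1%:R]%classic : set R) then
     ((1 - x / n.+1%:R) ^+ n.+1 * expR x)%:C else (0 : C)).
  apply: cmeas_restrict => //; last first.
    by move=> x; rewrite /D0 /= !in_itv /= andbT => /andP[].
  apply: cmeas_real; apply: measurable_funM; last exact: measurable_funTS (@measurable_expR R).
  apply: measurable_funX; apply: measurable_funB => //.
  by apply: measurable_funM => //; exact: measurable_id.
apply: (eq_measurable_fun _ _ m.1) => x _.
by rewrite /trunc_ratio; case: ifP.
Qed.

Let ge1 (n : nat) : (1 : R) <= n.+1%:R. Proof. by rewrite ler1n. Qed.

Lemma trunc_ratioE n x : x \in (`]0, n.+1%:R]%classic : set R) ->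
  trunc_kernel n.+1%:R n.+1 x = (trunc_ratio n x)%:C * gamma_kernel x.
Proof.
move=> h; rewrite /trunc_ratio h /trunc_kernel /gamma_kernel -rmorphM /=; congr (_%:C).
by rewrite mulrA -[_ * expR x * _]mulrA expRxMexpNx_1 mulr1.
Qed.

Lemma Gm_lim s : 0 < Re s -> trunc_mellin n.+1%:R n.+1 s @[n --> \oo] --> Gm s.
Proof.
move=> s0; pose proof (@cintegral_factor_lim _ _ trunc_ratio mD0 (Gm_integrable s0)
  measurable_trunc_ratio) as H.
have H2 := H _ _; apply: (cvgC_ext _ (H2 _ _)).
- move=> n; rewrite /trunc_mellin /mellin /laplace (@cintegral_restrict _ D0 `]0, n.+1%:R]%classic); last first.
    by move=> x; rewrite /D0 /= !in_itv /= andbT => /andP[].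
  apply: eq_cintegral => x _; case: ifPn => h; first by rewrite trunc_ratioE // mulrA.
  by rewrite /trunc_ratio (negbTE h) mul0r.
- move=> n x; rewrite /D0 /= in_itv /= andbT => x0.
  by have /andP[h1 h2] := trunc_ratio_le n x0; rewrite ger0_norm.
- by move=> x; rewrite /D0 /= in_itv /= andbT => x0; exact: trunc_ratio_lim.
Qed.

Lemma Gm'_lim s : 0 < Re s -> trunc_mellin' n.+1%:R n.+1 s @[n --> \oo] --> Gm' s.
Proof.
move=> s0; pose proof (@cintegral_factor_lim _ _ trunc_ratio mD0 (Gm_integrable_ln s0)
  measurable_trunc_ratio) as H.
have H2 := H _ _; apply: (cvgC_ext _ (H2 _ _)).
- move=> n; rewrite /trunc_mellin' (@cintegral_restrict _ D0 `]0, n.+1%:R]%classic); last first.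
    by move=> x; rewrite /D0 /= !in_itv /= andbT => /andP[].
  apply: eq_cintegral => x _; case: ifPn => h; first by rewrite trunc_ratioE // !mulrA.
  by rewrite /trunc_ratio (negbTE h) mul0r.
- move=> n x; rewrite /D0 /= in_itv /= andbT => x0.
  by have /andP[h1 h2] := trunc_ratio_le n x0; rewrite ger0_norm.
- by move=> x; rewrite /D0 /= in_itv /= andbT => x0; exact: trunc_ratio_lim.
Qed.

(** * Nonvanishing of Gamma and the digamma function *)

Definition rharm (n : nat) : R := \sum_(j < n) j.+1%:R^-1.

Lemma rharm_le n : rharm n.+1 <= 1 + ln n.+1%:R.
Proof.
elim: n => [|n IH]; first by rewrite /rharm big_ord1 ln1 addr0 invr1.
rewrite /rharm big_ord_recr /= -/(rharm n.+1); apply: (le_trans (lerD IH (lexx _))).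
rewrite -addrA lerD2l.
have h : ln (n.+1%:R / n.+2%:R : R) <= n.+1%:R / n.+2%:R - 1.
  rewrite lerBrDl -{1}[n.+1%:R / n.+2%:R]lnK ?posrE ?divr_gt0 //.
  by rewrite lnK ?posrE ?divr_gt0 //; have := expR_ge1Dx (ln (n.+1%:R / n.+2%:R : R));
     rewrite lnK ?posrE ?divr_gt0.
rewrite lnM ?posrE ?invr_gt0 // lnV ?posrE // in h.
have e : (n.+1%:R / n.+2%:R : R) - 1 = - n.+2%:R^-1.
  have h0 : (n.+2%:R : R) != 0 by rewrite pnatr_eq0.
  by rewrite -[X in X / _ - _](addrK 1) natr1; field.
by move: h; rewrite e; move: (ln n.+1%:R) (ln n.+2%:R) (n.+2%:R^-1) => x y v; lra.
Qed.

Definition rharm2 (n : nat) : R := \sum_(j < n) j.+1%:R^-1 ^+ 2.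

Lemma rharm2_le n : rharm2 n.+1 <= 2 - n.+1%:R^-1.
Proof.
elim: n => [|n IH]; first by rewrite /rharm2 big_ord1 invr1 expr1n; lra.
rewrite /rharm2 big_ord_recr /= -/(rharm2 n.+1); apply: (le_trans (lerD IH (lexx _))).
rewrite -[n.+2%:R]natr1; have : (0 : R) < n.+1%:R by [].
move: (n.+1%:R) => m m0; have m1 : 0 < m + 1 by lra.
rewrite -subr_ge0 (_ : _ - _ = (m * (m + 1) ^+ 2)^-1); first by rewrite invr_ge0 mulr_ge0 ?sqr_ge0 // ltW.
by field; rewrite !gt_eqF.
Qed.

(** Each factor satisfies |s + j|^2 = j^2 (1 + 2 Re s / j + |s|^2 / j^2). By [1 + u <= exp u] the
    corrections accumulate in the exponent as partial sums of 1/j and 1/j^2. *)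
Lemma rising_le s n : 0 < Re s -> cabs (rising s n) ^+ 2 <=
  cabs s ^+ 2 * n`!%:R ^+ 2 * expR (2 * Re s * rharm n + cabs s ^+ 2 * rharm2 n).
Proof.
move=> s0; elim: n => [|n IH].
  rewrite /rharm /rharm2 !big_ord0 !mulr0 addr0 expR0 fact0 expr1n !mulr1.
  by rewrite /rising big_ord1 addr0.
have e : cabs (s + n.+1%:R) ^+ 2 <= n.+1%:R ^+ 2 *
    expR (2 * Re s * n.+1%:R^-1 + cabs s ^+ 2 * n.+1%:R^-1 ^+ 2).
  apply: le_trans (ler_wpM2l (sqr_ge0 _) (expR_ge1Dx _)).
  rewrite !cabs_sqr ReD ImD -(rmorph_nat (real_complex R)) /= addr0.
  have : (n.+1%:R : R) != 0 by []; move: (n.+1%:R : R) => m m0.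
  by rewrite le_eqVlt; apply/orP; left; apply/eqP; field.
rewrite risingS cabsM exprMn.
apply: (le_trans (ler_pM (sqr_ge0 _) (sqr_ge0 _) IH e)).
rewrite /rharm /rharm2 ![in leRHS]big_ord_recr /= -/(rharm n) -/(rharm2 n) factS natrM exprMn.
rewrite [X in _ <= _ * expR X](_ : _ = (2 * Re s * rharm n + cabs s ^+ 2 * rharm2 n) +
  (2 * Re s / n.+1%:R + cabs s ^+ 2 * n.+1%:R^-1 ^+ 2)); last by ring.
by rewrite [in leRHS]expRD le_eqVlt; apply/orP; left; apply/eqP; ring.
Qed.

(** The bound does not depend on [n]: [rharm] grows at most like the logarithm, which is compensated
    by the factor [NR^s] of Euler's product. Hence the limit, Gamma, has no zero. *)
Lemma trunc_mellin_ge s n : 0 < Re s ->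
  (cabs s ^+ 2 * expR (2 * Re s + 2 * cabs s ^+ 2))^-1 <= cabs (trunc_mellin n.+1%:R n.+1 s) ^+ 2.
Proof.
move=> s0; rewrite trunc_mellinE // !cabsM cabs_nat cabsV cabs_cexp ReM /= mulr0 subr0.
have sn0 : 0 < cabs s by rewrite cabs_gt0; apply: contraTneq s0 => ->; rewrite ltxx.
have r0 : 0 < cabs (rising s n.+1) by rewrite cabs_gt0 rising_neq0.
have h := rising_le n.+1 s0.
have h1 := rharm_le n; have h2 := rharm2_le n.
have h2' : rharm2 n.+1 <= 2 by apply: (le_trans h2); rewrite gerBl.
have h3 : expR (2 * Re s * rharm n.+1 + cabs s ^+ 2 * rharm2 n.+1) <=
    expR (2 * Re s + 2 * cabs s ^+ 2) * expR (Re s * ln n.+1%:R) ^+ 2.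
  rewrite -expRM_natl -expRD ler_expR.
  have e1 : Re s * rharm n.+1 <= Re s * (1 + ln n.+1%:R) by rewrite ler_pM2l.
  have e2 : cabs s ^+ 2 * rharm2 n.+1 <= cabs s ^+ 2 * 2 by rewrite ler_wpM2l ?sqr_ge0.
  by move: e1 e2; lra.
have p1 : 0 < expR (Re s * ln n.+1%:R) by exact: expR_gt0.
have f0 : 0 < (n.+1`!%:R : R) by rewrite ltr0n fact_gt0.
move: h h3 p1 f0 r0 sn0; move: (cabs (rising s n.+1)) (cabs s) (n.+1`!%:R : R).
move=> r c f; move: (expR (Re s * ln n.+1%:R)) => P.
move: (expR (2 * Re s * rharm n.+1 + c ^+ 2 * rharm2 n.+1)) (expR _) (expR_gt0 (2 * Re s + 2 * c ^+ 2)).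
move=> X K K0 h h3 P0 f0 r0 c0.
rewrite -[leLHS]mul1r ler_pdivrMr; last by rewrite mulr_gt0 // exprn_gt0.
rewrite expr_div_n exprMn mulrAC ler_pdivlMr ?exprn_gt0 // mul1r.
apply: (le_trans h); apply: (le_trans (ler_wpM2l _ h3)).
  by rewrite mulr_ge0 ?sqr_ge0.
by rewrite le_eqVlt; apply/orP; left; apply/eqP; ring.
Qed.

Lemma Gm_neq0 s : 0 < Re s -> Gm s != 0.
Proof.
move=> s0; apply/eqP => G0; have h := Gm_lim s0; rewrite G0 in h.
set c := (cabs s ^+ 2 * expR (2 * Re s + 2 * cabs s ^+ 2))^-1.
have c0 : 0 < c.
  rewrite invr_gt0 mulr_gt0 ?expR_gt0 // exprn_gt0 // cabs_gt0.
  by apply: contraTneq s0 => ->; rewrite ltxx.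
pose proof (cvgC_cabs (cvgCM h h)) as H; move: H; rewrite mulr0 cabs0.
move/cvgrPdist_lt => /(_ _ c0) [N _] /(_ N (leqnn N)) /=.
rewrite sub0r normrN cabsM -expr2 ger0_norm ?sqr_ge0 // => h1.
by have := lt_le_trans h1 (trunc_mellin_ge N s0); rewrite ltxx.
Qed.

Lemma Gamma_cder s : 0 < Re s < 1 -> cder Gamma s (Gm' s).
Proof.
move=> /andP[s0 s1]; apply: cder_near (Gm_cder s0).
apply/nbhsCP; exists (Num.min (Re s) (1 - Re s)); first by rewrite lt_min s0 subr_gt0.
move=> w; rewrite lt_min => /andP[h1 h2]; rewrite GammaE //.
have := le_lt_trans (cabs_Re _) h1; have := le_lt_trans (cabs_Re _) h2.
rewrite ReD ReN !ltr_norml => /andP[_ a] /andP[b _]; apply/andP; split; lra.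
Qed.

Lemma digammaE s : 0 < Re s < 1 -> digamma s = Gm' s / Gm s.
Proof.
move=> h; rewrite /digamma (cderive_val (Gamma_cder h)) GammaE //.
by case/andP: h => -> /ltW.
Qed.

(** The truncated integral cancels in the quotient, leaving a logarithm minus a harmonic sum. In the
    difference of two values the logarithms cancel too, which yields [digamma_sub]. *)
Lemma digamma_lim s : 0 < Re s < 1 ->
  ((ln n.+1%:R)%:C - harm s n.+1) @[n --> \oo] --> digamma s.
Proof.
move=> h; rewrite digammaE //; case/andP: h => s0 _.
pose proof (cvgCM (Gm'_lim s0) (cvgCV (Gm_lim s0) (Gm_neq0 s0))) as H.
apply: cvgC_ext H => n; rewrite trunc_mellin'E // mulrAC mulfV ?mul1r //.
by rewrite trunc_mellinE // mulf_neq0 ?invr_eq0 ?rising_neq0 // mulf_neq0 ?cexp_neq0 // pnatr_eq0 -lt0n fact_gt0.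
Qed.

Lemma addn_neq0 s (n : nat) : 0 < Re s -> n%:R + s != 0.
Proof.
move=> s0; apply: contraTneq s0 => /(congr1 (@complex.Re R)).
rewrite ReD -(rmorph_nat (real_complex R)) /= => h; rewrite -leNgt.
by have := ler0n R n; lra.
Qed.

Lemma digamma_sub (a b : C) : 0 < Re a < 1 -> 0 < Re b < 1 ->
  (a - b) * series (fun n => (n%:R + a)^-1 * (n%:R + b)^-1) n @[n --> \oo] -->
  digamma a - digamma b.
Proof.
move=> ha hb; rewrite -(cvg_shiftn 2).
apply: cvgC_ext (cvgCB (digamma_lim ha) (digamma_lim hb)) => n.
case/andP: ha => a0 _; case/andP: hb => b0 _.
transitivity (harm b n.+1 - harm a n.+1); first by ring.
rewrite /harm -sumrB /= addn2 seriesC_sum big_distrr.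
apply: eq_bigr => j _ /=.
have := addn_neq0 j a0; have := addn_neq0 j b0; rewrite ![_ + j%:R]addrC.
by move: (j%:R : C) => J h1 h2; field; rewrite h1 h2.
Qed.

End GammaFunction.

(** * The theta function *)

Section Theta.
Context {R : realType}.
Local Notation C := R[i].
Implicit Types x y : R.

Definition cis y : C := cexp ('i%C * y%:C).

Lemma cisE y : cis y = cos y +i* sin y.
Proof. by rewrite /cis /cexp ReM ImM /= !mul0r !mul1r subr0 add0r expR0 !mul1r. Qed.

Lemma cisD x y : cis (x + y) = cis x * cis y.
Proof. by rewrite /cis rmorphD /= mulrDr cexpD. Qed.

Lemma cisX y n : cis y ^+ n = cis (n%:R * y).
Proof.
elim: n => [|n IH]; first by rewrite mul0r expr0 cisE cos0 sin0.
by rewrite exprS IH -cisD -natr1 mulrDl mul1r addrC.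
Qed.

Lemma cis_cos y : ((2 * cos y)%:C : C) = cis y + cis (- y).
Proof.
rewrite !cisE cosN sinN; apply: complexP; rewrite ?ReD ?ImD /=; last by rewrite subrr.
by rewrite mulr_natl mulr2n.
Qed.

Lemma cos_pow N y : (2 * cos y) ^+ N =
  \sum_(i < N.+1) 'C(N, i)%:R * cos ((N%:R - 2 * i%:R) * y).
Proof.
transitivity (Re (((2 * cos y)%:C : C) ^+ N)); first by rewrite -rmorphXn.
rewrite cis_cos exprDn Re_sum; apply: eq_bigr => i _.
rewrite !cisX -cisD -mulr_natl -(rmorph_nat (real_complex R)) ReZ cisE /=.
congr (_ * cos _); rewrite natrB; last by rewrite -ltnS.
by ring.
Qed.

Lemma cis_2pi (d : nat) : cis (d%:R * (2 * pi)) = 1.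
Proof.
rewrite -cisX (_ : cis _ = 1) ?expr1n //.
by rewrite cisE [2 * _]mulr_natl cos2pi sin2pi; apply: complexP.
Qed.

(** The real part of a geometric sum of powers of an l-th root of unity, which is 1 exactly when [l]
    divides [d]. *)
Lemma cos_sum (l d : nat) : (0 < l)%N ->
  \sum_(k < l) cos (2 * d%:R * (pi * k%:R / l%:R)) = if (l %| d)%N then l%:R else 0 :> R.
Proof.
move=> l0; have lR : (l%:R : R) != 0 by rewrite pnatr_eq0 -lt0n.
pose z := cis (d%:R * (2 * pi) / l%:R).
transitivity (Re (\sum_(k < l) z ^+ k)).
  rewrite Re_sum; apply: eq_bigr => k _; rewrite /z cisX cisE /=.
  by congr (cos _); ring.
have zl : z ^+ l = 1 by rewrite /z cisX mulrC divfK // cis_2pi.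
have zd : z = cis ((d %% l)%:R * (2 * pi) / l%:R).
  rewrite /z {1}(divn_eq d l) natrD natrM.
  rewrite [X in cis X](_ : _ = (d %/ l)%:R * (2 * pi) + (d %% l)%:R * (2 * pi) / l%:R).
    by rewrite cisD cis_2pi mul1r.
  by field.
case: ifPn => [|ld].
  rewrite /dvdn => /eqP d0; rewrite zd d0 !mul0r cisE cos0 sin0.
  rewrite (eq_bigr (fun=> 1)); last by move=> k _; rewrite expr1n.
  by rewrite sumr_const card_ord -(rmorph_nat (real_complex R)).
(* The half-angle [t] lies strictly between 0 and pi, so [cos (2 t) < 1]. *)
have z1 : z != 1.
  apply/eqP; rewrite zd cisE => /(congr1 (@complex.Re R)) /=.
  set t := (d %% l)%:R * pi / l%:R : R.
  rewrite (_ : _ / _ = t *+ 2); last by rewrite /t -mulr_natl; ring.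
  rewrite mulr2n cosD => h.
  have t0 : 0 < sin t.
    apply: sin_gt0_pi; rewrite /t; apply/andP; split.
      apply: divr_gt0; last by rewrite ltr0n.
      by apply: mulr_gt0; [rewrite ltr0n lt0n; exact: ld|exact: pi_gt0].
    by rewrite ltr_pdivrMr ?ltr0n // mulrC ltr_pM2l ?pi_gt0 // ltr_nat ltn_mod.
  have := cos2Dsin2 t; have := exprn_gt0 2 t0; move: h; rewrite -!expr2; lra.
have : (z - 1) * \sum_(k < l) z ^+ k = 0 by rewrite -subrX1 zl subrr.
by move/eqP; rewrite mulf_eq0 subr_eq0 (negbTE z1) /= => /eqP ->.
Qed.

Lemma sum_multiples (l J : nat) (G : nat -> R) : (0 < l)%N ->
  \sum_(d < J * l) (if (l %| d.+1)%N then G d.+1 else 0) = \sum_(j < J) G (j.+1 * l)%N.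
Proof.
case: l => // l _; elim: J => [|J IH]; first by rewrite mul0n !big_ord0.
rewrite [in RHS]big_ord_recr /= -IH -(big_mkord xpredT (fun d => if (l.+1 %| d.+1)%N then G d.+1 else 0)).
rewrite -(big_mkord xpredT (fun d => if (l.+1 %| d.+1)%N then G d.+1 else 0)).
rewrite (@big_cat_nat _ _ _ (J * l.+1)) //=; last by rewrite leq_mul2r leqnSn orbT.
congr (_ + _); rewrite mulSn addnC -{1}[(J * l.+1)%N]add0n big_addn addKn.
rewrite big_nat_recr //= big1_seq ?add0r.
  by rewrite ifT ?addSn ?[(l + _)%N]addnC -?addnS -?mulSnr ?dvdn_mull // mulSnr.
move=> r /andP[_]; rewrite mem_index_iota /= => rl; rewrite ifF //.
by rewrite -addSn dvdn_addl ?dvdn_mull // gtnNdvd.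
Qed.

(** In the binomial expansion of (2 cos)^(2m), summation over [l] equidistant angles keeps the
    frequencies divisible by [l], that is, the coefficients at distances [j l] from the centre.
    Those with [j l > m] are 0, so [m] is a sufficient upper limit for [j]. *)
Lemma polya_identity (l m : nat) : (0 < l)%N ->
  \sum_(k < l) (2 * cos (pi * k%:R / l%:R)) ^+ (m + m) =
  l%:R * ('C(m + m, m)%:R + 2 * \sum_(j < m) 'C(m + m, m + j.+1 * l)%:R) :> R.
Proof.
move=> l0; under eq_bigr do rewrite cos_pow.
rewrite exchange_big /=.
pose F (i : nat) : R := \sum_(k < l) 'C(m + m, i)%:R *
   cos (((m + m)%:R - 2 * i%:R) * (pi * k%:R / l%:R)).
pose S (d : nat) : R := if (l %| d)%N then l%:R else 0.
have Fp d : F (m + d)%N = 'C(m + m, m + d)%:R * S d.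
  rewrite /F /S -big_distrr /= -cos_sum //; congr (_ * _); apply: eq_bigr => k _.
  by rewrite -cosN -mulNr !natrD; congr (cos (_ * _)); ring.
have Fm d : (d <= m)%N -> F (m - d)%N = 'C(m + m, m + d)%:R * S d.
  move=> dm; rewrite /F /S -big_distrr /= -cos_sum //; congr (_ * _).
    have -> : (m - d = (m + m) - (m + d))%N by lia.
    by rewrite bin_sub ?leq_add2l.
  by apply: eq_bigr => k _; rewrite !natrD natrB //; congr (cos (_ * _)); ring.
rewrite -(big_mkord xpredT F) (@big_cat_nat _ _ _ m) //=; last by lia.
rewrite [X in _ + X]big_ltn; last by lia.
have -> : F m = 'C(m + m, m)%:R * S 0 by have := Fp 0; rewrite addn0.
have e1 : \sum_(0 <= i < m) F i = \sum_(d < m) 'C(m + m, m + d.+1)%:R * S d.+1.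
  rewrite big_nat_rev /= big_mkord; apply: eq_bigr => i _; rewrite add0n Fm //.
have e2 : \sum_(m.+1 <= i < (m + m).+1) F i = \sum_(d < m) 'C(m + m, m + d.+1)%:R * S d.+1.
  rewrite -{1}[m.+1]add0n big_addn subSS addnK big_mkord; apply: eq_bigr => i _.
  by rewrite -Fp; congr F; lia.
have e3 : \sum_(d < m) 'C(m + m, m + d.+1)%:R * S d.+1 =
   l%:R * \sum_(j < m) 'C(m + m, m + j.+1 * l)%:R.
  rewrite -(sum_multiples m (fun d => 'C(m + m, m + d)%:R)) //.
  have -> : (m * l = m + m * l.-1)%N by case: (l) l0 => //= l' _; rewrite mulnS.
  rewrite big_split_ord /= [X in _ + X]big1 ?addr0; last first.
    move=> d _; rewrite bin_small ?if_same //; lia.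
  rewrite big_distrr; apply: eq_bigr => d _ /=; rewrite /S; case: ifP; rewrite ?mulr0 // mulrC //.
by rewrite e1 e2 e3 /S dvdn0; ring.
Qed.

(** The number of angles is odd, so [k] and its reflection pair off, with opposite cosines and an
    even exponent. After folding, all angles lie in [0, pi/2], the range of [cos_le_exp]. *)
Lemma cos_sum_fold (n m : nat) :
  \sum_(k < (n + n).+1) (2 * cos (pi * k%:R / (n + n).+1%:R)) ^+ (m + m) =
  2 ^+ (m + m) * (1 + 2 * \sum_(k < n) cos (pi * k.+1%:R / (n + n).+1%:R) ^+ (m + m)) :> R.
Proof.
pose l : R := (n + n).+1%:R; have l0 : l != 0 by rewrite pnatr_eq0.
rewrite -/l; under eq_bigr do rewrite exprMn.
rewrite -big_distrr /=; congr (_ * _).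
rewrite big_ord_recl mulr0 mul0r cos0 expr1n; congr (_ + _).
rewrite big_split_ord /= mulr_natl mulr2n; congr (_ + _).
rewrite [LHS](reindex_inj rev_ord_inj) /=; apply: eq_bigr => k _.
rewrite addnn -mul2n !exprM; congr (_ ^+ m).
have -> : pi * (bump 0 (n + (n - k.+1)))%:R / l = pi - pi * k.+1%:R / l.
  rewrite (_ : bump 0 _ = (n + n).+1 - k.+1)%N; last by rewrite /bump leq0n; have := ltn_ord k; lia.
  by rewrite natrB; [rewrite -/l; field|have := ltn_ord k; lia].
by rewrite cosB cospi sinpi mul0r addr0 mulN1r sqrrN.
Qed.

(** * Gaussian estimates for cosines and binomial coefficients *)

Lemma ge0_derive_le (f f' : R -> R) (a b : R) : a <= b ->
  (forall x, a <= x <= b -> is_derive x 1 f (f' x)) ->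
  (forall x, a < x < b -> 0 <= f' x) -> f a <= f b.
Proof.
rewrite le_eqVlt => /predU1P[->//|ab] df f0.
have d x : x \in `]a, b[ -> is_derive x 1 f (f' x).
  by rewrite in_itv /= => /andP[h1 h2]; apply: df; rewrite !ltW.
have cf : {within `[a, b], continuous f}.
  apply: continuous_in_subspaceT => x; rewrite inE /= in_itv /= => h.
  by apply: differentiable_continuous; apply/derivable1_diffP; case: (df x h).
have [c] := MVT ab d cf.
rewrite in_itv /= => c01 e; rewrite -subr_ge0 e mulr_ge0 ?f0 //.
by rewrite subr_ge0 ltW.
Qed.

Lemma sin_ge_ycos y : 0 <= y <= pi -> y * cos y <= sin y.
Proof.
move=> /andP[y0 yp]; rewrite -subr_ge0.
have -> : 0 = sin 0 - 0 * cos 0 :> R by rewrite sin0 mul0r subr0.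
apply: (@ge0_derive_le (fun y => sin y - y * cos y) (fun y => y * sin y)) => //.
  move=> x _; apply: (is_derive_eq' (is_deriveBR (is_derive_sin x) (is_deriveMR (is_derive_idR x) (is_derive_cos x)))).
  by ring.
move=> x /andP[x0 xy]; apply: mulr_ge0; first exact: ltW.
by apply: sin_ge0_pi; rewrite (ltW x0) /=; apply: (le_trans (ltW xy)).
Qed.

(** The product cos y exp(y^2 / 2) is decreasing, since its derivative has the sign of
    [y cos y - sin y]. *)
Lemma cos_le_exp y : 0 <= y <= pi / 2 -> cos y <= expR (- (y ^+ 2 / 2)).
Proof.
move=> /andP[y0 yp]; rewrite expRN -div1r ler_pdivlMr ?expR_gt0 //.
rewrite -lerN2; have -> : -1 = - (cos 0 * expR (0 ^+ 2 / 2)) :> R.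
  by rewrite cos0 expr0n mul0r expR0 mulr1.
apply: (@ge0_derive_le (fun y => - (cos y * expR (y ^+ 2 / 2)))
  (fun y => expR (y ^+ 2 / 2) * (sin y - y * cos y))) => //.
  move=> x _; have h : is_derive x 1 (fun y : R => expR (y ^+ 2 / 2)) (expR (x ^+ 2 / 2) * x).
    apply: (is_derive_compR (g := fun y : R => y ^+ 2 / 2) (is_derive_expR _)).
    by apply: (is_derive_eq' (is_deriveMR (is_deriveMR (is_derive_idR x) (is_derive_idR x)) (is_derive_cstR 2^-1 x))); field.
  by apply: (is_derive_eq' (is_deriveN (is_deriveMR (is_derive_cos x) h))); ring.
move=> x /andP[x0 xy]; apply: mulr_ge0; first exact: expR_ge0.
rewrite subr_ge0; apply: sin_ge_ycos; rewrite (ltW x0) /=.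
by have := pi_gt0 R; lra.
Qed.

Lemma expR_lower_1B (v : R) : 0 <= v < 1 -> expR (- (v / (1 - v))) <= 1 - v.
Proof.
move=> /andP[v0 v1]; have h : 0 < 1 - v by rewrite subr_gt0.
rewrite expRN -[leRHS]invrK lef_pV2 ?posrE ?invr_gt0 ?expR_gt0 //.
apply: le_trans (expR_ge1Dx _); rewrite le_eqVlt; apply/orP; left; apply/eqP.
by field; rewrite gt_eqF.
Qed.

(** A local limit theorem with explicit error. Consecutive coefficients have ratio 1 - (2i+1) /
    (m+i+1), which lies between the exponentials of -(2i+1) / (m-J) and -(2i+1) / (m+J); the odd
    numbers then sum to i^2. *)
Lemma binomial_ratio (m J i : nat) : (J <= m)%N -> (i <= J)%N ->
  ('C(m + m, m + i)%:R : R) <= 'C(m + m, m)%:R * expR (- (i%:R ^+ 2 / (m + J)%:R)) /\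
  ((J < m)%N -> 'C(m + m, m)%:R * expR (- (i%:R ^+ 2 / (m%:R - J%:R))) <= ('C(m + m, m + i)%:R : R)).
Proof.
move=> Jm; elim: i => [|i IH] iJ.
  by rewrite addn0 expr0n !mul0r oppr0 expR0 mulr1.
have [IH1 IH2] := IH (ltnW iJ).
have m0 : (0 < m)%N by lia.
have mi0 : (0 : R) < m%:R + i.+1%:R by rewrite -natrD ltr0n; lia.
have e : ('C(m + m, m + i.+1)%:R : R) = 'C(m + m, m + i)%:R * (1 - (2 * i%:R + 1) / (m%:R + i.+1%:R)).
  have := mul_bin_left (m + m) (m + i) => /(congr1 (fun k : nat => k%:R : R)).
  rewrite !natrM -addnS natrD natrB; last by rewrite leq_add2l; lia.
  move: ('C(_, _)%:R : R) ('C(_, _)%:R : R) => X Y h.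
  rewrite -[LHS](mulKf (_ : m%:R + i.+1%:R != 0)) ?gt_eqF // h.
  have n0 : m%:R + i.+1%:R != 0 :> R by rewrite gt_eqF.
  move: n0; rewrite -natr1 !natrD => n0; by field.
set M : R := m%:R in e mi0 *; set I : R := i%:R in e IH1 IH2 *.
have I1 : i.+1%:R = I + 1 by rewrite -natr1.
have I0 : 0 <= I by exact: ler0n.
have IM : I + 1 <= M by rewrite -I1 ler_nat; lia.
have IJ : I + 1 <= J%:R by rewrite -I1 ler_nat.
have JM : J%:R <= M by rewrite ler_nat.
rewrite I1 in e mi0 *; rewrite natrD -/M in IH1 *.
set v := (2 * I + 1) / (M + (I + 1)) in e *.
have v0 : 0 <= v by rewrite /v divr_ge0 //; lra.
have v1 : v < 1 by rewrite /v ltr_pdivrMr // mul1r; lra.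
have w0 : 0 <= 1 - v by rewrite subr_ge0 ltW.
split => [|JMs].
  rewrite e; apply: (le_trans (ler_wpM2r w0 IH1)).
  rewrite -mulrA ler_wpM2l //.
  have h : 1 - v <= expR (- ((2 * I + 1) / (M + J%:R))).
    apply: (@le_trans _ _ (expR (- v))); first by have := expR_ge1Dx (- v); lra.
    rewrite ler_expR lerN2 /v ler_wpM2l ?lef_pV2 ?posrE //; lra.
  apply: (le_trans (ler_wpM2l (expR_ge0 _) h)).
  by rewrite -expRD ler_expR le_eqVlt; apply/orP; left; apply/eqP; ring.
have JMr : J%:R < M by rewrite ltr_nat.
rewrite e; apply: le_trans (ler_wpM2r w0 (IH2 JMs)).
rewrite -[leRHS]mulrA; apply: ler_wpM2l => //.
have h : expR (- ((2 * I + 1) / (M - J%:R))) <= 1 - v.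
  apply: le_trans (expR_lower_1B _); last by rewrite v0.
  have -> : v / (1 - v) = (2 * I + 1) / (M - I).
    by rewrite /v; field; apply/andP; split; rewrite gt_eqF //; lra.
  by rewrite ler_expR lerN2 ler_wpM2l ?lef_pV2 ?posrE //; lra.
apply: le_trans (ler_wpM2l (expR_ge0 _) h).
by rewrite -expRD ler_expR le_eqVlt; apply/orP; left; apply/eqP; ring.
Qed.

(** * Real series and the theta series *)

Lemma rsum_cvg (u b : nat -> R) : (forall n, `|u n| <= b n) -> cvgn (series b) ->
  series u @ \oo --> limn (series u) /\ csum (fun n => (u n)%:C) = (limn (series u))%:C.
Proof.
move=> ub cb; have h : forall n, cabs ((u n)%:C) <= b n by move=> n; rewrite cabs_real.
have h1 := csum_cvg h cb; pose proof (cvgC_Re h1) as h2.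
have h3 : series u @ \oo --> Re (csum (fun n => (u n)%:C)).
  rewrite (_ : series u = fun n => Re (series (fun k => (u k)%:C) n)) //.
  by apply/funext => n; rewrite seriesC_sum Re_sum /series /= big_mkord.
rewrite (cvg_lim _ h3) //; split => //.
apply: csum_eq; pose proof (cvgC_real h3) as h4; apply: cvgC_ext h4 => n.
by rewrite seriesC_sum /series /= big_mkord rmorph_sum.
Qed.

Lemma rsum_dominated {T : Type} (F : set_system T) {FF : ProperFilter F}
    (a : T -> nat -> R) (l b : nat -> R) :
  (\forall x \near F, forall n, `|a x n| <= b n) -> cvgn (series b) ->
  (forall n, a x n @[x --> F] --> l n) ->
  limn (series (a x)) @[x --> F] --> limn (series l).
Proof.
move=> ab cb al.
have lb n : `|l n| <= b n.
  have := @cabs_lim_le _ _ F _ (fun t => (a t n)%:C) (l n)%:C (b n) (cvgC_real (al n)).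
  by rewrite cabs_real; apply; apply: filterS ab => t /(_ n); rewrite cabs_real.
have h : csum (fun n => (a x n)%:C) @[x --> F] --> csum (fun n => (l n)%:C).
  apply: (csum_dominated _ cb) => [|n]; last exact: cvgC_real (al n).
  by apply: filterS ab => t h n; rewrite cabs_real.
pose proof (cvgC_Re h) as H; move: H; rewrite (rsum_cvg lb cb).2 /=.
apply: cvg_trans; apply: near_eq_cvg.
by apply: filterS ab => t /(@rsum_cvg (a t) b) /(_ cb) [_ ->].
Qed.

(** A finite sum of growing length becomes a series, so that Tannery's theorem applies to it. *)
Lemma rsum_finite N (f : nat -> R) :
  limn (series (fun k => if (k < N)%N then f k else 0)) = \sum_(k < N) f k.
Proof.
apply: cvg_lim => //; apply: cvg_near_cst; exists N => // n /= Nn.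
rewrite /series /= (@big_cat_nat _ _ _ N) //= [X in _ + X]big1_seq ?addr0.
  by rewrite big_mkord; apply: eq_bigr => k _; rewrite ltn_ord.
by move=> k /andP[_]; rewrite mem_index_iota => /andP[h _]; rewrite ltnNge h.
Qed.

Lemma cvg_series_expn (c : R) : 0 < c -> cvgn (series (fun n => expR (- (c * n.+1%:R)))).
Proof.
move=> c0; rewrite (_ : (fun n => _) = geometric (expR (- c)) (expR (- c))).
  apply: is_cvg_geometric_series; rewrite ger0_norm ?expR_ge0 //.
  by rewrite expR_lt1 oppr_lt0.
apply/funext => n; rewrite /geometric /= -expRM_natl -expRD; congr expR.
by rewrite -natr1; ring.
Qed.

Definition omega_term (n : nat) x : R := expR (- (pi * n.+1%:R ^+ 2 * x)).

Definition omega x : R := limn (series (fun n => omega_term n x)).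

Lemma omega_term_le (n : nat) (x y : R) : 0 < x -> x <= y ->
  `|omega_term n y| <= expR (- (pi * x * n.+1%:R)).
Proof.
move=> x0 xy; rewrite ger0_norm ?expR_ge0 // ler_expR lerN2 -!mulrA ler_pM2l ?pi_gt0 //.
rewrite [X in X <= _]mulrC ler_pM2l //; apply: (le_trans xy).
by apply: ler_peMl; [exact: le_trans (ltW x0) xy|rewrite ler1n].
Qed.

Lemma omega_gt0 x : 0 < x -> 0 < omega x.
Proof.
move=> x0; apply: (@lt_le_trans _ _ (omega_term 0 x)); first exact: expR_gt0.
have h := (rsum_cvg (fun n => @omega_term_le n x x x0 (lexx x)) (cvg_series_expn (mulr_gt0 (pi_gt0 R) x0))).1.
apply: (limr_ge (x := _)); first exact: (cvgP _ h).
exists 1%N => // n /= n1; rewrite /series /= big_ltn // lerDl.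
by apply: sumr_ge0 => i _; exact: expR_ge0.
Qed.

Definition wallis (m : nat) : R := 'C(m + m, m)%:R / 2 ^+ (m + m).

Lemma wallisS m : wallis m.+1 = wallis m * ((2 * m%:R + 1) / (2 * m%:R + 2)).
Proof.
have h1 : ((m + m.+1).+1 * 'C(m + m.+1, m) = m.+1 * 'C(m.+1 + m.+1, m.+1))%N.
  by rewrite addSn -mul_bin_diag.
have h2 : (m.+1 * 'C(m + m.+1, m) = (m + m).+1 * 'C(m + m, m))%N.
  by rewrite addnS -[(m + m)%N]/((m + m).+1.-1) mul_bin_down subSn ?leq_addr // addnK.
move: h1 h2 => /(congr1 (fun k : nat => k%:R : R)) + /(congr1 (fun k : nat => k%:R : R)).
rewrite !natrM /wallis addSn addnS !exprSr -addSn -addnS.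
have : (2 ^+ (m + m) : R) != 0 by rewrite expf_neq0 // pnatr_eq0.
move: ('C(m.+1 + m, m)%:R : R) ('C(m.+1 + m.+1, m.+1)%:R : R) ('C(m + m, m)%:R : R) (2 ^+ (m + m) : R).
have m0 : 0 < m.+1%:R :> R by [].
have -> : (m.+1 + m.+1)%:R = 2 * m.+1%:R :> R by rewrite natrD; ring.
have -> : (m.+1 + m)%:R = 2 * m.+1%:R - 1 :> R by rewrite natrD -natr1; ring.
have -> : m%:R = m.+1%:R - 1 :> R by rewrite -natr1 addrK.
move: (m.+1%:R : R) m0 => a a0 X Y Z P P0 h1 h2.
have a1 : a != 0 by rewrite gt_eqF.
have -> : Y = 2 * X by apply: (mulfI a1); rewrite -h1; ring.
have -> : X = (2 * a - 1) * Z / a by rewrite -h2 mulrAC mulfV // mul1r.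
have h : 2 * (a - 1) + 2 != 0 by rewrite gt_eqF //; lra.
by field; rewrite P0 h a1.
Qed.

(** The sequence increases, and it stays below (2m+1) wallis^2, which decreases from 1. Only the
    existence of the limit is shown; its value 1/pi is forced later by the theta identity at
    [x = 1]. *)
Lemma wallis_cvg : cvgn (fun m => m%:R * wallis m ^+ 2).
Proof.
have wS m : wallis m.+1 ^+ 2 = wallis m ^+ 2 * ((2 * m%:R + 1) ^+ 2 / (2 * m%:R + 2) ^+ 2).
  by rewrite wallisS exprMn; congr (_ * _); exact: expr_div_n.
have m0 m : 0 <= m%:R :> R by exact: ler0n.
have s0 m : 0 < (2 * m%:R + 2) ^+ 2 :> R by rewrite exprn_gt0 //; have := m0 m; lra.
apply: nondecreasing_is_cvgn.
  apply/nondecreasing_seqP => m; rewrite wS mulrC mulrCA ler_wpM2l ?sqr_ge0 //.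
  rewrite mulrA ler_pdivlMr // -[m.+1%:R]natr1.
  have := m0 m; move: (m%:R : R) => a a0; nra.
exists 1 => _ [m _ <-].
have h : (2 * m%:R + 1) * wallis m ^+ 2 <= 1.
  elim: m => [|m IH]; first by rewrite /wallis addn0 bin0 expr0 divr1 expr1n !mulr1 mulr0 add0r.
  apply: le_trans IH; rewrite wS mulrCA mulrC ler_wpM2r ?sqr_ge0 //.
  rewrite mulrA ler_pdivrMr // -[m.+1%:R]natr1.
  have := m0 m; move: (m%:R : R) => a a0.
  rewrite -subr_ge0 (_ : _ - _ = 2 * a + 1); [lra|ring].
apply: le_trans h; apply: ler_wpM2r; first exact: sqr_ge0.
by have := m0 m; lra.
Qed.

Lemma sin_le_id y : 0 <= y -> sin y <= y.
Proof.
move=> y0; rewrite -subr_ge0.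
have -> : 0 = 0 - sin 0 :> R by rewrite sin0 subr0.
apply: (@ge0_derive_le (fun y => y - sin y) (fun y => 1 - cos y) 0 y y0).
by move=> x _; rewrite subr_ge0 cos_le1.
Qed.

(** * The limit in Polya's identity *)

Section FunctionalEquation.
Variable x : R.
Hypothesis x0 : 0 < x.
(** With [m] close to x l^2 / pi, the cosine term at the angle pi k / l tends to exp(-pi k^2 x), and
    the binomial ratio at distance k l from the centre tends to exp(-pi k^2 / x). *)
Let l (n : nat) : R := (n + n).+1%:R.
Let m (n : nat) : nat := Num.truncn (x * l n ^+ 2 / pi).
Let q n : R := (m n)%:R / l n ^+ 2.
Let p0 : 0 < (pi : R) := pi_gt0 R.
Let l0 n : 0 < l n. Proof. by rewrite ltr0n. Qed.
Let l1 n : n.+1%:R <= l n. Proof. by rewrite ler_nat ltnS leq_addr. Qed.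

Let linv : (l n)^-1 @[n --> \oo] --> (0 : R).
Proof.
apply: squeeze_cvgr; [|exact: cvg_cst|exact: (@cvg_harmonic R)].
near=> n; rewrite /harmonic /= invr_ge0 (ltW (l0 n)) /= lef_pV2 ?posrE //.
Unshelve. all: by end_near. Qed.

Let q_le n : q n <= x / pi.
Proof.
rewrite /q ler_pdivrMr ?exprn_gt0 // mulrAC /m.
by rewrite truncn_le //; rewrite !mulr_ge0 ?invr_ge0 ?sqr_ge0 // ltW.
Qed.

Let q_ge n : x / pi - (l n)^-1 <= q n.
Proof.
rewrite /q ler_pdivlMr ?exprn_gt0 // mulrBl mulrAC lerBlDr.
apply: (le_trans (ltW (truncnS_gt _))); rewrite -/(m n) -natr1 lerD2l.
rewrite expr2 mulrA mulVf ?mul1r ?gt_eqF //; apply: le_trans (l1 n).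
by rewrite ler1n.
Qed.

Let qlim : q @ \oo --> x / pi.
Proof.
apply: (squeeze_cvgr (f := fun n => x / pi - (l n)^-1) (h := fun=> x / pi)).
- by near=> n; rewrite q_ge q_le.
- by rewrite -[X in _ --> X]subr0; apply: cvgB; [exact: cvg_cst|exact: linv].
- exact: cvg_cst.
Unshelve. all: by end_near. Qed.

Let mE n : (m n)%:R = q n * l n ^+ 2.
Proof. by rewrite /q divfK // expf_neq0 // gt_eqF. Qed.

(** Half the limit of [q] is a lower bound independent of [n]; it provides the summable majorant of
    the cosine terms. *)
Let q_big : \forall n \near \oo, x / (2 * pi) < q n.
Proof.
have h : x / (2 * pi) < x / pi.
  by rewrite ltr_pM2l // ltf_pV2 ?posrE ?mulr_gt0 // ltr_pMl // ltr1n.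
by move/cvgr_gt : qlim => /(_ _ h).
Qed.

Let m_infty : m n @[n --> \oo] --> \oo.
Proof.
apply/cvgnyPge => N.
have c0 : 0 < x / (2 * pi) by rewrite divr_gt0 ?mulr_gt0.
near=> n; rewrite -(ler_nat R) mE.
have qn : x / (2 * pi) < q n by near: n; exact: q_big.
have nN : (Num.truncn (N%:R / (x / (2 * pi))) < n.+1)%N.
  by near: n; exists (Num.truncn (N%:R / (x / (2 * pi)))) => // k /=; rewrite ltnS.
have h : N%:R <= x / (2 * pi) * l n.
  rewrite mulrC -ler_pdivrMr //; apply: (le_trans (ltW (truncnS_gt _))).
  by apply: le_trans (l1 n); rewrite ler_nat.
apply: (le_trans h); rewrite expr2 mulrA.
have lr : 1 <= l n by apply: le_trans (l1 n); rewrite ler1n.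
apply: (@le_trans _ _ (q n * l n)); first by rewrite ler_pM2r // ltW.
by apply: ler_peMr => //; rewrite mulr_ge0 // ltW // (lt_trans c0).
Unshelve. all: by end_near. Qed.

Let y n (k : nat) : R := pi * k.+1%:R / l n.

Let cos_term_ub n k : (k < n)%N -> 0 <= cos (y n k) ^+ (m n + m n) <= expR (- (q n * (pi * k.+1%:R) ^+ 2)).
Proof.
move=> kn; have y0 : 0 <= y n k by rewrite !mulr_ge0 ?invr_ge0 // ltW.
have y2 : y n k <= pi / 2.
  rewrite /y -mulrA ler_pM2l // ler_pdivrMr // mulrC ler_pdivlMr // -natrM ler_nat; lia.
have c0 : 0 <= cos (y n k).
  apply: cos_ge0_pihalf; rewrite y2 andbT; apply: le_trans y0.
  by rewrite oppr_le0 divr_ge0 // ltW.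
rewrite exprn_ge0 //=; apply: (le_trans (lerXn2r _ _ _ (cos_le_exp _))).
- by rewrite nnegrE.
- by rewrite nnegrE expR_ge0.
- by rewrite y0.
rewrite -expRM_natl ler_expR natrD mE /y; rewrite le_eqVlt; apply/orP; left; apply/eqP.
by field; rewrite gt_eqF.
Qed.

(** Here cos^2 = 1 - sin^2 >= 1 - y^2, to which [expR_lower_1B] applies. The denominator 1 - y^2
    tends to 1, so this bound and [cos_term_ub] have the same limit. *)
Let cos_term_lb n k : (k < n)%N -> y n k < 1 ->
  expR (- (q n * (pi * k.+1%:R) ^+ 2 / (1 - y n k ^+ 2))) <= cos (y n k) ^+ (m n + m n).
Proof.
move=> kn y1; have y0 : 0 <= y n k by rewrite !mulr_ge0 ?invr_ge0 // ltW.
have y21 : y n k ^+ 2 < 1 by rewrite expr_lt1.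
rewrite addnn -mul2n exprM cos2sin2.
have h : expR (- (y n k ^+ 2 / (1 - y n k ^+ 2))) <= 1 - sin (y n k) ^+ 2.
  apply: le_trans (expR_lower_1B _) _; first by rewrite sqr_ge0.
  rewrite lerD2l lerN2; apply: lerXn2r; rewrite ?nnegrE ?sin_le_id //.
  apply: sin_ge0_pi; rewrite y0 /=; apply: (le_trans (ltW y1)).
  by have := pi_ge2 R; lra.
apply: le_trans (lerXn2r (m n) _ _ h); rewrite ?nnegrE ?expR_ge0 ?(le_trans (expR_ge0 _) h) //.
rewrite -expRM_natl ler_expR mE mulrN lerN2 mulrA le_eqVlt; apply/orP; left; apply/eqP.
congr (_ / _); rewrite /y; by field; rewrite gt_eqF.
Qed.

Let ylim k : y n k @[n --> \oo] --> (0 : R).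
Proof.
by rewrite -[X in _ --> X](mulr0 (pi * k.+1%:R)); apply: cvgM; [exact: cvg_cst|exact: linv].
Qed.

Let cos_term_lim k : (if (k < n)%N then cos (y n k) ^+ (m n + m n) else 0) @[n --> \oo] -->
  omega_term k x.
Proof.
have e : pi * k.+1%:R ^+ 2 * x = x / pi * (pi * k.+1%:R) ^+ 2.
  by move: (pi : R) p0 => P P0; field; rewrite gt_eqF.
have h : q n * (pi * k.+1%:R) ^+ 2 @[n --> \oo] --> pi * k.+1%:R ^+ 2 * x.
  by rewrite e; apply: cvgM; [exact: qlim|exact: cvg_cst].
have h1 : expR (- (q n * (pi * k.+1%:R) ^+ 2)) @[n --> \oo] --> omega_term k x.
  by apply: continuous_cvg; [exact: continuous_expR|exact: cvgN].
have h2 : expR (- (q n * (pi * k.+1%:R) ^+ 2 / (1 - y n k ^+ 2))) @[n --> \oo] --> omega_term k x.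
  apply: continuous_cvg; [exact: continuous_expR|apply: cvgN].
  rewrite -[X in _ --> X]divr1; apply: cvgM => //; apply: cvgV; first exact: oner_neq0.
  rewrite -[X in _ --> X]subr0 -[X in _ - X](mulr0 0); apply: cvgB; first exact: cvg_cst.
  by under eq_fun do rewrite expr2; apply: cvgM; exact: ylim.
apply: squeeze_cvgr h2 h1; near=> n.
have kn : (k < n)%N by near: n; exists k.+1.
have y1 : y n k < 1 by near: n; apply: (cvgr_lt _ (ylim k)); exact: ltr01.
by rewrite kn cos_term_lb //; have /andP[_ ->] := cos_term_ub kn.
Unshelve. all: by end_near. Qed.

Let cos_sum_lim : (1 + 2 * \sum_(k < n) cos (y n k) ^+ (m n + m n)) @[n --> \oo] -->
  1 + 2 * omega x.
Proof.
apply: cvgD; first exact: cvg_cst.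
apply: cvgM; first exact: cvg_cst.
pose proof (@rsum_dominated nat \oo _ (fun n k => if (k < n)%N then cos (y n k) ^+ (m n + m n) else 0)
  (fun k => omega_term k x) (fun k => expR (- (x * pi / 2 * k.+1%:R)))) as h.
have := h _ (cvg_series_expn (c := x * pi / 2) _) cos_term_lim.
move=> H; rewrite (_ : (fun n => _) = fun n => limn (series (fun k => if (k < n)%N then cos (y n k) ^+ (m n + m n) else 0))); last first.
  by apply/funext => n; rewrite rsum_finite.
apply: H; last by rewrite !mulr_gt0.
apply: filterS q_big => n qn k; case: ifP => [kn|_]; last by rewrite normr0 expR_ge0.
have /andP[a1 a2] := cos_term_ub kn; rewrite ger0_norm //; apply: (le_trans a2).
rewrite ler_expR lerN2 exprMn mulrA; have k1 : 1 <= k.+1%:R :> R by rewrite ler1n.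
apply: (@le_trans _ _ (x * pi / 2 * k.+1%:R ^+ 2)).
  rewrite ler_pM2l ?mulr_gt0 // expr2 ler_peMl //; exact: le_trans k1.
apply: ler_wpM2r; first exact: sqr_ge0.
rewrite [leLHS](_ : _ = x / (2 * pi) * pi ^+ 2); last first.
  by move: (pi : R) p0 => P P0; field; rewrite gt_eqF.
by rewrite ler_wpM2r ?sqr_ge0 // ltW.
Qed.

Let ratio n (k : nat) : R := 'C(m n + m n, m n + k.+1 * (n + n).+1)%:R / 'C(m n + m n, m n)%:R.

Let C0 n : 0 < ('C(m n + m n, m n)%:R : R).
Proof. by rewrite ltr0n bin_gt0 leq_addr. Qed.

Let ratio_ge0 n k : 0 <= ratio n k. Proof. by rewrite divr_ge0. Qed.

Let JE n k : ((k.+1 * (n + n).+1)%N%:R : R) = k.+1%:R * l n. Proof. by rewrite natrM. Qed.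

Let ratio_ub n k : (0 < m n)%N -> ratio n k <= expR (- (k.+1%:R ^+ 2 / (q n + k.+1%:R / l n))).
Proof.
move=> m0; set J := (k.+1 * (n + n).+1)%N; rewrite /ratio -/J.
have q0 : 0 < q n by rewrite divr_gt0 ?exprn_gt0 ?ltr0n.
case: (leqP J (m n)) => h; last by rewrite bin_small ?mul0r ?expR_ge0 // ltn_add2l.
have [h1 _] := binomial_ratio h (leqnn J).
rewrite ler_pdivrMr // mulrC; apply: (le_trans h1); rewrite ler_pM2l // ler_expR lerN2.
have k0 : 0 < k.+1%:R :> R by [].
rewrite natrD mE JE le_eqVlt; apply/orP; left; apply/eqP.
move: (q n) (l n) (l0 n) (k.+1%:R : R) k0 q0 => Q L L0 K K0 Q0; field.
by rewrite !gt_eqF // addr_gt0 ?mulr_gt0 ?exprn_gt0.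
Qed.

Let ratio_lb n k : k.+1%:R / l n < q n -> expR (- (k.+1%:R ^+ 2 / (q n - k.+1%:R / l n))) <= ratio n k.
Proof.
move=> hq; set J := (k.+1 * (n + n).+1)%N; rewrite /ratio -/J.
have h : (J < m n)%N.
  by rewrite -(ltr_nat R) JE mE expr2 mulrA ltr_pM2r // -ltr_pdivrMr.
have [_ h1] := binomial_ratio (ltnW h) (leqnn J).
rewrite ler_pdivlMr // mulrC; apply: le_trans (h1 h); rewrite ler_pM2l // ler_expR lerN2.
rewrite mE JE le_eqVlt; apply/orP; left; apply/eqP.
move: (q n) (l n) (l0 n) (k.+1%:R : R) hq => Q L L0 K; rewrite ltr_pdivrMr // => hq; field.
by rewrite !gt_eqF ?subr_gt0 // expr2 mulrA ltr_pM2r.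
Qed.

Let ratio_lim k : ratio n k @[n --> \oo] --> omega_term k x^-1.
Proof.
have kl : k.+1%:R / l n @[n --> \oo] --> (0 : R).
  by rewrite -[X in _ --> X](mulr0 k.+1%:R); apply: cvgM; [exact: cvg_cst|exact: linv].
have xp : x / pi != 0 by rewrite gt_eqF // divr_gt0.
have e : pi * k.+1%:R ^+ 2 / x = k.+1%:R ^+ 2 / (x / pi).
  by move: (pi : R) p0 => P P0; field; rewrite !gt_eqF.
have h1 : expR (- (k.+1%:R ^+ 2 / (q n + k.+1%:R / l n))) @[n --> \oo] --> omega_term k x^-1.
  apply: continuous_cvg; [exact: continuous_expR|apply: cvgN]; rewrite e.
  apply: cvgM; [exact: cvg_cst|apply: cvgV => //].
  by rewrite -[X in _ --> X]addr0; exact: cvgD.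
have h2 : expR (- (k.+1%:R ^+ 2 / (q n - k.+1%:R / l n))) @[n --> \oo] --> omega_term k x^-1.
  apply: continuous_cvg; [exact: continuous_expR|apply: cvgN]; rewrite e.
  apply: cvgM; [exact: cvg_cst|apply: cvgV => //].
  by rewrite -[X in _ --> X]subr0; exact: cvgB.
apply: squeeze_cvgr h2 h1; near=> n.
have qn : k.+1%:R / l n < q n.
  rewrite -subr_gt0; near: n; apply: (cvgr_gt (x / pi)); last by rewrite divr_gt0.
  by rewrite -[X in _ --> X]subr0; exact: cvgB.
rewrite ratio_lb // ratio_ub // -(ltr_nat R) mE mulr_gt0 ?exprn_gt0 //.
by apply: le_lt_trans qn; rewrite divr_ge0 // ltW.
Unshelve. all: by end_near. Qed.

Let ratio_sum n : limn (series (ratio n)) = \sum_(k < m n) ratio n k.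
Proof.
rewrite -rsum_finite; congr (limn (series _)); apply/funext => k; case: ltnP => // h.
by rewrite /ratio bin_small ?mul0r // ltn_add2l mulnS; lia.
Qed.

Let ratio_sum_lim : (1 + 2 * \sum_(k < m n) ratio n k) @[n --> \oo] --> 1 + 2 * omega x^-1.
Proof.
apply: cvgD; first exact: cvg_cst.
apply: cvgM; first exact: cvg_cst.
have xp : 0 < x / pi by rewrite divr_gt0.
pose proof (@rsum_dominated nat \oo _ ratio
  (fun k => omega_term k x^-1) (fun k => expR (- ((2 * (x / pi))^-1 * k.+1%:R)))) as h.
have := h _ (cvg_series_expn (c := (2 * (x / pi))^-1) _) ratio_lim.
move=> H; rewrite (_ : (fun n => _) = fun n => limn (series (ratio n))); last first.
  by apply/funext => n; rewrite ratio_sum.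
apply: H; last by rewrite invr_gt0 mulr_gt0.
apply: filterS q_big => n qn k; rewrite ger0_norm //.
have q0 : 0 < q n by apply: lt_trans qn; rewrite divr_gt0 ?mulr_gt0.
have m0 : (0 < m n)%N by rewrite -(ltr_nat R) mE mulr_gt0 ?exprn_gt0.
have k1 : 1 <= k.+1%:R :> R by rewrite ler1n.
have k0 : 0 < k.+1%:R :> R by [].
have [hJ|hJ] := ltnP (m n) (k.+1 * (n + n).+1).
  by rewrite /ratio bin_small ?mul0r ?expR_ge0 // ltn_add2l.
(* A nonzero coefficient lies within distance [m] of the centre. Hence the denominator in [ratio_ub]
   is at most [2 q], and so at most [2 x / pi]. *)
have qJ : k.+1%:R / l n <= q n.
  rewrite ler_pdivrMr // -(ler_pM2r (l0 n)) -mulrA -expr2 -mE -JE ler_nat //.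
apply: (le_trans (ratio_ub k m0)); rewrite ler_expR lerN2.
apply: (@le_trans _ _ ((2 * (x / pi))^-1 * k.+1%:R ^+ 2)).
  apply: ler_wpM2l; first by rewrite invr_ge0 mulr_ge0 // ltW.
  by rewrite expr2 ler_peMl // ltW.
have h2 : 0 < 2 * (x / pi) by apply: mulr_gt0.
have h3 : 0 < q n + k.+1%:R / l n by apply: addr_gt0 => //; exact: divr_gt0.
rewrite mulrC ler_pM2l ?exprn_gt0 // lef_pV2 ?posrE //.
by move: (q_le n) qJ; move: (x / pi) (q n) (k.+1%:R / l n) => a b c; lra.
Qed.

Let polya n : 1 + 2 * \sum_(k < n) cos (y n k) ^+ (m n + m n) =
  l n * wallis (m n) * (1 + 2 * \sum_(k < m n) ratio n k).
Proof.
have h := cos_sum_fold n (m n); rewrite polya_identity // in h.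
have p2 : (2 ^+ (m n + m n) : R) != 0 by rewrite expf_neq0.
have -> : \sum_(k < m n) ratio n k = (\sum_(j < m n) 'C(m n + m n, m n + j.+1 * (n + n).+1)%:R) / 'C(m n + m n, m n)%:R.
  by rewrite big_distrl.
apply: (mulfI p2); rewrite -h /wallis -/(l n); have := C0 n.
move: ('C(m n + m n, m n)%:R : R) (l n) (\sum_(j < _) _) => X L S X0.
by field; rewrite p2 gt_eqF.
Qed.

(** Squaring turns the prefactor [l * wallis m] into [m * wallis m ^ 2 / q], whose limit exists by
    [wallis_cvg]. *)
Lemma theta_sqr : (1 + 2 * omega x) ^+ 2 =
  limn (fun m => m%:R * wallis m ^+ 2) * pi / x * (1 + 2 * omega x^-1) ^+ 2.
Proof.
set K := limn _; have hK : (fun m => m%:R * wallis m ^+ 2) @ \oo --> K by exact: wallis_cvg.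
have hm : (m n)%:R * wallis (m n) ^+ 2 @[n --> \oo] --> K := cvg_comp _ _ m_infty hK.
have xp : x / pi != 0 by rewrite gt_eqF // divr_gt0.
have h1 : (1 + 2 * \sum_(k < n) cos (y n k) ^+ (m n + m n)) ^+ 2 @[n --> \oo] --> (1 + 2 * omega x) ^+ 2.
  by under eq_fun do rewrite expr2; apply: cvgM; exact: cos_sum_lim.
apply: (cvg_unique _ h1) => //.
have h2 : (m n)%:R * wallis (m n) ^+ 2 / q n * (1 + 2 * \sum_(k < m n) ratio n k) ^+ 2 @[n --> \oo] -->
    K / (x / pi) * (1 + 2 * omega x^-1) ^+ 2.
  apply: cvgM; first by apply: cvgM => //; exact: cvgV.
  by under eq_fun do rewrite expr2; apply: cvgM; exact: ratio_sum_lim.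
have -> : K * pi / x = K / (x / pi).
  by move: (pi : R) p0 => P P0; field; rewrite !gt_eqF.
apply: cvg_trans h2; apply: near_eq_cvg; apply: filterS q_big => n qn.
have q0 : 0 < q n by apply: lt_trans qn; rewrite divr_gt0 ?mulr_gt0.
by rewrite polya mE; field; rewrite gt_eqF.
Qed.

End FunctionalEquation.

(** At [x = 1] the two theta values coincide, which forces the constant of [theta_sqr] to be 1. The
    sign of the square root is settled by positivity. *)
Lemma theta_equation x : 0 < x -> 1 + 2 * omega x^-1 = rpw 2^-1 x * (1 + 2 * omega x).
Proof.
move=> x0; have x0' : 0 < x^-1 by rewrite invr_gt0.
have := @theta_sqr 1 ltr01; rewrite invr1 mulr1.
have := @theta_sqr _ x0'; rewrite invrK.
move: (limn (fun m => m%:R * wallis m ^+ 2) * pi) => K h1 h2.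
have w1 := omega_gt0 (@ltr01 R); have wx := omega_gt0 x0; have wx' := omega_gt0 x0'.
have K1 : K = 1.
  have n0 : (1 + 2 * omega 1) ^+ 2 != 0 by rewrite gt_eqF // exprn_gt0 //; lra.
  by apply: (mulIf n0); rewrite mul1r -h2.
move: h1; rewrite K1 mul1r => h.
have -> : rpw 2^-1 x = Num.sqrt x.
  apply/esym/eqP; rewrite -(@eqrXn2 _ 2) ?sqrtr_ge0 ?rpw_ge0 // sqr_sqrtr ?(ltW x0) //.
  by rewrite expr2 -rpwD (_ : 2^-1 + 2^-1 = 1) ?rpw1 //; lra.
apply/eqP; rewrite -(@eqrXn2 _ 2) //; [|lra|]; last first.
  by rewrite mulr_ge0 ?sqrtr_ge0 //; lra.
by rewrite exprMn sqr_sqrtr ?(ltW x0) // h.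
Qed.

End Theta.

(** * The Mellin transform of the theta function *)

Section MellinTheta.
Context {R : realType}.
Local Notation C := R[i].
Local Notation mu := (@lebesgue_measure R).
Implicit Types (s w : C) (x y c : R) (K g : R -> R).

Let D0 : set R := `]0, +oo[%classic.
Let mD0 : measurable D0. Proof. exact: measurable_itv. Qed.
Let D0E x : D0 x = (0 < x) :> Prop.
Proof. by rewrite /D0 /= in_itv /= andbT. Qed.

(** * Changes of variable on the half-line *)

Lemma within_pos_continuous g a b : 0 < a -> (forall x, 0 < x -> g y @[y --> x] --> g x) ->
  {within `[a, b], continuous g}.
Proof.
move=> a0 cg; apply: continuous_in_subspaceT => x; rewrite inE /= in_itv /= => /andP[ax _].
by apply: cg; exact: lt_le_trans ax.
Qed.

Lemma integral_scale g c a b : 0 < c -> 0 < a -> a <= b ->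
  (forall x, 0 < x -> g y @[y --> x] --> g x) ->
  \int[mu]_(x in `[c * a, c * b]) g x = \int[mu]_(x in `[a, b]) (g (c * x) * c).
Proof.
move=> c0 a0 ab cg.
have dF x : is_derive x 1 (fun y => c * y) c.
  by apply: (is_derive_eq' (is_deriveMR (is_derive_cstR c x) (is_derive_idR x))); ring.
have F' : derive1 (fun y => c * y) = cst c.
  by apply/funext => x; rewrite derive1E; case: (dF x).
have cF x : c * y @[y --> x] --> c * x := is_derive_cont (dF x).
rewrite /Rintegral (@integration_by_substitution_increasing _ (fun y => c * y)) //.
- by rewrite F'.
- by move=> x y _ _ xy; rewrite ltr_pM2l.
- by rewrite F' => x _; exact: cvg_cst.
- by rewrite F'; exact: is_cvg_cst.
- by rewrite F'; exact: is_cvg_cst.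
- split; first by move=> x _; case: (dF x).
  + by apply: cvg_at_right_filter; exact: cF.
  + by apply: cvg_at_left_filter; exact: cF.
- by apply: within_pos_continuous => //; exact: mulr_gt0.
Qed.

Lemma integral_inv g a b : 0 < a -> a <= b ->
  (forall x, 0 < x -> g y @[y --> x] --> g x) ->
  \int[mu]_(x in `[b^-1, a^-1]) g x = \int[mu]_(x in `[a, b]) (g x^-1 / x ^+ 2).
Proof.
move=> a0 ab cg; have b0 : 0 < b by exact: lt_le_trans ab.
have dF x : 0 < x -> is_derive x 1 (@GRing.inv R) (- x ^- 2).
  move=> x0; apply: (is_derive_eq' (is_deriveV (f := fun y : R => y) (v := 1) _ (is_derive_idR x))); first by rewrite gt_eqF.
  by rewrite /GRing.scale /= mulr1.
have F' x : 0 < x -> derive1 (@GRing.inv R) x = - x ^- 2.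
  by move=> x0; rewrite derive1E; case: (dF x x0).
have cF x : 0 < x -> y^-1 @[y --> x] --> x^-1 by move=> x0; exact: is_derive_cont (dF x x0).
have cF' x : 0 < x -> derive1 (@GRing.inv R) y @[y --> x] --> - x ^- 2.
  move=> x0; apply: (@cvg_trans _ ((fun y : R => - (y^-1 * y^-1)) @ x)).
    apply: near_eq_cvg; near=> y; rewrite F' ?expr2 ?invfM //; near: y.
    exact: lt_nbhsr.
  have -> : - x ^- 2 = - (x^-1 * x^-1) by rewrite expr2 invfM.
  exact: (cvgN (cvgM (cF x x0) (cF x x0))).
rewrite /Rintegral (@integration_by_substitution_decreasing _ (@GRing.inv R)) //.
- congr fine; apply: eq_integral => x; rewrite inE /= in_itv /= => /andP[ax _].
  by rewrite !fctE F' ?opprK //; exact: lt_le_trans ax.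
- move=> x y; rewrite !in_itv /= => /andP[ax _] /andP[ay _] xy.
  by rewrite ltf_pV2 // posrE; [exact: lt_le_trans a0 ax|exact: lt_le_trans a0 ay].
- move=> x; rewrite in_itv /= => /andP[ax _].
  by have x0 : 0 < x by [exact: lt_trans ax]; rewrite /continuous_at F' //; exact: cF'.
- by apply/cvg_ex; exists (- a ^- 2); apply: cvg_at_right_filter; exact: cF'.
- by apply/cvg_ex; exists (- b ^- 2); apply: cvg_at_left_filter; exact: cF'.
- split; first by move=> x; rewrite in_itv /= => /andP[ax _]; case: (dF x (lt_trans a0 ax)).
  + by apply: cvg_at_right_filter; exact: cF.
  + by apply: cvg_at_left_filter; exact: cF.
- by apply: within_pos_continuous => //; rewrite invr_gt0.
Unshelve. all: by end_near. Qed.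

Lemma cintegrable_dominator D (f : R -> C) : measurable D -> cintegrable D f ->
  mu.-integrable D (EFin \o (fun x => `|Re (f x)| + `|Im (f x)|)).
Proof.
move=> mD [i1 i2]; rewrite (_ : _ \o _ = (fun x => `|(Re (f x))%:E| + `|(Im (f x))%:E|)%E) //.
by apply: integrableD => //; exact: integrable_abse.
Qed.

(** Substitution is carried out on segments; this lemma passes to the half-line, with |Re f| + |Im
    f| as majorant. *)
Lemma cintegral_exhaust (E : nat -> set R) (f : R -> C) :
  (forall n, measurable (E n)) -> (forall n, E n `<=` D0) ->
  (forall x, 0 < x -> \forall n \near \oo, E n x) -> cintegrable D0 f ->
  cintegral (E n) f @[n --> \oo] --> cintegral D0 f.
Proof.
move=> mE ED DE fi; apply: (cintegral_incr mD0 mE ED _ (cintegrable_cmeas fi) (cintegrable_dominator mD0 fi)).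
  by move=> x; rewrite D0E; exact: DE.
by move=> x _; exact: cabs_ReIm.
Qed.

Let E n : set R := `[n.+1%:R^-1, n.+1%:R]%classic.

Let E_exhaust x : 0 < x -> \forall n \near \oo, n.+1%:R^-1 <= x <= n.+1%:R.
Proof.
move=> x0; exists (maxn (Num.truncn x) (Num.truncn x^-1)) => // n /= hn.
apply/andP; split.
  rewrite invf_ple ?posrE //; apply: (le_trans (ltW (truncnS_gt _))).
  by rewrite ler_nat ltnS (leq_trans (leq_maxr _ _) hn).
apply: (le_trans (ltW (truncnS_gt _))).
by rewrite ler_nat ltnS (leq_trans (leq_maxl _ _) hn).
Qed.

Let mE n : measurable (E n). Proof. exact: measurable_itv. Qed.

Let n0 n : 0 < n.+1%:R^-1 :> R. Proof. by rewrite invr_gt0. Qed.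
Let n01 n : n.+1%:R^-1 <= n.+1%:R :> R.
Proof. by apply: (@le_trans _ _ 1); rewrite ?invf_le1 ?ler1n. Qed.

Let ccont (f : R -> C) := forall x, 0 < x -> f y @[y --> x] --> f x.

Let ccont_Re f : ccont f -> forall x, 0 < x -> Re (f y) @[y --> x] --> Re (f x).
Proof. by move=> cf x /cf h; exact: cvgC_Re. Qed.

Let ccont_Im f : ccont f -> forall x, 0 < x -> Im (f y) @[y --> x] --> Im (f x).
Proof. by move=> cf x /cf h; exact: cvgC_Im. Qed.

Lemma cintegral_scale (f : R -> C) c : 0 < c -> ccont f -> cintegrable D0 f ->
  cintegrable D0 (fun x => f (c * x) * c%:C) ->
  cintegral D0 (fun x => f (c * x) * c%:C) = cintegral D0 f.
Proof.
move=> c0 cf fi fci.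
have h1 : cintegral `[c * n.+1%:R^-1, c * n.+1%:R] f @[n --> \oo] --> cintegral D0 f.
  apply: (@cintegral_exhaust (fun n => `[c * n.+1%:R^-1, c * n.+1%:R]%classic)) => //.
  - move=> n x; rewrite D0E /= in_itv /= => /andP[h _].
    by apply: lt_le_trans h; exact: mulr_gt0.
  - move=> x x0; have xc : 0 < x / c by rewrite divr_gt0.
    apply: filterS (E_exhaust xc) => n /andP[a b]; rewrite /= in_itv /=.
    by rewrite mulrC -ler_pdivlMr // a mulrC -ler_pdivrMr.
have h2 : cintegral (E n) (fun x => f (c * x) * c%:C) @[n --> \oo] --> cintegral D0 (fun x => f (c * x) * c%:C).
  apply: (cintegral_exhaust mE) => //.
  - by move=> n x; rewrite D0E /E /= in_itv /= => /andP[h _]; exact: lt_le_trans h.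
apply: (cvgC_uniq h2); apply: cvgC_ext h1 => n.
rewrite /cintegral (integral_scale c0 (n0 n) (n01 n) (ccont_Re cf)).
rewrite (integral_scale c0 (n0 n) (n01 n) (ccont_Im cf)).
by congr (_ +i* _); apply: eq_Rintegral => x _; rewrite ?ReM ?ImM /= mulr0 ?subr0 ?add0r ?addr0.
Qed.

Lemma cintegral_inv (f : R -> C) : ccont f -> cintegrable D0 f ->
  cintegrable D0 (fun x => f x^-1 * (x ^- 2)%:C) ->
  cintegral D0 (fun x => f x^-1 * (x ^- 2)%:C) = cintegral D0 f.
Proof.
move=> cf fi fci.
have h1 : cintegral (E n) f @[n --> \oo] --> cintegral D0 f.
  apply: (cintegral_exhaust mE) => //.
  - by move=> n x; rewrite D0E /E /= in_itv /= => /andP[h _]; exact: lt_le_trans h.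
have h2 : cintegral (E n) (fun x => f x^-1 * (x ^- 2)%:C) @[n --> \oo] --> cintegral D0 (fun x => f x^-1 * (x ^- 2)%:C).
  apply: (cintegral_exhaust mE) => //.
  - by move=> n x; rewrite D0E /E /= in_itv /= => /andP[h _]; exact: lt_le_trans h.
apply: (cvgC_uniq h2); apply: cvgC_ext h1 => n.
have := integral_inv (n0 n) (n01 n) (ccont_Re cf).
have := integral_inv (n0 n) (n01 n) (ccont_Im cf).
rewrite invrK /E /cintegral => -> ->.
by congr (_ +i* _); apply: eq_Rintegral => x _; rewrite ?ReM ?ImM /= mulr0 ?subr0 ?add0r ?addr0.
Qed.

(** * Mellin transforms with respect to dx/x *)

Definition rker K x : C := (K x / x)%:C.

Definition rmellin K s : C := mellin D0 (rker K) s.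

Definition rmellin_integrable K s : Prop :=
  cintegrable D0 (fun x => rker K x * cexp (s * (ln x)%:C)).

Definition pcont K : Prop := forall x, 0 < x -> K y @[y --> x] --> K x.

Lemma rker_cont K s : pcont K -> ccont (fun x => rker K x * cexp (s * (ln x)%:C)).
Proof.
move=> cK x x0; apply: cvgCM.
  apply: cvgC_real; apply: cvgM; first exact: cK.
  by apply: cvgV; [rewrite gt_eqF|exact: cvg_id].
have [h1 h2] := rder_cpow s x0; apply/cvgC_ReIm.
by split; [exact: is_derive_cont h1|exact: is_derive_cont h2].
Qed.

Lemma rmellin_scale K c s : 0 < c -> pcont K -> rmellin_integrable K s ->
  rmellin_integrable (fun x => K (c * x)) s ->
  rmellin (fun x => K (c * x)) s = cexp (- s * (ln c)%:C) * rmellin K s.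
Proof.
move=> c0 cK i1 i2.
have e x : 0 < x -> rker K (c * x) * cexp (s * (ln (c * x))%:C) * c%:C =
   cexp (s * (ln c)%:C) * (rker (fun x => K (c * x)) x * cexp (s * (ln x)%:C)).
  move=> x0; rewrite lnM ?posrE // rmorphD mulrDr cexpD /rker !rmorphM !fmorphV rmorphM /=.
  by field; rewrite !(inj_eq (@complexI R)) !gt_eqF.
have i3 : cintegrable D0 (fun x => rker K (c * x) * cexp (s * (ln (c * x))%:C) * c%:C).
  apply: cintegrable_ext mD0 _ (cintegrableZ (cexp (s * (ln c)%:C)) mD0 i2) => x.
  by rewrite inE D0E => x0; rewrite e.
have := cintegral_scale c0 (@rker_cont K s cK) i1 i3.
rewrite /rmellin /mellin /laplace => <-.
rewrite [X in _ = _ * X](_ : _ = cexp (s * (ln c)%:C) *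
    cintegral D0 (fun x => rker (fun x => K (c * x)) x * cexp (s * (ln x)%:C))).
  by rewrite mulrA -cexpD mulNr addNr cexp0 mul1r.
by rewrite -cintegralZ //; apply: eq_cintegral => x; rewrite inE D0E => x0; rewrite e.
Qed.

Lemma rmellin_inv K s : pcont K -> rmellin_integrable K (- s) ->
  rmellin_integrable (fun x => K x^-1) s ->
  rmellin (fun x => K x^-1) s = rmellin K (- s).
Proof.
move=> cK i1 i2.
have e x : 0 < x -> rker K x^-1 * cexp (- s * (ln x^-1)%:C) * (x ^- 2)%:C =
   rker (fun x => K x^-1) x * cexp (s * (ln x)%:C).
  move=> x0; rewrite lnV ?posrE // rmorphN mulrNN /rker mulrAC -rmorphM /=.
  by congr (_%:C * _); field; rewrite gt_eqF.
have i3 : cintegrable D0 (fun x => rker K x^-1 * cexp (- s * (ln x^-1)%:C) * (x ^- 2)%:C).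
  by apply: cintegrable_ext mD0 _ i2 => x; rewrite inE D0E => x0; rewrite e.
have := cintegral_inv (@rker_cont K (- s) cK) i1 i3.
rewrite /rmellin /mellin /laplace => <-; apply: eq_cintegral.
by move=> x; rewrite inE D0E => x0; rewrite e.
Qed.


Lemma rmellin_integrable_bound K (al be M : R) : measurable_fun D0 K ->
  (forall x, 0 < x <= 1 -> `|K x| <= M * rpw (- al) x) ->
  (forall x, 1 < x -> `|K x| <= M * rpw (- be) x) ->
  cmeas D0 (rker K) /\ mellin_bound D0 (rker K) al be M.
Proof.
move=> mK h1 h2; split.
  apply: cmeas_real; apply: measurable_funM => //; exact: measurable_invr.
move=> x; rewrite D0E => x0; split => //; rewrite /rker cabs_real normrM (gtr0_norm (_ : 0 < x^-1)) ?invr_gt0 //.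
have e p : rpw (- 1 - p) x = rpw (- p) x / x by rewrite addrC rpwD rpwN1.
by split => hx; rewrite e mulrA ler_pM2r ?invr_gt0 //; [apply: h1; rewrite x0|exact: h2].
Qed.

Lemma pcont_expN c : pcont (fun x => expR (- (c * x))).
Proof.
move=> x _; apply: continuous_cvg; [exact: continuous_expR|].
by apply: cvgN; apply: cvgM; [exact: cvg_cst|exact: cvg_id].
Qed.

Lemma pcont_measurable K : pcont K -> measurable_fun D0 K.
Proof.
move=> cK; apply: open_continuous_measurable_fun; first exact: interval_open.
by move=> x; rewrite inE D0E; exact: cK.
Qed.

Lemma rmellin_exp_integrable c s : 0 < c -> 0 < Re s ->
  rmellin_integrable (fun x => expR (- (c * x))) s.
Proof.
move=> c0 s0; pose m := (Num.truncn (Re s)).+1.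
have M0 : 0 <= m`!%:R / c ^+ m by rewrite divr_ge0 // exprn_ge0 // ltW.
have [h1 h2] : cmeas D0 (rker (fun x => expR (- (c * x)))) /\
    mellin_bound D0 (rker (fun x => expR (- (c * x)))) 0 m%:R (1 + m`!%:R / c ^+ m).
  apply: rmellin_integrable_bound.
  - exact (@pcont_measurable _ (@pcont_expN c)).
  - move=> x /andP[x0 x1]; rewrite oppr0 rpw0 mulr1 ger0_norm ?expR_ge0 //.
    apply: (@le_trans _ _ 1); last by rewrite lerDl.
    by rewrite expR_le1 oppr_le0 mulr_ge0 // ltW.
  - move=> x x1; have x0 : 0 < x by exact: lt_trans x1.
    rewrite ger0_norm ?expR_ge0 // rpwN rpw_nat // expRN.
    apply: (@le_trans _ _ (m`!%:R / c ^+ m * (x ^+ m)^-1)); last first.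
      by apply: ler_wpM2r; rewrite ?invr_ge0 ?exprn_ge0 ?lerDr // ltW.
    rewrite -mulrA -invfM -exprMn ler_pdivlMr ?exprn_gt0 ?mulr_gt0 //.
    rewrite mulrC ler_pdivrMr ?expR_gt0 // mulrC.
    by rewrite mulrC; apply: expR_ge_monomial; rewrite mulr_ge0 // ltW.
by apply: (mellin_integrable mD0 h1 h2); rewrite s0 truncnS_gt.
Qed.

Lemma rmellin_exp1 s : rmellin (fun x => expR (- (1 * x))) s = Gm s.
Proof.
have e : rker (fun x => expR (- (1 * x))) = gamma_kernel.
  by apply/funext => x; rewrite /rker /gamma_kernel mul1r.
by rewrite /rmellin e.
Qed.

Lemma rmellin_exp c s : 0 < c -> 0 < Re s ->
  rmellin (fun x => expR (- (c * x))) s = cexp (- s * (ln c)%:C) * Gm s.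
Proof.
move=> c0 s0; have e : (fun x => expR (- (c * x))) = (fun x => expR (- (1 * (c * x)))).
  by apply/funext => x; rewrite mul1r.
have i := rmellin_exp_integrable c0 s0; rewrite e in i *.
pose proof (rmellin_scale c0 (@pcont_expN 1) (rmellin_exp_integrable ltr01 s0) i) as h.
by rewrite h; congr (_ * _); exact: rmellin_exp1.
Qed.

(** * The regularised theta kernel *)

Lemma omega_le x : 1 <= x -> 0 <= omega x <= limn (series (fun n => expR (- (1 * n.+1%:R) : R))) * expR (- x).
Proof.
move=> x1; have x0 : 0 < x by exact: lt_le_trans x1.
(* For x >= 1 and k >= 1, pi k^2 x >= 2 k x >= k + x, which separates the two variables. *)
have h n : `|omega_term n x| <= expR (- (1 * n.+1%:R)) * expR (- x).
  rewrite ger0_norm ?expR_ge0 // -expRD ler_expR -opprD lerN2 mul1r.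
  have p2 : 2 <= (pi : R) := pi_ge2 R.
  have n1 : 1 <= n.+1%:R :> R by rewrite ler1n.
  have n2 : n.+1%:R <= n.+1%:R ^+ 2 :> R by rewrite expr2 ler_peMl // (le_trans _ n1).
  apply: (@le_trans _ _ (2 * n.+1%:R * x)); last first.
    by rewrite ler_pM2r //; apply: ler_pM => //; rewrite (le_trans _ n1).
  move: n1; move: (n.+1%:R : R) => a a1; nra.
have c1 := cvg_series_expn (@ltr01 R).
have c2 : cvgn (series (fun n => expR (- (1 * n.+1%:R)) * expR (- x))).
  rewrite (_ : (fun n => _) = expR (- x) *: (fun n => expR (- (1 * n.+1%:R)))).
    exact: is_cvg_seriesZ.
  by apply/funext => n /=; rewrite /GRing.scale /= mulrC.
have [h1 _] := rsum_cvg h c2; rewrite (ltW (omega_gt0 x0)) /=.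
rewrite (_ : _ * _ = limn (series (fun n => expR (- (1 * n.+1%:R)) * expR (- x)))).
  apply: ler_lim; [exact: (cvgP _ h1)|exact: c2|].
  near=> n; apply: ler_sum => i _; apply: le_trans (h i); exact: ler_norm.
rewrite (_ : (fun n => _ * _) = expR (- x) *: (fun n => expR (- (1 * n.+1%:R)))).
  by rewrite lim_seriesZ // mulrC.
by apply/funext => n /=; rewrite /GRing.scale /= mulrC.
Unshelve. all: by end_near. Qed.

(** By the theta equation [omega] is x^(-1/2)/2 plus a bounded term near 0, so its Mellin transform
    converges only for Re w > 1/2. After the subtraction the kernel is bounded at 0 and O(x^(-1/2))
    at infinity: the strip becomes 0 < Re w < 1/2. *)
Definition omega0 x : R := omega x - 2^-1 * rpw (- 2^-1) x.

(** The subtraction absorbs both constants of the theta equation and leaves a pure symmetry under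
    inversion. *)
Lemma omega0V x : 0 < x -> omega0 x^-1 = rpw 2^-1 x * omega0 x.
Proof.
move=> x0; have := theta_equation x0; rewrite /omega0.
have -> : rpw (- 2^-1) x^-1 = rpw 2^-1 x by rewrite /rpw lnV ?posrE // mulrNN.
have -> : rpw 2^-1 x * (omega x - 2^-1 * rpw (- 2^-1) x) = rpw 2^-1 x * omega x - 2^-1 * (rpw (2^-1) x * rpw (- 2^-1) x) by ring.
rewrite -rpwD subrr rpw0; move: (rpw 2^-1 x) (omega x) (omega x^-1) => r a b h; lra.
Qed.

Lemma omega0_bound : exists2 M : R, 0 <= M &
  (forall x, 1 <= x -> `|omega0 x| <= M * rpw (- 2^-1) x) /\
  (forall x, 0 < x <= 1 -> `|omega0 x| <= M).
Proof.
set M0 := limn (series (fun n => expR (- (1 * n.+1%:R) : R))).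
have M00 : 0 <= M0.
  have /andP[h1 h2] := omega_le (lexx 1); have := le_trans h1 h2.
  by rewrite pmulr_lge0 ?expR_gt0.
have h1 x : 1 <= x -> `|omega0 x| <= (M0 + 1) * rpw (- 2^-1) x.
  move=> x1; have /andP[a b] := omega_le x1; have x0 : 0 < x by exact: lt_le_trans x1.
  have r0 := rpw_ge0 (- 2^-1) x.
  have e : expR (- x) <= rpw (- 2^-1) x.
    apply: (@le_trans _ _ (rpw (- 1) x)); last by apply: ler_rpw => //; lra.
    rewrite rpwN1 // expRN lef_pV2 ?posrE ?expR_gt0 //.
    by have := expR_ge1Dx x; lra.
  have b2 := le_trans b (ler_wpM2l M00 e).
  rewrite /omega0 ler_norml; apply/andP; split; last by nra.
  by have := mulr_ge0 M00 r0; lra.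
exists (M0 + 1); first by rewrite addr_ge0.
split => // x /andP[x0 x1].
have x1' : 1 <= x^-1 by rewrite invf_ge1.
have := omega0V (_ : 0 < x^-1); rewrite invrK invr_gt0 => -> //.
rewrite normrM (ger0_norm (rpw_ge0 _ _)); have := h1 _ x1' => h.
apply: (le_trans (ler_wpM2l (rpw_ge0 _ _) h)).
by rewrite mulrCA -rpwD subrr rpw0 mulr1.
Qed.

Lemma omega_cont : pcont omega.
Proof.
move=> x x0; apply: (@rsum_dominated _ _ (nbhs x) _ (fun y n => omega_term n y) (fun n => omega_term n x)
   (fun n => expR (- (pi * (x / 2) * n.+1%:R)))).
- near=> y => n; apply: omega_term_le; first by rewrite divr_gt0.
  near: y; apply: filterS (lt_nbhsr (_ : x / 2 < x)) => [y /ltW //|]; lra.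
- by apply: cvg_series_expn; rewrite mulr_gt0 ?pi_gt0 ?divr_gt0.
- by move=> n; have := @pcont_expN (pi * n.+1%:R ^+ 2) x x0.
Unshelve. all: by end_near. Qed.

Lemma omega0_cont : pcont omega0.
Proof.
move=> x x0; apply: cvgB; first exact: omega_cont.
apply: cvgM; first exact: cvg_cst.
exact: is_derive_cont (is_derive_rpw _ x0).
Qed.

Lemma omega0_mellin : exists M, cmeas D0 (rker omega0) /\ mellin_bound D0 (rker omega0) 0 2^-1 M.
Proof.
have [M M0 [h1 h2]] := omega0_bound; exists M; apply: rmellin_integrable_bound.
- exact (@pcont_measurable _ (@omega0_cont)).
- by move=> x /h2; rewrite oppr0 rpw0 mulr1.
- by move=> x /ltW /h1.
Qed.

Definition Mth s : C := rmellin omega0 s.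

Lemma Mth_integrable s : 0 < Re s < 2^-1 -> rmellin_integrable omega0 s.
Proof. by have [M [h1 h2]] := omega0_mellin; exact: (mellin_integrable mD0 h1 h2). Qed.

Lemma Mth_analytic s : 0 < Re s < 2^-1 -> analytic_at Mth s.
Proof. by have [M [h1 h2]] := omega0_mellin; exact: (mellin_analytic mD0 h1 h2). Qed.

(** Inversion of the variable turns [omega0V] into this symmetry, which at [s / 2] becomes the
    functional equation of xi. *)
Lemma Mth_sym s : 0 < Re s < 2^-1 -> Mth (2^-1 - s) = Mth s.
Proof.
move=> hs; have hs' : 0 < Re (2^-1 - s) < 2^-1.
  by rewrite ReD ReN -(rmorph_nat (real_complex R)) -fmorphV /=; move: hs; lra.
have e x : 0 < x -> rker (fun x => omega0 x^-1) x * cexp (- s * (ln x)%:C) =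
    rker omega0 x * cexp ((2^-1 - s) * (ln x)%:C).
  move=> x0; have -> : cexp ((2^-1 - s) * (ln x)%:C) = (rpw 2^-1 x)%:C * cexp (- s * (ln x)%:C).
    have h2 : (2^-1 : C) = (2^-1 : R)%:C by rewrite fmorphV rmorph_nat.
    by rewrite mulrDl cexpD h2 -rmorphM cexp_real.
  by rewrite /rker omega0V // !rmorphM /=; ring.
have i2 : rmellin_integrable (fun x => omega0 x^-1) (- s).
  have i3 := Mth_integrable hs'; rewrite /rmellin_integrable in i3 *.
  refine (@cintegrable_ext _ D0 _ _ mD0 _ i3) => x; rewrite inE D0E => x0.
  exact/esym/e.
have := rmellin_inv omega0_cont _ i2; rewrite opprK => /(_ (Mth_integrable hs)) h.
rewrite /Mth -h; apply: eq_cintegral => x.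
by rewrite inE D0E => x0; exact/esym/e.
Qed.

Lemma MthJ s : 0 < Re s < 2^-1 -> Mth s^* = (Mth s)^*.
Proof.
move=> hs; apply: laplaceJ => //; last exact: Mth_integrable.
by move=> x _; rewrite /rker conjc_real.
Qed.

(** * The alternating zeta series and its kernel *)

Lemma npowM (m n : nat) s : npow (m.+1 * n.+1) s = npow m.+1 s * npow n.+1 s.
Proof. by rewrite /npow natrM lnM ?posrE // rmorphD mulrDr cexpD. Qed.

Lemma alternating_sum (V : comNzRingType) (f : nat -> V) N :
  \sum_(n < N) (f n.*2 - f n.*2.+1) = \sum_(n < N + N) f n - (\sum_(n < N) f n.*2.+1) *+ 2.
Proof.
elim: N => [|N IH]; first by rewrite !big_ord0 mul0rn subr0.
rewrite addSn addnS !big_ord_recr /= IH addnn mulrnDl opprD !mulr2n.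
move: (\sum_(n < N.*2) f n) (\sum_(n < N) _) (f N.*2) (f N.*2.+1) => X Y a b; ring.
Qed.

(** The compensating terms of [zt_asymp] at 2N and at N have the ratio 2 * 2^(-s) and cancel, so the
    alternating series converges without correction. *)
Lemma eta_lim s : 0 < Re s -> s != 1 ->
  \sum_(n < N.+1) (npow n.*2.+1 s - npow n.*2.+2 s) @[N --> \oo] --> (1 - 2 * npow 2 s) * zt s.
Proof.
move=> s0 s1; have s1' : 1 - s != 0 by rewrite subr_eq0 eq_sym.
pose A N := \sum_(n < N) npow n.+1 s.
pose Q N := N%:R * npow N s / (1 - s).
have h1 := zt_asymp s0 s1.
have h2 : A (N.+1 + N.+1)%N - Q (N.+1 + N.+1)%N @[N --> \oo] --> zt s.
  have hN : (N.+1 + N)%N @[N --> \oo] --> \oo.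
    apply/cvgnyPge => n; exists n => // m /= nm; lia.
  pose proof (cvg_comp _ _ hN h1) as h3; apply: cvgC_ext h3 => N.
  by rewrite /= addnS.
have h3 : (A (N.+1 + N.+1)%N - Q (N.+1 + N.+1)%N) - 2 * npow 2 s * (A N.+1 - Q N.+1) @[N --> \oo] -->
   zt s - 2 * npow 2 s * zt s by exact: cvgCB h2 (cvgCM (cvgCc _) h1).
rewrite mulrBl mul1r; apply: cvgC_ext h3 => N.
rewrite (alternating_sum (fun n => npow n.+1 s)).
have -> : \sum_(n < N.+1) npow n.*2.+2 s = npow 2 s * A N.+1.
  rewrite /A big_distrr; apply: eq_bigr => n _ /=.
  have e : n.*2.+2 = (2 * n.+1)%N by lia.
  by rewrite e npowM.
have -> : Q (N.+1 + N.+1)%N = 2 * npow 2 s * Q N.+1.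
  rewrite /Q addnn -mul2n npowM natrM; ring.
rewrite -/(A (N.+1 + N.+1)%N) -mulr_natl; ring.
Qed.

Definition alt_kernel N x : R := \sum_(n < N.+1) (omega_term n.*2 x - omega_term n.*2.+1 x).

Lemma alt_sum_le (a : nat -> R) N : (forall n, 0 <= a n) -> (forall n, a n.+1 <= a n) ->
  0 <= \sum_(n < N) (a n.*2 - a n.*2.+1) <= a 0%N.
Proof.
move=> a0 ad.
have h : 0 <= \sum_(n < N) (a n.*2 - a n.*2.+1) <= a 0%N - a N.*2.
  elim: N => [|N /andP[IH1 IH2]]; first by rewrite big_ord0 subrr lexx.
  rewrite big_ord_recr /=; have := ad (N.*2); have := ad (N.*2.+1).
  move: IH1 IH2; set X := \sum_(n < _) _ => IH1 IH2 u v; apply/andP; split; rewrite ?doubleS; lra.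
by case/andP: h => h1 h2; rewrite h1 /=; apply: (le_trans h2); rewrite gerBl.
Qed.

(** An alternating sum of decreasing terms is at most its first term. Unlike the sum of absolute
    values, this bound is integrable against x^(w-1) for every [w] with positive real part. *)
Lemma alt_kernel_le N x : 0 < x -> `|alt_kernel N x| <= expR (- (pi * x)).
Proof.
move=> x0; have /andP[h1 h2] : 0 <= alt_kernel N x <= omega_term 0 x.
  apply: (@alt_sum_le (fun n => omega_term n x)) => n; first exact: expR_ge0.
  rewrite ler_expR lerN2 ler_pM2r // ler_pM2l ?pi_gt0 // ler_sqr ?nnegrE //.
  by rewrite ler_nat.
by rewrite ger0_norm //; move: h2; rewrite /omega_term expr1n mulr1.
Qed.

Lemma alt_kernel_lim x : 0 < x -> alt_kernel N x @[N --> \oo] --> omega0 x - 2 * omega0 (4 * x).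
Proof.
move=> x0; have x4 : 0 < 4 * x by rewrite mulr_gt0.
have c0 (y : R) : 0 < y -> series (fun n => omega_term n y) @ \oo --> omega y.
  move=> y0; exact: (rsum_cvg (fun n => @omega_term_le R n y y y0 (lexx y)) (cvg_series_expn (mulr_gt0 (pi_gt0 R) y0))).1.
(* The subtracted terms cancel because (4x)^(-1/2) is half of x^(-1/2). *)
have e : omega0 x - 2 * omega0 (4 * x) = omega x - 2 * omega (4 * x).
  rewrite /omega0.
  have -> : rpw (- 2^-1) (4 * x) = 2^-1 * rpw (- 2^-1) x.
    rewrite /rpw lnM ?posrE // mulrDr expRD; congr (_ * _).
    have -> : (4 : R) = 2 ^+ 2 by rewrite -natrX.
    rewrite lnXn // [X in expR X](_ : _ = - ln 2); last by rewrite -mulr_natl; field.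
    by rewrite expRN lnK // posrE.
  by field.
rewrite e; have h1 := c0 x x0; have h4 := c0 _ x4.
have hN : (N.+1 + N.+1)%N @[N --> \oo] --> \oo.
  apply/cvgnyPge => n; exists n => // m /= nm; lia.
have hS : N.+1 @[N --> \oo] --> \oo by apply/cvgnyPge => n; exists n => // m /= nm; lia.
have h5 : (fun _ : nat => 2 : R) @ \oo --> (2 : R) by exact: cvg_cst.
pose proof (cvgB (cvg_comp _ _ hN h1) (cvgM h5 (cvg_comp _ _ hS h4))) as H.
move: H; apply: cvg_trans; apply: near_eq_cvg; near=> N.
transitivity (series (omega_term^~ x) (N.+1 + N.+1)%N - 2 * series (omega_term^~ (4 * x)) N.+1); first by [].
rewrite /alt_kernel (alternating_sum (fun n => omega_term n x)) /series /= !big_mkord.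
rewrite -[X in _ = _ - X]mulr_natl; congr (_ - 2 * _); apply: eq_bigr => n _.
rewrite /omega_term; congr (expR (- _)).
have -> : n.*2.+2%:R = 2 * n.+1%:R :> R by rewrite -natrM; congr (_%:R); lia.
by ring.
Unshelve. all: by end_near. Qed.

Lemma rmellin_omega_term n w : 0 < Re w ->
  rmellin (fun x => omega_term n x) w = cexp (- w * (ln pi)%:C) * npow n.+1 (2 * w) * Gm w.
Proof.
move=> w0; have c0 : 0 < pi * n.+1%:R ^+ 2 :> R by rewrite mulr_gt0 ?pi_gt0 ?exprn_gt0.
have h := rmellin_exp c0 w0; rewrite h; congr (_ * _).
rewrite /npow -cexpD lnM ?posrE ?pi_gt0 ?exprn_gt0 // lnXn // rmorphD mulrDr.
by rewrite rmorphMn /=; congr (cexp _); ring.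
Qed.

Lemma omega_term_integrable n w : 0 < Re w -> rmellin_integrable (fun x => omega_term n x) w.
Proof.
by move=> w0; apply: rmellin_exp_integrable => //; rewrite mulr_gt0 ?pi_gt0 ?exprn_gt0.
Qed.

Lemma alt_kernelE N w x : rker (alt_kernel N) x * cexp (w * (ln x)%:C) =
  \sum_(n < N.+1) (rker (fun y => omega_term n.*2 y) x * cexp (w * (ln x)%:C) -
      rker (fun y => omega_term n.*2.+1 y) x * cexp (w * (ln x)%:C)).
Proof.
rewrite /rker /alt_kernel mulr_suml rmorph_sum mulr_suml.
by apply: eq_bigr => n _; rewrite mulrBl rmorphB mulrBl.
Qed.

Lemma alt_kernel_integrable N w : 0 < Re w -> rmellin_integrable (alt_kernel N) w.
Proof.
move=> w0; rewrite /rmellin_integrable (funext (alt_kernelE N w)).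
apply: cintegrable_sum => // n.
exact: cintegrableB mD0 (omega_term_integrable n.*2 w0) (omega_term_integrable n.*2.+1 w0).
Qed.

Lemma rmellin_alt N w : 0 < Re w -> rmellin (alt_kernel N) w =
  cexp (- w * (ln pi)%:C) * Gm w * \sum_(n < N.+1) (npow n.*2.+1 (2 * w) - npow n.*2.+2 (2 * w)).
Proof.
move=> w0; rewrite big_distrr /=.
have i n := omega_term_integrable n w0.
rewrite /rmellin /mellin /laplace (funext (alt_kernelE N w)) cintegral_sum //; last first.
  by move=> n; exact: cintegrableB mD0 (i n.*2) (i n.*2.+1).
apply: eq_bigr => n _; rewrite cintegralB //; [|exact: i|exact: i].
have h1 := rmellin_omega_term n.*2 w0; have h2 := rmellin_omega_term n.*2.+1 w0.
by rewrite /rmellin /mellin /laplace in h1 h2; rewrite h1 h2; ring.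
Qed.

Lemma Mth4 w : 0 < Re w < 2^-1 ->
  rmellin_integrable (fun x => omega0 (4 * x)) w /\
  rmellin (fun x => omega0 (4 * x)) w = npow 2 (2 * w) * Mth w.
Proof.
move=> hw; have c4 : 0 < 4 :> R by [].
have i : rmellin_integrable (fun x => omega0 (4 * x)) w.
  have [M M0 [h1 h2]] := omega0_bound.
  have [m1 m2] : cmeas D0 (rker (fun x => omega0 (4 * x))) /\
      mellin_bound D0 (rker (fun x => omega0 (4 * x))) 0 2^-1 M.
    apply: rmellin_integrable_bound.
    - apply: pcont_measurable => x x0.
      have cx : 4 * y @[y --> x] --> 4 * x by apply: cvgM; [exact: cvg_cst|exact: cvg_id].
      apply: continuous_cvg cx; apply: omega0_cont; exact: mulr_gt0.
    - move=> x /andP[x0 x1]; rewrite oppr0 rpw0 mulr1.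
      have [h|h] := leP (4 * x) 1; first by apply: h2; rewrite h mulr_gt0.
      apply: (le_trans (h1 _ (ltW h))); apply: ler_piMr => //.
      by rewrite /rpw expR_le1 mulNr oppr_le0 mulr_ge0 ?invr_ge0 ?ln_ge0 // ltW.
    - move=> x x1; have h : 1 <= 4 * x by lra.
      apply: (le_trans (h1 _ h)); apply: ler_wpM2l => //.
      rewrite /rpw ler_expR !mulNr lerN2 ler_pM2l // ler_ln ?posrE; lra.
  by apply: (mellin_integrable mD0 m1 m2).
split => //; have h := rmellin_scale c4 (@omega0_cont) (Mth_integrable hw) i.
rewrite h; congr (_ * _); rewrite /npow; congr cexp.
have -> : (4 : R) = 2 ^+ 2 by rewrite -natrX.
by rewrite lnXn // rmorphMn /=; ring.
Qed.

(** The Mellin transform of [alt_kernel N] has its limit computed twice: term by term, through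
    [eta_lim], and by dominated convergence, as the transform of omega0(x) - 2 omega0(4x). Both
    contain the factor 1 - 2^(1-2w), which is then divided out. *)
Lemma Mth_zeta w : 0 < Re w < 2^-1 ->
  Mth w = cexp (- w * (ln pi)%:C) * Gm w * zt (2 * w).
Proof.
move=> hw; have /andP[w0 w1] := hw.
have [i4 e4] := Mth4 hw; have i1 := Mth_integrable hw.
have Re2 : Re (2 * w) = 2 * Re w by rewrite -(rmorph_nat (real_complex R)) ReZ.
have s0 : 0 < Re (2 * w) by rewrite Re2; lra.
have s1 : 2 * w != 1.
  by apply: contraTneq w1 => /(congr1 (@complex.Re R)); rewrite Re2 /= => h; rewrite -leNgt; lra.
(* The modulus of 2^(1-2w) exceeds 1, because [Re w] is less than 1/2. *)
have f0 : 1 - 2 * npow 2 (2 * w) != 0.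
  rewrite subr_eq0; apply: contraTneq w1 => /(congr1 cabs).
  rewrite cabs1 cabsM cabs_nat cabs_npow Re2 => h; rewrite -leNgt.
  have e2 : (2 : R) = rpw 1 2 by rewrite rpw1.
  move: h; rewrite {1}e2 -rpwD /rpw -{1}expR0 => /expR_inj/esym/eqP.
  rewrite mulf_eq0 => /orP[/eqP|]; first by lra.
  by rewrite gt_eqF // ln_gt0 // ltr1n.
have h1 : rmellin (alt_kernel N) w @[N --> \oo] -->
    cexp (- w * (ln pi)%:C) * Gm w * ((1 - 2 * npow 2 (2 * w)) * zt (2 * w)).
  apply: cvgC_ext (cvgCM (cvgCc _) (eta_lim s0 s1)) => N.
  by rewrite rmellin_alt.
have h2 : rmellin (alt_kernel N) w @[N --> \oo] -->
    cintegral D0 (fun x => rker omega0 x * cexp (w * (ln x)%:C) -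
      2 * (rker (fun x => omega0 (4 * x)) x * cexp (w * (ln x)%:C))).
  have i := cintegrable_dominator mD0 (rmellin_exp_integrable (pi_gt0 R) w0).
  apply: (cintegral_dominated mD0 _ _ i).
  - by move=> N; apply: cintegrable_cmeas; exact: alt_kernel_integrable.
  - move=> x; rewrite D0E => x0.
    have -> : rker omega0 x * cexp (w * (ln x)%:C) - 2 * (rker (fun x => omega0 (4 * x)) x * cexp (w * (ln x)%:C)) =
       ((omega0 x - 2 * omega0 (4 * x)) / x)%:C * cexp (w * (ln x)%:C).
      rewrite /rker mulrA -mulrBl; congr (_ * _).
      have h3 : (2 : C) = (2 : R)%:C by rewrite rmorph_nat.
      by rewrite h3 -rmorphM -rmorphB; congr (_%:C); ring.
    apply: cvgCM; last exact: cvgCc.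
    apply: cvgC_real; apply: cvgM; last exact: cvg_cst.
    exact: alt_kernel_lim.
  - move=> N x; rewrite D0E => x0; apply: le_trans (cabs_ReIm _).
    rewrite !cabsM ler_wpM2r ?cabs_ge0 // /rker !cabs_real !normrM ler_wpM2r //.
    by rewrite [leRHS]ger0_norm ?expR_ge0 //; exact: alt_kernel_le.
have := cvgC_uniq h1 h2; rewrite cintegralB //; last exact: cintegrableZ.
rewrite cintegralZ // => h.
have {}h : cexp (- w * (ln pi)%:C) * Gm w * ((1 - 2 * npow 2 (2 * w)) * zt (2 * w)) =
   Mth w - 2 * (npow 2 (2 * w) * Mth w) by rewrite h -e4.
apply: (mulfI f0); rewrite mulrCA h; ring.
Qed.

End MellinTheta.

(** * The xi function in the critical strip *)

Section Xi.
Context {R : realType}.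
Local Notation C := R[i].
Implicit Types (s z w : C) (x y : R).

Definition strip s := 0 < Re s < 1.

Lemma Re_near s (e : R) : 0 < e -> \forall w \near s, `|Re w - Re s| < e.
Proof.
move=> e0; apply/nbhsCP; exists e => // w we.
by rewrite -ReN -ReD; apply: le_lt_trans we; exact: cabs_Re.
Qed.

Lemma strip_near s : strip s -> \forall w \near s, strip w.
Proof.
move=> /andP[s0 s1]; have e0 : 0 < Num.min (Re s) (1 - Re s) by rewrite lt_min s0 subr_gt0.
apply: filterS (Re_near s e0) => w; rewrite lt_min !ltr_norml => /andP[/andP[a _] /andP[_ b]].
by rewrite /strip; apply/andP; split; lra.
Qed.

Lemma half_Re s : Re (s / 2) = Re s / 2.
Proof.
have -> : (2^-1 : C) = (2^-1 : R)%:C by rewrite fmorphV rmorph_nat.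
by rewrite mulrC ReZ mulrC.
Qed.

Lemma strip_half s : strip s -> 0 < Re (s / 2) < 2^-1.
Proof. by move=> /andP[s0 s1]; rewrite half_Re; apply/andP; split; lra. Qed.

Lemma strip_neq0 s : strip s -> s != 0.
Proof. by move=> /andP[s0 _]; apply: contraTneq s0 => ->; rewrite ltxx. Qed.

Lemma strip_neq1 s : strip s -> s != 1.
Proof. by move=> /andP[_ s1]; apply: contraTneq s1 => ->; rewrite ltxx. Qed.

Lemma strip_sym s : strip s -> strip (1 - s).
Proof. by rewrite /strip ReD ReN /= => /andP[s0 s1]; apply/andP; split; lra. Qed.

Lemma stripJ s : strip s -> strip s^*.
Proof. by rewrite /strip ReJ. Qed.

Lemma analytic_scale (f : C -> C) (a : C) z : analytic_at f (a * z) ->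
  analytic_at (fun w => f (a * w)) z.
Proof.
move=> [c hc]; exists (fun n => c n * a ^+ n).
have [e e0 he] := (nbhsCP _ _).1 hc.
have a0 : 0 < cabs a + 1 by rewrite ltr_wpDl ?cabs_ge0.
apply/nbhsCP; exists (e / (cabs a + 1)); first by rewrite divr_gt0.
move=> w; rewrite ltr_pdivlMr // => wz; have : cabs (a * w - a * z) < e.
  rewrite -mulrBr cabsM; apply: le_lt_trans wz.
  by rewrite mulrC; apply: ler_wpM2l; rewrite ?cabs_ge0 // lerDl.
move=> /he; apply: cvgC_ext => n; rewrite !seriesEnat /=; apply: eq_bigr => i _.
by rewrite -mulrBr exprMn mulrA.
Qed.

(* xi on the strip 0 < Re s < 1 *)
Definition X s : C := 2^-1 * s * (s - 1) * Mth (s / 2).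

Definition gfac s : C := cexp (- (s / 2) * (ln pi)%:C) * Gm (s / 2).

Lemma gfac_neq0 s : 0 < Re s -> gfac s != 0.
Proof.
move=> s0; rewrite /gfac mulf_neq0 ?cexp_neq0 // Gm_neq0 // half_Re.
by rewrite divr_gt0.
Qed.

Lemma XE s : strip s -> X s = 2^-1 * s * (s - 1) * (gfac s * zt s).
Proof.
move=> hs; rewrite /X Mth_zeta ?strip_half //; congr (_ * (_ * zt _)).
by rewrite mulrC divfK // pnatr_eq0.
Qed.

Lemma raw_xiE s : strip s ->
  2^-1 * s * (s - 1) * cpow pi (- s / 2) * Gamma (s / 2) * zeta s = X s.
Proof.
move=> hs; have /andP[s0 s1] := hs; rewrite XE // zetaE ?strip_neq1 // GammaE; last first.
  by rewrite half_Re; apply/andP; split; lra.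
by rewrite /gfac /cpow mulNr !mulrA.
Qed.

Lemma X_analytic s : strip s -> analytic_at X s.
Proof.
move=> hs; have h : analytic_at (fun w => Mth (w / 2)) s.
  have : analytic_at (@Mth R) (2^-1 * s) by apply: Mth_analytic; rewrite mulrC; exact: strip_half.
  by move/analytic_scale; apply: analytic_ext => w; rewrite mulrC.
have h1 := analyticB (analytic_mulid (analytic_mulid h)) (analytic_mulid h).
by apply: analytic_ext (analyticZ 2^-1 h1) => w; rewrite /X; ring.
Qed.

Definition dX s : C := derive1 X s.

Lemma X_cder s : strip s -> cder X s (dX s).
Proof. by move=> /X_analytic /analytic_cder_at. Qed.

(** The strip contains neither 0 nor 1, and the raw formula agrees with the continuous function [X]
    around [s]; the punctured limit is therefore the value. *)
Lemma xiE s : strip s -> xi s = X s.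
Proof.
move=> hs; rewrite /xi /fill_removable; apply: limC.
apply: (cvgC_eq_near _ (cder_cvg (X_cder hs))).
by apply: filterS (near_dnbhs (strip_near hs)) => w /raw_xiE ->.
Qed.

Lemma xi_derive s : strip s -> derive1 xi s = dX s.
Proof.
move=> hs; apply: cderive_val; apply: cder_near (X_cder hs).
by apply: filterS (strip_near hs) => w hw; rewrite xiE.
Qed.

Lemma X_sym s : strip s -> X (1 - s) = X s.
Proof.
move=> hs; rewrite /X; have -> : (1 - s) / 2 = 2^-1 - s / 2 by rewrite mulrBl mul1r.
by rewrite Mth_sym ?strip_half //; ring.
Qed.

Lemma halfJ : (2^-1 : C)^* = 2^-1.
Proof.
have -> : (2^-1 : C) = (2^-1 : R)%:C by rewrite fmorphV rmorph_nat.
by rewrite conjc_real.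
Qed.

Lemma XJ s : strip s -> X s^* = (X s)^*.
Proof.
move=> hs; rewrite /X !cconjM rmorphB rmorph1 halfJ.
by rewrite -MthJ ?strip_half // cconjM halfJ.
Qed.

Lemma cconjB z w : conjc (z - w) = conjc z - conjc w.
Proof. exact: rmorphB. Qed.

Lemma cconjD z w : conjc (z + w) = conjc z + conjc w.
Proof. exact: rmorphD. Qed.

Lemma cconjV z : conjc z^-1 = (conjc z)^-1.
Proof. exact: fmorphV. Qed.

Lemma cder_conj (f : C -> C) z d : cder f z d -> cder (fun w => (f w^*)^*) z^* d^*.
Proof.
move/cvgC_dnbhs => h; apply/cvgC_dnbhs => e e0.
have [r r0 hr] := h e e0; exists r; first exact: r0.
move=> w wz wr; have wz' : w^* != z by apply: contra wz => /eqP <-; rewrite conjcK.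
have wr' : cabs (w^* - z) < r by rewrite -cabsJ cconjB conjcK.
have := hr _ wz' wr'; rewrite -cabsJ cconjB cconjM cconjV !cconjB conjcK.
by move=> hh; rewrite (conjcK z).
Qed.

Lemma dXJ s : strip s -> dX s^* = (dX s)^*.
Proof.
move=> hs; apply: cderive_val; apply: cder_near (cder_conj (X_cder hs)).
apply: filterS (strip_near (stripJ hs)) => w hw.
by rewrite XJ // conjcK.
Qed.

Lemma dX_sym s : strip s -> dX (1 - s) = - dX s.
Proof.
move=> hs; have hs' := strip_sym hs.
have h : cder X (-1 * s + 1) (dX (1 - s)) by rewrite mulN1r addrC; exact: X_cder.
have h2 := cder_affine h; rewrite mulN1r in h2.
rewrite -[LHS]opprK; congr (- _); apply/esym/cderive_val.
apply: cder_near h2; apply: filterS (strip_near hs) => w hw.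
by rewrite mulN1r addrC X_sym.
Qed.

(** * The critical line *)

Definition sline z : C := 1 / 2 - 'i%C * z.

Lemma Re_sline z : Re (sline z) = 2^-1 + Im z.
Proof.
have h : Re ('i%C * z) = - Im z by rewrite ReM /= mul0r mul1r sub0r.
by rewrite /sline ReD ReN h opprK half_Re /= mul1r.
Qed.

Lemma strip_sline z : `|Im z| < 2^-1 -> strip (sline z).
Proof. by rewrite /strip Re_sline ltr_norml => /andP[a b]; apply/andP; split; lra. Qed.

Lemma slineJ z : (sline z^*)^* = 1 - sline z.
Proof.
have h : conjc ('i%C : C) = - 'i%C by apply: complexP; rewrite /= ?oppr0.
rewrite /sline cconjB !cconjM conjcK halfJ rmorph1 h.
have h2 : (2 : C) != 0 by rewrite pnatr_eq0.
by field.
Qed.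

Lemma E_xiE z : `|Im z| < 2^-1 -> E_xi z = X (sline z) + dX (sline z).
Proof. by move=> /strip_sline h; rewrite /E_xi -/(sline z) (xiE h) (xi_derive h). Qed.

(** Conjugating both [z] and the value amounts to the reflection of [sline z] into [1 - sline z],
    under which [X] is even and [dX] odd; hence the minus sign. *)
Lemma sharp_E_xiE z : `|Im z| < 2^-1 -> sharp E_xi z = X (sline z) - dX (sline z).
Proof.
move=> hz; have hs := strip_sline hz.
have hz' : `|Im z^*| < 2^-1 by rewrite ImJ normrN.
have hs' := strip_sline hz'.
by rewrite /sharp (E_xiE hz') cconjD -(XJ hs') -(dXJ hs') slineJ (X_sym hs) (dX_sym hs).
Qed.

Lemma sharp_ThetaE z : `|Im z| < 2^-1 ->
  sharp Theta_xi z = (X (sline z) + dX (sline z)) / (X (sline z) - dX (sline z)).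
Proof.
move=> hz; rewrite -E_xiE // -sharp_E_xiE // /sharp /Theta_xi /sharp cconjM conjcK.
by rewrite fmorphV conjcK.
Qed.

(** On the critical line complex conjugation and the reflection of [s] into [1 - s] coincide. *)
Lemma X_line_Im z : Im z = 0 -> Im (X (sline z)) = 0.
Proof.
move=> hz; have hs : strip (sline z) by apply: strip_sline; rewrite hz normr0.
have zJ : z^* = z by apply: complexP; rewrite ?ReJ ?ImJ // hz oppr0.
have := XJ hs; have -> : (sline z)^* = 1 - sline z by rewrite -slineJ zJ.
rewrite X_sym // => /(congr1 (@complex.Im R)); rewrite ImJ; lra.
Qed.

Lemma dX_line_Re z : Im z = 0 -> Re (dX (sline z)) = 0.
Proof.
move=> hz; have hs : strip (sline z) by apply: strip_sline; rewrite hz normr0.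
have zJ : z^* = z by apply: complexP; rewrite ?ReJ ?ImJ // hz oppr0.
have := dXJ hs; have -> : (sline z)^* = 1 - sline z by rewrite -slineJ zJ.
rewrite dX_sym // => /(congr1 (@complex.Re R)); rewrite ReN ReJ; lra.
Qed.

(** A real and an imaginary number are orthogonal, so |a - b|^2 = |a|^2 + |b|^2; the second quotient
    is b / (a - b). It is applied to [X] and [dX] on the critical line. *)
Lemma H_bounds (a b : C) : Im a = 0 -> Re b = 0 -> a - b != 0 ->
  cabs (a / (a - b)) <= 1 /\ cabs (a / (a - b) - 1) <= 1.
Proof.
move=> a0 b0 ab; have ab0 : 0 < cabs (a - b) by rewrite cabs_gt0.
have -> : a / (a - b) - 1 = b / (a - b) by field.
have e : cabs (a - b) ^+ 2 = Re a ^+ 2 + Im b ^+ 2.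
  by rewrite cabs_sqr ReD ImD ReN ImN a0 b0 subr0 sub0r sqrrN.
have h (c : C) : cabs c ^+ 2 <= cabs (a - b) ^+ 2 -> cabs (c / (a - b)) <= 1.
  move=> hc; rewrite cabsM cabsV ler_pdivrMr // mul1r.
  by rewrite -ler_sqr ?nnegrE ?cabs_ge0.
by split; apply: h; rewrite e cabs_sqr ?a0 ?b0 expr0n /= ?addr0 ?add0r ?lerDl ?lerDr sqr_ge0.
Qed.

(* The logarithmic derivative of s (s - 1) pi^(-s/2) Gamma(s/2) *)
Definition Afac s : C := s^-1 + (s - 1)^-1 - (ln pi)%:C / 2 + digamma (s / 2) / 2.

Lemma zt_cder s : strip s -> cder (@zt R) s (derive1 zt s).
Proof.
move=> hs; apply: analytic_cder_at; apply: zt_analytic; last exact: strip_neq1.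
by case/andP: hs.
Qed.

Lemma zeta_near s : strip s -> \forall w \near s, zt w = zeta w.
Proof.
move=> hs; apply: filterS (strip_near hs) => w hw; rewrite zetaE ?strip_neq1 //.
by case/andP: hw.
Qed.

Lemma zeta_derive s : strip s -> derive1 zeta s = derive1 zt s.
Proof.
by move=> hs; apply: cderive_val; apply: cder_near (zeta_near hs) (zt_cder hs).
Qed.

Lemma gfac_cder s : strip s ->
  cder gfac s (gfac s * (digamma (s / 2) / 2 - (ln pi)%:C / 2)).
Proof.
move=> hs; have /andP[s0 s1] := hs; have h0 : 0 < Re (s / 2) by rewrite half_Re divr_gt0.
have h1 : cder (fun w => cexp (w * (- (ln pi)%:C / 2))) s ((- (ln pi)%:C / 2) * cexp (s * (- (ln pi)%:C / 2))).
  exact: cder_cexp.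
have h2 : cder (@Gm R) (2^-1 * s + 0) (Gm' (s / 2)) by rewrite addr0 mulrC; exact: Gm_cder.
have h3 := cderM h1 (cder_affine h2).
have e : digamma (s / 2) = Gm' (s / 2) / Gm (s / 2).
  by apply: digammaE; rewrite half_Re; apply/andP; split; lra.
have G0 := Gm_neq0 h0.
apply: (@cder_near _ (fun w => cexp (w * (- (ln pi)%:C / 2)) * Gm (2^-1 * w + 0))).
  by apply/nbhsCP; exists 1 => // w _; rewrite /gfac addr0 [2^-1 * w]mulrC; congr (cexp _ * _); ring.
have -> : gfac s * (digamma (s / 2) / 2 - (ln pi)%:C / 2) =
   (- (ln pi)%:C / 2) * cexp (s * (- (ln pi)%:C / 2)) * Gm (2^-1 * s + 0) +
   cexp (s * (- (ln pi)%:C / 2)) * (2^-1 * Gm' (s / 2)).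
  rewrite e /gfac addr0 [2^-1 * s]mulrC.
  have -> : - (s / 2) * (ln pi)%:C = s * (- (ln pi)%:C / 2) by ring.
  move: G0; move: (Gm (s / 2)) (Gm' (s / 2)) (cexp (s * (- (ln pi)%:C / 2))) (ln pi)%:C => g g' E l g0.
  by field; rewrite g0.
exact: h3.
Qed.

Lemma dXE s : strip s -> dX s = 2^-1 * s * (s - 1) * (gfac s * zt s) * Afac s +
  2^-1 * s * (s - 1) * (gfac s * derive1 zt s).
Proof.
move=> hs; have s0 := strip_neq0 hs; have s1 := strip_neq1 hs; rewrite -subr_eq0 in s1.
have h1 := cderM (cderZ (c := 2^-1) (cderM (cder_id s) (cderB (cder_id s) (cder_cst 1 s)))) (cderM (gfac_cder hs) (zt_cder hs)).
have h2 : cder X s (2^-1 * (1 * (s - 1) + s * (1 - 0)) * (gfac s * zt s) +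
   2^-1 * (s * (s - 1)) * (gfac s * (digamma (s / 2) / 2 - (ln pi)%:C / 2) * zt s + gfac s * derive1 zt s)).
  apply: cder_near h1; apply: filterS (strip_near hs) => w hw.
  by rewrite XE // !mulrA.
rewrite /dX (cderive_val h2) /Afac; move: (gfac s) (zt s) (derive1 zt s) (digamma _) (ln pi)%:C => g f f' d l.
by field; rewrite s0 s1.
Qed.

Lemma zeta_log s : strip s -> X s != 0 -> derive1 zeta s / zeta s = dX s / X s - Afac s.
Proof.
move=> hs X0; have /andP[s0 _] := hs; rewrite zeta_derive // zetaE ?strip_neq1 // dXE //.
rewrite XE // in X0 *; have h4 := gfac_neq0 s0; have h2 := strip_neq0 hs.
have h3 := strip_neq1 hs; rewrite -subr_eq0 in h3.
have h5 : zt s != 0 by apply: contra_neq X0 => ->; rewrite !mulr0.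
move: h4 h5; move: (gfac s) (zt s) (derive1 zt s) (Afac s) => g f f' a h4 h5.
by field; rewrite h2 h3 h4 h5.
Qed.

(** For the case of xi vanishing near a point: the quotient zeta'/zeta in [frakP] then has
    denominator 0 and takes the value 0. *)
Lemma zeta_X0 s : strip s -> X s = 0 -> zeta s = 0.
Proof.
move=> hs; have /andP[s0' _] := hs; rewrite zetaE ?strip_neq1 // XE //.
have s0 := strip_neq0 hs; have s1 := strip_neq1 hs; rewrite -subr_eq0 in s1.
move=> h; apply/eqP/negPn/negP => f0; move/eqP: h; apply/negP.
have h2 : (2^-1 : C) != 0 by rewrite invr_eq0 pnatr_eq0.
apply: mulf_neq0; first by apply: mulf_neq0 s1; exact: mulf_neq0 h2 s0.
exact: mulf_neq0 (gfac_neq0 s0') f0.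
Qed.

End Xi.

(** * The Lerch and digamma functions *)

Section Lerch.
Context {R : realType}.
Local Notation C := R[i].
Implicit Types (s z w : C) (x y t : R).

Lemma rpwMl (p x y : R) : 0 < x -> 0 < y -> rpw p (x * y) = rpw p x * rpw p y.
Proof. by move=> x0 y0; rewrite /rpw lnM ?posrE // mulrDr expRD. Qed.

Lemma ler_rpw2 (p x y : R) : 0 <= p -> 0 < x -> x <= y -> rpw p x <= rpw p y.
Proof.
move=> p0 x0 xy; rewrite /rpw ler_expR ler_wpM2l // ler_ln // posrE //.
exact: lt_le_trans xy.
Qed.

(** Comparison with the telescoping series of the differences of n^(-p). The step is the
    monotonicity of -x^(-p) - p c x between consecutive integers, where [c] is the value of x^(-1-p)
    at the right one. *)
Lemma cvg_series_rpw (p : R) : 0 < p -> cvgn (series (fun n => rpw (- 1 - p) n.+1%:R : R)).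
Proof.
move=> p0.
have step n : rpw (- 1 - p) n.+2%:R <= p^-1 * (rpw (- p) n.+1%:R - rpw (- p) n.+2%:R).
  rewrite ler_pdivlMl //; set c := rpw _ n.+2%:R.
  have : - rpw (- p) n.+1%:R - p * c * n.+1%:R <= - rpw (- p) n.+2%:R - p * c * n.+2%:R.
    apply: (@ge0_derive_le _ (fun x => - rpw (- p) x - p * c * x) (fun x => p * rpw (- 1 - p) x - p * c)).
    - by rewrite ler_nat.
    - move=> x /andP[x1 _]; have x0 : 0 < x by apply: lt_le_trans x1.
      apply: (is_derive_eq' (is_deriveBR (is_deriveN (is_derive_rpw (- p) x0))
        (is_deriveMR (is_derive_cstR (p * c) x) (is_derive_idR x)))).
      by rewrite [- p - 1]addrC; ring.
    - move=> x /andP[x1 x2]; have x0 : 0 < x by apply: lt_trans x1.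
      rewrite -mulrBr mulr_ge0 ?(ltW p0) // subr_ge0 /c /rpw ler_expR.
      by rewrite ler_nM2l ?ler_ln ?posrE ?(ltW x2) //; lra.
  by rewrite -[n.+2%:R]natr1; lra.
apply: nondecreasing_is_cvgn.
  apply/nondecreasing_seqP => n; rewrite /series /= big_nat_recr //= lerDl; exact: rpw_ge0.
exists (1 + p^-1) => _ [n _ <-].
have h : series (fun n => rpw (- 1 - p) n.+1%:R) n.+1 <= 1 + p^-1 * (1 - rpw (- p) n.+1%:R).
  elim: n => [|n IH]; first by rewrite /series /= big_nat1 /rpw ln1 !mulr0 expR0 subrr mulr0 addr0.
  rewrite /series /= big_nat_recr //=; have := step n; move: IH; rewrite /series /=.
  by move: (\sum_(0 <= i < n.+1) _) => S; lra.
apply: (@le_trans _ _ (series (fun n => rpw (- 1 - p) n.+1%:R) n.+1)).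
  by rewrite /series /= big_nat_recr //= lerDl rpw_ge0.
apply: (le_trans h); rewrite lerD2l ler_piMr ?invr_ge0 ?(ltW p0) // gerBl; exact: rpw_ge0.
Qed.

Definition av z : C := 1 / 4 - 'i%C * z / 2.

Lemma avE z : av z = sline z / 2.
Proof. by rewrite /av /sline; field. Qed.

Lemma lerch_arg z : 1 / 2 * (1 / 2 - 'i%C * z) = av z.
Proof. by rewrite /av; field. Qed.

Lemma Re_av z : Re (av z) = 4^-1 + Im z / 2.
Proof. by rewrite avE half_Re Re_sline mulrDl; congr (_ + _); field. Qed.

Lemma quarter : (1 / 4 : C) = (4^-1 : R)%:C.
Proof. by rewrite mul1r fmorphV rmorph_nat. Qed.

Lemma Re_natD (n : nat) w : Re (n%:R + w) = n%:R + Re w.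
Proof. by rewrite ReD -(rmorph_nat (real_complex R)). Qed.

Lemma cabs_nat_av n z : - 4^-1 <= Im z -> n.+1%:R / 8 <= cabs (n%:R + av z).
Proof.
move=> hz; apply: le_trans (cabs_Re _); apply: le_trans (ler_norm _).
rewrite Re_natD Re_av -natr1; have := ler0n R n; lra.
Qed.

Lemma cabs_nat_quarter n : n.+1%:R / 4 <= cabs (n%:R + (1 / 4 : C)).
Proof.
apply: le_trans (cabs_Re _); apply: le_trans (ler_norm _).
rewrite Re_natD quarter /= -natr1; have := ler0n R n; lra.
Qed.

Lemma nat_av_neq0 n z : - 4^-1 <= Im z -> n%:R + av z != 0.
Proof.
by move=> /(cabs_nat_av n) h; rewrite -cabs_gt0; apply: lt_le_trans h; rewrite divr_gt0.
Qed.

Lemma nat_quarter_neq0 n : n%:R + (1 / 4 : C) != 0.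
Proof.
by have h := cabs_nat_quarter n; rewrite -cabs_gt0; apply: lt_le_trans h; rewrite divr_gt0.
Qed.

(** The series common to the digamma difference, with x = 1, and to the Lerch bracket, with x =
    exp(-2t). Up to sign each of them is i z / 2 times its sum, and this factor cancels 1 / (2 i z)
    in [frakP], so nothing singular remains at z = 0. *)
Definition Mterm x z (n : nat) : C := (x ^+ n)%:C / ((n%:R + av z) * (n%:R + 1 / 4)).

Definition Msum x z : C := csum (Mterm x z).

(** 32 is the product of the constants 8 and 4 in [cabs_nat_av] and [cabs_nat_quarter]; the exponent
    -2 which they give is relaxed to -5/4. *)
Definition Mbound (n : nat) : R := 32 * rpw (- 1 - 4^-1) n.+1%:R.

Lemma Mbound_cvg : cvgn (series Mbound).
Proof.
have p : 0 < 4^-1 :> R by rewrite invr_gt0.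
rewrite (_ : Mbound = 32 *: (fun n => rpw (- 1 - 4^-1) n.+1%:R)) //.
by apply: is_cvg_seriesZ; exact: cvg_series_rpw.
Qed.

Lemma cabs_Xn x n : 0 <= x <= 1 -> cabs (x ^+ n)%:C <= 1.
Proof.
move=> /andP[x0 x1]; rewrite cabs_real ger0_norm ?exprn_ge0 //; exact: exprn_ile1.
Qed.

Lemma Mterm_le x z n : 0 <= x <= 1 -> - 4^-1 <= Im z -> cabs (Mterm x z n) <= Mbound n.
Proof.
move=> hx hz; rewrite /Mterm cabsM cabsV cabsM.
have n0 : 0 < n.+1%:R :> R by [].
have n1 : 1 <= n.+1%:R :> R by rewrite ler1n.
have h1 := cabs_nat_av n hz; have h2 := cabs_nat_quarter n.
have p1 : 0 < n.+1%:R / 8 :> R by rewrite divr_gt0.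
have p2 : 0 < n.+1%:R / 4 :> R by rewrite divr_gt0.
apply: (@le_trans _ _ (32 * rpw (- 2) n.+1%:R)); last first.
  by rewrite ler_pM2l // ler_rpw //; lra.
rewrite rpwN (rpw_nat 2 n0).
have -> : 32 * (n.+1%:R ^+ 2)^-1 = (n.+1%:R / 8 * (n.+1%:R / 4))^-1 :> R.
  by move: n0; move: (n.+1%:R : R) => m m0; field; rewrite gt_eqF.
apply: (@le_trans _ _ (cabs (n%:R + av z) * cabs (n%:R + (1 / 4 : C)))^-1).
  apply: ler_piMl; last exact: cabs_Xn.
  by rewrite invr_ge0 mulr_ge0 ?cabs_ge0.
rewrite lef_pV2 ?posrE; [by apply: ler_pM => //; apply: ltW| |exact: mulr_gt0].
by apply: mulr_gt0; [exact: lt_le_trans h1|exact: lt_le_trans h2].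
Qed.

Lemma Msum_cvg x z : 0 <= x <= 1 -> - 4^-1 <= Im z -> series (Mterm x z) @ \oo --> Msum x z.
Proof. by move=> hx hz; exact: csum_cvg (fun n => Mterm_le n hx hz) Mbound_cvg. Qed.

Lemma Msum_le x z : 0 <= x <= 1 -> - 4^-1 <= Im z -> cabs (Msum x z) <= limn (series Mbound).
Proof. by move=> hx hz; exact: csum_le (fun n => Mterm_le n hx hz) Mbound_cvg. Qed.

(** On the real line |n + av z| is at least (n + 1) / 4 and at least |z| / 2. Interpolating with
    exponents 1/4 and 3/4 produces |z|^(-3/4) and, together with the other denominator, the summable
    (n + 1)^(-5/4). *)
Lemma Msum_decay : exists2 K : R, 0 <= K & forall x z, 0 <= x <= 1 -> Im z = 0 -> z != 0 ->
  cabs (Msum x z) <= K * rpw (- (3 / 4)) (cabs z).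
Proof.
have p4 : 0 < 4^-1 :> R by rewrite invr_gt0.
pose u n : R := rpw (- 1 - 4^-1) n.+1%:R.
have uc : cvgn (series u) := cvg_series_rpw p4.
pose c : R := rpw (- 1 - 4^-1) 4^-1 * rpw (- (3 / 4)) 2^-1.
have c0 : 0 <= c by rewrite mulr_ge0 ?rpw_ge0.
have S0 : 0 <= limn (series u).
  apply: limr_ge uc _; near=> n; apply: sumr_ge0 => i _; exact: rpw_ge0.
exists (c * limn (series u)); first exact: mulr_ge0.
move=> x z hx hz z0; have az : 0 < cabs z by rewrite cabs_gt0.
have hz' : - 4^-1 <= Im z by rewrite hz oppr_le0 ltW.
pose d : R := c * rpw (- (3 / 4)) (cabs z).
have h n : cabs (Mterm x z n) <= d * u n.
  rewrite /Mterm cabsM cabsV cabsM.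
  have n0 : 0 < n.+1%:R :> R by [].
  have m0 : 0 < n.+1%:R / 4 :> R by rewrite divr_gt0.
  have v0 : 0 < cabs z / 2 by rewrite divr_gt0.
  have a1 : n.+1%:R / 4 <= cabs (n%:R + av z).
    apply: le_trans (cabs_Re _); apply: le_trans (ler_norm _).
    by rewrite Re_natD Re_av hz -natr1; have := ler0n R n; lra.
  have a2 : cabs z / 2 <= cabs (n%:R + av z).
    apply: le_trans (cabs_Im _).
    have -> : Im (n%:R + av z) = - (Re z / 2).
      rewrite ImD -(rmorph_nat (real_complex R)) /= add0r /av quarter ImD ImN /= sub0r.
      have -> : (2^-1 : C) = (2^-1 : R)%:C by rewrite fmorphV rmorph_nat.
      by rewrite [_ * (_%:C)]mulrC ImZ ImM /= mul0r mul1r add0r mulrC.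
    have -> : cabs z = `|Re z| by rewrite /cabs hz expr0n addr0 sqrtr_sqr.
    by rewrite normrN normrM (ger0_norm (_ : 0 <= 2^-1)) // invr_ge0.
  have q0 : 0 < cabs (n%:R + av z) by exact: lt_le_trans a1.
  have a3 : rpw 4^-1 (n.+1%:R / 4) * rpw (3 / 4) (cabs z / 2) <= cabs (n%:R + av z).
    have e : cabs (n%:R + av z) = rpw 4^-1 (cabs (n%:R + av z)) * rpw (3 / 4) (cabs (n%:R + av z)).
      by rewrite -rpwD (_ : 4^-1 + 3 / 4 = 1) ?rpw1 //; lra.
    by rewrite e; apply: ler_pM; rewrite ?rpw_ge0 // ler_rpw2 //; lra.
  have a4 := cabs_nat_quarter n.
  apply: (@le_trans _ _ (rpw 4^-1 (n.+1%:R / 4) * rpw (3 / 4) (cabs z / 2) * (n.+1%:R / 4))^-1).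
    apply: (@le_trans _ _ (cabs (n%:R + av z) * cabs (n%:R + (1 / 4 : C)))^-1).
      apply: ler_piMl; last exact: cabs_Xn.
      by rewrite invr_ge0 mulr_ge0 ?cabs_ge0.
    have r0 : 0 < rpw 4^-1 (n.+1%:R / 4) * rpw (3 / 4) (cabs z / 2) by rewrite mulr_gt0 ?rpw_gt0.
    rewrite lef_pV2 ?posrE; [|by apply: mulr_gt0 => //; exact: lt_le_trans a4|exact: mulr_gt0].
    by apply: ler_pM => //; apply: ltW.
  rewrite le_eqVlt; apply/orP; left; apply/eqP.
  have -> : d * u n = rpw (- 1 - 4^-1) (n.+1%:R / 4) * rpw (- (3 / 4)) (cabs z / 2).
    rewrite !rpwMl ?invr_gt0 // /d /c /u; ring.
  move: m0; move: (n.+1%:R / 4) (cabs z / 2) => m v m0.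
  rewrite [in RHS]rpwD rpwN1 // !rpwN.
  by move: (rpw_gt0 4^-1 m) (rpw_gt0 (3 / 4) v) => r1 r2; field; rewrite !gt_eqF.
have dE : (fun n => d * u n) = d *: u by [].
have dc : cvgn (series (fun n => d * u n)) by rewrite dE; exact: is_cvg_seriesZ.
apply: (le_trans (csum_le h dc)).
have -> : limn (series (fun n => d * u n)) = d * limn (series u) by rewrite dE lim_seriesZ.
by rewrite /d le_eqVlt; apply/orP; left; apply/eqP; ring.
Unshelve. all: by end_near. Qed.

Lemma Im_near z (e : R) : 0 < e -> \forall w \near z, `|Im w - Im z| < e.
Proof.
move=> e0; apply/nbhsCP; exists e => // w we.
by rewrite -ImN -ImD; apply: le_lt_trans we; exact: cabs_Im.
Qed.

Lemma av_cont z : av w @[w --> z] --> av z.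
Proof.
have h : w @[w --> z] --> z by exact: cvg_id.
exact: (cvgCB (cvgCc _) (cvgCM (cvgCM (cvgCc _) h) (cvgCc _))).
Qed.

Lemma Msum_cont x z : 0 <= x <= 1 -> Im z = 0 -> Msum x w @[w --> z] --> Msum x z.
Proof.
move=> hx hz; apply: (@csum_dominated _ _ (nbhs z) (nbhs_pfilter z) (fun w n => Mterm x w n) (Mterm x z) Mbound _ Mbound_cvg).
  have p4 : 0 < 4^-1 :> R by rewrite invr_gt0.
  apply: filterS (Im_near z p4) => w; rewrite hz subr0 ltr_norml => /andP[h _] n.
  by apply: Mterm_le => //; exact: ltW.
move=> n; apply: cvgCM; first exact: cvgCc.
apply: cvgCV; last first.
  rewrite mulf_neq0 ?nat_quarter_neq0 ?nat_av_neq0 //.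
  by rewrite hz oppr_le0 invr_ge0.
apply: cvgCM; last exact: cvgCc.
by apply: cvgCD; [exact: cvgCc|exact: av_cont].
Qed.

Lemma lerch_csum x (a : C) : lerch x%:C 1 a = csum (fun n => (x ^+ n)%:C * (n%:R + a)^-1).
Proof.
rewrite /lerch /csum; congr (lim (series _ @ \oo)); apply/funext => n.
by rewrite expr1 rmorphXn.
Qed.

Lemma lerch_term_le x (a : C) n : 0 <= x -> 8^-1 <= cabs (n%:R + a) ->
  cabs ((x ^+ n)%:C * (n%:R + a)^-1) <= geometric 8 x n.
Proof.
move=> x0 h; rewrite cabsM cabsV cabs_real ger0_norm ?exprn_ge0 // /geometric /= mulrC.
apply: ler_wpM2r; first exact: exprn_ge0.
by rewrite -[leRHS]invrK lef_pV2 ?posrE ?invr_gt0 //; apply: lt_le_trans h; rewrite invr_gt0.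
Qed.

(** For t > 0 both Lerch series converge geometrically and may be subtracted term by term; the
    numerators combine to [1 / 4 - av z], a multiple of [z]. *)
Lemma lerch_bracketE t z : 0 < t -> - 4^-1 <= Im z ->
  lerch_bracket t z = 'i%C * z / 2 * Msum (expR (- 2 * t)) z.
Proof.
move=> t0 hz; rewrite /lerch_bracket lerch_arg !lerch_csum.
set x := expR (- 2 * t); have x0 : 0 <= x by exact: expR_ge0.
have x1 : x < 1 by rewrite expR_lt1; lra.
have hx : 0 <= x <= 1 by rewrite x0 ltW.
have gc : cvgn (series (geometric 8 x)).
  by apply: is_cvg_geometric_series; rewrite ger0_norm.
have n8 n : 8^-1 <= n.+1%:R / 8 :> R by rewrite ler_peMl ?invr_ge0 // ler1n.
have b1 n : cabs ((x ^+ n)%:C * (n%:R + av z)^-1) <= geometric 8 x n.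
  by apply: lerch_term_le => //; apply: le_trans (cabs_nat_av n hz).
have b2 n : cabs ((x ^+ n)%:C * (n%:R + (1 / 4 : C))^-1) <= geometric 8 x n.
  apply: lerch_term_le => //; apply: le_trans (cabs_nat_quarter n); apply: (le_trans (n8 n)).
  by rewrite ler_pM2l // lef_pV2 ?posrE // ler_nat.
rewrite -(csumB b1 gc b2 gc) -(csumZ _ (fun n => Mterm_le n hx hz) Mbound_cvg).
congr csum; apply/funext => n; rewrite /Mterm.
have := nat_av_neq0 n hz; have := nat_quarter_neq0 n.
have : 1 / 4 - av z = 'i%C * z / 2 by rewrite /av; ring.
move: (av z) (x ^+ n)%:C (n%:R : C) (1 / 4 : C) => a X N q <- h1 h2.
by field; rewrite h1 h2.
Qed.

Lemma Mterm_cvgx (F : set_system R) (FF : ProperFilter F) z : (expR (- 2 * u) @[u --> F] --> (1 : R)) ->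
  (\forall u \near F, 0 < u) -> - 4^-1 <= Im z ->
  Msum (expR (- 2 * u)) z @[u --> F] --> Msum 1 z.
Proof.
move=> h hu hz; apply: (csum_dominated _ Mbound_cvg).
  apply: filterS hu => u u0 n; apply: Mterm_le => //; rewrite expR_ge0 /= expR_le1.
  lra.
move=> n; apply: cvgCM; last exact: cvgCc.
apply: cvgC_real; elim: n => [|n IH]; first by rewrite expr0; exact: cvg_cst.
by rewrite exprS; under eq_fun do rewrite exprS; apply: cvgM.
Qed.

(** At t = 0 the two Lerch series diverge separately, but [Msum] extends continuously to x = 1 by
    Tannery's theorem, which gives the one-sided limit. *)
Lemma lerch_bracket0E t z : 0 <= t -> - 4^-1 <= Im z ->
  lerch_bracket0 t z = 'i%C * z / 2 * Msum (expR (- 2 * t)) z.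
Proof.
move=> t0 hz; rewrite /lerch_bracket0; case: eqVneq => [->|tn]; last first.
  by rewrite lerch_bracketE // lt_def tn.
rewrite mulr0 expR0; apply: limC.
have e : expR (- 2 * u) @[u --> (0 : R)^'+] --> (1 : R).
  have c : expR (- 2 * u) @[u --> (0 : R)] --> expR (- 2 * 0).
    by apply: continuous_cvg; [exact: continuous_expR|exact: mulrl_continuous].
  by rewrite mulr0 expR0 in c; exact: cvg_at_right_filter.
have p : \forall u \near (0 : R)^'+, 0 < u by exact: nbhs_right_gt.
pose proof (cvgCM (cvgCc ('i%C * z / 2)) (Mterm_cvgx _ e p hz)) as H.
apply: (cvgC_eq_near _ H); apply: filterS p => u u0.
by rewrite lerch_bracketE.
Qed.

Lemma digamma_av z : `|Im z| < 4^-1 ->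
  digamma (av z) - digamma (1 / 4) = - ('i%C * z / 2) * Msum 1 z.
Proof.
rewrite ltr_norml => /andP[h1 h2]; have hz : - 4^-1 <= Im z by exact: ltW.
have ha : 0 < Re (av z) < 1 by rewrite Re_av; apply/andP; split; lra.
have hb : 0 < Re (1 / 4 : C) < 1 by rewrite quarter /=; apply/andP; split; lra.
have H := digamma_sub ha hb.
have x01 : 0 <= (1 : R) <= 1 by rewrite ler01 lexx.
have e : av z - 1 / 4 = - ('i%C * z / 2) by rewrite /av; ring.
rewrite e in H; apply: (cvgC_uniq H).
apply: cvgC_ext (cvgCM (cvgCc (- ('i%C * z / 2))) (Msum_cvg x01 hz)) => n.
rewrite !seriesC_sum; congr (_ * _); apply: eq_bigr => k _.
by rewrite /Mterm expr1n rmorph1 [LHS]mul1r invfM.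
Qed.

Lemma cmeas_Msum (D : set R) (f : R -> R) z : - 4^-1 <= Im z -> measurable_fun D f ->
  (forall t, D t -> 0 <= f t <= 1) -> cmeas D (fun t => Msum (f t) z).
Proof.
move=> hz mf f01; apply: (@cmeas_cvg _ D (fun n t => \sum_(k < n) Mterm (f t) z k)).
  move=> n; apply: cmeas_sum => k; apply: cmeasM; last exact: cmeas_cst.
  by apply: cmeas_real; exact: measurable_funX.
move=> t Dt; apply: cvgC_ext (Msum_cvg (f01 t Dt) hz) => n.
by rewrite seriesC_sum.
Qed.

End Lerch.

(** * The kernel near the real line *)

Section Kernel.
Context {R : realType}.
Local Notation C := R[i].
Implicit Types (s z w : C) (x y t u : R).

(** The value at 0 fills the removable singularity, so that [ee u] is continuous everywhere. *)
Definition ee u z : C :=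
  if z == 0 then - u%:C else (cexp (- 'i%C * z * u%:C) - 1) / ('i%C * z).

Lemma i_neq0 : ('i%C : C) != 0.
Proof. by rewrite -cabs_gt0 cabs_i. Qed.

Lemma eeE u z : z != 0 -> ee u z = (cexp (- 'i%C * z * u%:C) - 1) / ('i%C * z).
Proof. by rewrite /ee => /negbTE ->. Qed.

Lemma ee0 z : ee 0 z = 0.
Proof. by rewrite /ee; case: ifP => _; rewrite ?mulr0 ?cexp0 ?subrr ?mul0r ?oppr0. Qed.

Lemma ee_cont u z : ee u w @[w --> z] --> ee u z.
Proof.
apply: cvgC_at; have i0 := i_neq0.
have [->|z0] := eqVneq z 0.
  have h : cder (fun w => cexp (w * (- 'i%C * u%:C))) 0 ((- 'i%C * u%:C) * cexp (0 * (- 'i%C * u%:C))).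
    exact: cder_cexp.
  pose proof (cvgCM h (cvgCc 'i%C^-1)) as H.
  have -> : ee u 0 = - 'i%C * u%:C * cexp (0 * (- 'i%C * u%:C)) * 'i%C^-1.
    by rewrite /ee eqxx mul0r cexp0; field.
  apply: (cvgC_eq_near _ H); apply: filterS (near_dnbhs_neq 0) => w; rewrite subr0 => w0.
  rewrite eeE // mul0r cexp0.
  have -> : w * (- 'i%C * u%:C) = - 'i%C * w * u%:C by ring.
  by field; rewrite w0.
have hz := @cvg_id_dnbhs _ z.
have h1 : cder (fun w => cexp (w * (- 'i%C * u%:C))) z ((- 'i%C * u%:C) * cexp (z * (- 'i%C * u%:C))).
  exact: cder_cexp.
have h2 := cder_cvg h1.
have iz : 'i%C * z != 0 by rewrite mulf_neq0.
have H : (cexp (w * (- 'i%C * u%:C)) - 1) * ('i%C * w)^-1 @[w --> z^'] -->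
    (cexp (z * (- 'i%C * u%:C)) - 1) * ('i%C * z)^-1.
  exact: (cvgCM (cvgCB h2 (cvgCc 1)) (cvgCV (cvgCM (cvgCc 'i%C) hz) iz)).
have e w : w != 0 -> (cexp (w * (- 'i%C * u%:C)) - 1) * ('i%C * w)^-1 = ee u w.
  by move=> w0; rewrite eeE //; have -> : w * (- 'i%C * u%:C) = - 'i%C * w * u%:C by ring.
rewrite (e z z0) in H.
apply: (@cvgC_eq_near _ _ _ _ (fun w => (cexp (w * (- 'i%C * u%:C)) - 1) * ('i%C * w)^-1) (ee u) _ _ H).
by apply: filterS (cvgC_neq0 hz z0) => w; exact: e.
Qed.

Lemma real_line z : Im z = 0 -> z = (Re z)%:C.
Proof. by move=> h; apply: complexP. Qed.

Lemma cabs_real_line z : Im z = 0 -> cabs z = `|Re z|.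
Proof. by move=> h; rewrite /cabs h expr0n addr0 sqrtr_sqr. Qed.

Lemma ee_num z u : Im z = 0 -> cexp (- 'i%C * z * u%:C) = cis (- (Re z * u)).
Proof.
by move=> /real_line ->; rewrite /cis; congr cexp; rewrite !rmorphN rmorphM /=; ring.
Qed.

Lemma sin_norm_le y : `|sin y| <= `|y|.
Proof.
have h (x : R) : 0 <= x -> `|sin x| <= x.
  move=> x0; rewrite ler_norml sin_le_id // andbT lerNl -subr_ge0 opprK.
  have -> : 0 = 0 + sin 0 :> R by rewrite sin0 addr0.
  apply: (@ge0_derive_le _ (fun x => x + sin x) (fun x => 1 + cos x) 0 x x0).
  by move=> u _; have := cos_geN1 u; lra.
have [y0|y0] := leP 0 y; first by rewrite (ger0_norm y0); exact: h.
rewrite (ltr0_norm y0) -normrN -sinN; apply: h; lra.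
Qed.

(** The squared modulus is 2 - 2 cos y = 4 sin(y/2)^2. *)
Lemma cis_sub1_le y : cabs (cis y - 1) <= `|y|.
Proof.
rewrite -ler_sqr ?nnegrE ?cabs_ge0 // cabs_sqr cisE ReD ImD ReN ImN /= oppr0 addr0.
have e : cos y = 1 - 2 * sin (y / 2) ^+ 2.
  rewrite {1}[y](_ : _ = y / 2 + y / 2); last by field.
  by rewrite cosD -!expr2 cos2sin2; ring.
have h2 : sin (y / 2) ^+ 2 <= (y / 2) ^+ 2.
  rewrite -[leLHS]real_normK ?num_real // -[leRHS]real_normK ?num_real //.
  by rewrite ler_sqr ?nnegrE //; exact: sin_norm_le.
rewrite real_normK ?num_real //.
have -> : (cos y - 1) ^+ 2 + sin y ^+ 2 = 2 - 2 * cos y.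
  by have := cos2Dsin2 y; move: (cos y) (sin y) => c s; lra.
by rewrite e; move: h2; move: (sin (y / 2)) => s; lra.
Qed.

Lemma ee_le1 u z : Im z = 0 -> cabs (ee u z) <= `|u|.
Proof.
move=> hz; rewrite /ee; case: eqVneq => [_|z0]; first by rewrite cabsN cabs_real.
rewrite ee_num // cabsM cabsV cabsM cabs_i mul1r ler_pdivrMr ?cabs_gt0 //.
apply: (le_trans (cis_sub1_le _)); rewrite normrN normrM cabs_real_line // mulrC.
exact: lexx.
Qed.

Lemma ee_le2 u z : Im z = 0 -> z != 0 -> cabs (ee u z) <= 2 / cabs z.
Proof.
move=> hz z0; rewrite eeE // ee_num // cabsM cabsV cabsM cabs_i mul1r.
apply: ler_wpM2r; first by rewrite invr_ge0 cabs_ge0.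
apply: (le_trans (cabsB _ _)); rewrite cabs1 /cis cabs_cexp ReM /= mul0r mulr0 subr0 expR0.
by rewrite -natr1.
Qed.

Lemma cmeas_ee (D : set R) (f : R -> R) z : measurable_fun D f -> cmeas D (fun t => ee (f t) z).
Proof.
move=> mf; rewrite /ee; case: eqP => _; first by apply: cmeasN; exact: cmeas_real.
apply: cmeasM; last exact: cmeas_cst.
apply: cmeasB; last exact: cmeas_cst.
by apply: cmeas_cexp; apply: cmeasM; [exact: cmeas_cst|exact: cmeas_real].
Qed.

Definition vM (n : nat) : C := (von_Mangoldt n / Num.sqrt n%:R)%:C.

(* The terms with log n > t vanish, so that N can be chosen independently of t. *)
Definition VS (N : nat) t z : C :=
  \sum_(1 <= n < N) vM n * ee (Num.max (t - ln n%:R) 0) z.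

Lemma VS_E N t z : (Num.truncn (expR t) < N)%N -> z != 0 ->
  \sum_(1 <= n < (Num.truncn (expR t)).+1)
      (von_Mangoldt n / Num.sqrt n%:R)%:C
      * ((cexp (- 'i%C * z * (t - ln n%:R)%:C) - 1) / ('i%C * z)) = VS N t z.
Proof.
move=> tN z0; rewrite /VS [RHS](@big_cat_nat _ _ _ (Num.truncn (expR t)).+1) //=.
rewrite [X in _ = _ + X]big1_seq ?addr0; last first.
  move=> n /andP[_]; rewrite mem_index_iota => /andP[n1 _].
  have n0 : 0 < n%:R :> R by rewrite ltr0n (leq_trans _ n1).
  have -> : Num.max (t - ln n%:R) 0 = 0; last by rewrite ee0 mulr0.
  apply/max_idPr; rewrite subr_le0 -ler_expR lnK // ltW //.
  by apply: (lt_le_trans (truncnS_gt _)); rewrite ler_nat.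
rewrite !big_seq; apply: eq_bigr => n; rewrite mem_index_iota => /andP[n1 n2].
have n0 : 0 < n%:R :> R by rewrite ltr0n.
transitivity (vM n * ee (t - ln n%:R) z); first by rewrite (eeE _ z0).
congr (vM n * ee _ z); apply/esym/max_idPl.
rewrite subr_ge0 -ler_expR lnK //; apply: le_trans (_ : (Num.truncn (expR t))%:R <= _).
  by rewrite ler_nat -ltnS.
by rewrite truncn_le expR_ge0.
Qed.

(* P_t without its term zeta'/zeta *)
Definition RR (N : nat) t z : C :=
  (4 * (expR (t / 2) - 1))%:C / (1 + 2 * 'i%C * z)
  + (4 * (expR (- t / 2) - 1))%:C / (1 - 2 * 'i%C * z)
  + VS N t z + 1 / 4 * Msum 1 z
  - 1 / 4 * (expR (- t / 2))%:C * Msum (expR (- 2 * t)) z.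

Definition zlog s : C := derive1 zeta s / zeta s.

(** The factors 1 / (2 i z) in front of the digamma and Lerch brackets meet the factor i z / 2
    extracted from them; their product is the 1/4 in [RR]. *)
Lemma frakP_E N t z : 0 <= t -> (Num.truncn (expR t) < N)%N -> z != 0 -> `|Im z| < 4^-1 ->
  frakP t z = RR N t z + ee t z * zlog (sline z).
Proof.
move=> t0 tN z0 hz; have hz' : - 4^-1 <= Im z.
  by move: hz; rewrite ltr_norml => /andP[h _]; exact: ltW.
rewrite /frakP (VS_E tN z0) (lerch_bracket0E t0 hz').
rewrite -/(av z) (digamma_av hz) eeE // -/(sline z) -/(zlog (sline z)) /RR.
move: (_ / (1 + _)) (_ / (1 - _)) (VS N t z) (zlog _) (Msum 1 z) (Msum _ z) (expR (- t / 2))%:C (cexp _) => a b v l m1 m2 e c.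
by field; rewrite z0 i_neq0.
Qed.

(* [Afac] on the critical line, with digamma expanded as a series *)
Definition Aline z : C := (sline z)^-1 + (sline z - 1)^-1 - (ln pi)%:C / 2 +
  (digamma (1 / 4) - 'i%C * z / 2 * Msum 1 z) / 2.

Lemma AlineE z : `|Im z| < 4^-1 -> Afac (sline z) = Aline z.
Proof.
move=> hz; rewrite /Afac /Aline -avE; congr (_ + _ / 2).
by have /eqP := digamma_av hz; rewrite subr_eq => /eqP ->; rewrite addrC mulNr.
Qed.

Lemma cvgC_sum (I : Type) (T : Type) (F : set_system T) {FF : Filter F} (r : seq I) (f : I -> T -> C) (l : I -> C) :
  (forall i, f i x @[x --> F] --> l i) ->
  \sum_(i <- r) f i x @[x --> F] --> \sum_(i <- r) l i.
Proof.
move=> h; elim: r => [|i r IH].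
  by rewrite big_nil; apply: cvgC_ext (cvgCc 0) => x; rewrite big_nil.
by rewrite big_cons; apply: cvgC_ext (cvgCD (h i) IH) => x; rewrite big_cons.
Qed.

Lemma sline_cont z : sline w @[w --> z] --> sline z.
Proof.
have h : w @[w --> z] --> z by exact: cvg_id.
exact: (cvgCB (cvgCc _) (cvgCM (cvgCc _) h)).
Qed.

Lemma lin_neq0 (c : R) z : Im z = 0 -> 1 + c%:C * 'i%C * z != 0.
Proof.
move=> hz; apply/eqP => /(congr1 (@complex.Re R)) /=; rewrite -mulrA ReD ReZ ReM hz /=.
by rewrite mul0r mulr0 subr0 mulr0 addr0; apply/eqP; exact: oner_neq0.
Qed.

Lemma twoC : (2 : C) = (2 : R)%:C. Proof. by rewrite rmorph_nat. Qed.

Lemma lin_neq0p z : Im z = 0 -> 1 + 2 * 'i%C * z != 0.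
Proof. by rewrite twoC; exact: lin_neq0. Qed.

Lemma lin_neq0m z : Im z = 0 -> 1 - 2 * 'i%C * z != 0.
Proof. by move=> hz; have := lin_neq0 (- 2) hz; rewrite rmorphN /= -twoC !mulNr. Qed.

Lemma RR_cont N t z : 0 <= t -> Im z = 0 -> RR N t w @[w --> z] --> RR N t z.
Proof.
move=> t0 hz; have h : w @[w --> z] --> z by exact: cvg_id.
have hl : 2 * 'i%C * w @[w --> z] --> 2 * 'i%C * z by exact: (cvgCM (cvgCc _) h).
have x1 : 0 <= (1 : R) <= 1 by rewrite ler01 lexx.
have x2 : 0 <= expR (- 2 * t) <= 1 by rewrite expR_ge0 /= expR_le1; lra.
have v : VS N t w @[w --> z] --> VS N t z.
  by apply: (@cvgC_sum _ _ (nbhs z) _) => n; exact: (cvgCM (cvgCc _) (@ee_cont _ z)).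
have hp : (4 * (expR (t / 2) - 1))%:C / (1 + 2 * 'i%C * w) @[w --> z] --> (4 * (expR (t / 2) - 1))%:C / (1 + 2 * 'i%C * z).
  exact: (cvgCM (cvgCc _) (cvgCV (cvgCD (cvgCc _) hl) (lin_neq0p hz))).
have hm : (4 * (expR (- t / 2) - 1))%:C / (1 - 2 * 'i%C * w) @[w --> z] --> (4 * (expR (- t / 2) - 1))%:C / (1 - 2 * 'i%C * z).
  exact: (cvgCM (cvgCc _) (cvgCV (cvgCB (cvgCc _) hl) (lin_neq0m hz))).
exact: (cvgCB (cvgCD (cvgCD (cvgCD hp hm) v) (cvgCM (cvgCc _) (Msum_cont x1 hz))) (cvgCM (cvgCc _) (Msum_cont x2 hz))).
Qed.

Lemma strip_line z : Im z = 0 -> strip (sline z).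
Proof. by move=> hz; apply: strip_sline; rewrite hz normr0. Qed.

Lemma Aline_cont z : Im z = 0 -> Aline w @[w --> z] --> Aline z.
Proof.
move=> hz; have h : w @[w --> z] --> z by exact: cvg_id.
have hs := strip_line hz; have s0 := strip_neq0 hs; have s1 := strip_neq1 hs.
rewrite -subr_eq0 in s1; have x1 : 0 <= (1 : R) <= 1 by rewrite ler01 lexx.
have m : digamma (1 / 4) - 'i%C * w / 2 * Msum 1 w @[w --> z] --> digamma (1 / 4) - 'i%C * z / 2 * Msum 1 z.
  exact: (cvgCB (cvgCc _) (cvgCM (cvgCM (cvgCM (cvgCc _) h) (cvgCc _)) (Msum_cont x1 hz))).
have a : (sline w)^-1 @[w --> z] --> (sline z)^-1 by exact: (cvgCV (@sline_cont z) s0).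
have b : (sline w - 1)^-1 @[w --> z] --> (sline z - 1)^-1 by exact: (cvgCV (cvgCB (@sline_cont z) (cvgCc 1)) s1).
exact: (cvgCD (cvgCB (cvgCD a b) (cvgCc _)) (cvgCM m (cvgCc _))).
Qed.

Lemma sline_sub z w : cabs (sline w - sline z) = cabs (w - z).
Proof.
have -> : sline w - sline z = - 'i%C * (w - z) by rewrite /sline; ring.
by rewrite cabsM cabsN cabs_i mul1r.
Qed.

Lemma sline_inj z w : w != z -> sline w != sline z.
Proof. by rewrite -subr_eq0 -cabs_gt0 => h; rewrite -subr_eq0 -cabs_gt0 sline_sub. Qed.

Lemma near_sline' z (P : C -> Prop) : (\forall s \near (sline z)^', P s) ->
  \forall w \near z^', P (sline w).
Proof.
move=> /dnbhsCP[e e0 h]; apply/dnbhsCP; exists e => // w wz we; apply: h.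
  exact: sline_inj.
by rewrite sline_sub.
Qed.

Lemma cvg_sline z (f : C -> C) (l : C) : f s @[s --> (sline z)^'] --> l ->
  f (sline w) @[w --> z^'] --> l.
Proof.
move=> /cvgC_dnbhs h; apply/cvgC_dnbhs => e e0; have [r r0 hr] := h e e0.
exists r; first exact: r0.
by move=> w wz wr; apply: hr; [exact: sline_inj|rewrite sline_sub].
Qed.

(** * Limits of S_t at real points *)

Definition Sraw t z : C := 'i%C * (1 + sharp Theta_xi z) / 2 * frakP t z.

(* S_t is the case h1 = H, h2 = H - 1, h3 = - H. *)
Definition Sform N t z (h1 h2 h3 : C) : C :=
  'i%C * (h1 * RR N t z + h2 * ee t z + h3 * (Aline z * ee t z)).

Lemma cvgC_punctured (f : C -> C) z (l : C) : f w @[w --> z] --> l -> f w @[w --> z^'] --> l.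
Proof. by move=> h P /h /near_dnbhs. Qed.

Lemma Sraw_lim N t z (k1 k2 k3 : C -> C) (h1 h2 h3 : C) : 0 <= t -> Im z = 0 ->
  (\forall w \near z^', Sraw t w = Sform N t w (k1 w) (k2 w) (k3 w)) ->
  k1 w @[w --> z^'] --> h1 -> k2 w @[w --> z^'] --> h2 -> k3 w @[w --> z^'] --> h3 ->
  Sraw t w @[w --> z^'] --> Sform N t z h1 h2 h3.
Proof.
move=> t0 hz E c1 c2 c3.
have r : RR N t w @[w --> z^'] --> RR N t z by exact: cvgC_punctured (@RR_cont N t z t0 hz).
have e : ee t w @[w --> z^'] --> ee t z by exact: cvgC_punctured (@ee_cont t z).
have a : Aline w @[w --> z^'] --> Aline z by exact: cvgC_punctured (@Aline_cont z hz).
pose proof (cvgCM (cvgCc 'i%C) (cvgCD (cvgCD (cvgCM c1 r) (cvgCM c2 e)) (cvgCM c3 (cvgCM a e)))) as H.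
by apply: (cvgC_eq_near _ H); apply: filterS E => w ->.
Qed.

Lemma Sraw_E N t z : 0 <= t -> (Num.truncn (expR t) < N)%N -> z != 0 -> `|Im z| < 4^-1 ->
  Sraw t z = 'i%C * (1 + (X (sline z) + dX (sline z)) / (X (sline z) - dX (sline z))) / 2 *
    (RR N t z + ee t z * zlog (sline z)).
Proof.
move=> t0 tN z0 hz; rewrite /Sraw (frakP_E t0 tN z0 hz) sharp_ThetaE //.
by apply: lt_trans hz _; rewrite ltf_pV2 ?posrE // ltr_nat.
Qed.

Lemma Sraw_E1 N t z : 0 <= t -> (Num.truncn (expR t) < N)%N -> z != 0 -> `|Im z| < 4^-1 ->
  X (sline z) != 0 -> X (sline z) - dX (sline z) != 0 ->
  Sraw t z = Sform N t z (X (sline z) / (X (sline z) - dX (sline z)))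
    (X (sline z) / (X (sline z) - dX (sline z)) - 1)
    (- (X (sline z) / (X (sline z) - dX (sline z)))).
Proof.
move=> t0 tN z0 hz x0 h0; have hs : strip (sline z).
  by apply: strip_sline; apply: lt_trans hz _; rewrite ltf_pV2 ?posrE // ltr_nat.
rewrite (Sraw_E t0 tN z0 hz) /zlog zeta_log // AlineE // /Sform.
move: x0 h0; move: (X (sline z)) (dX (sline z)) (RR N t z) (ee t z) (Aline z) => a b r e l a0 ab.
by field; rewrite a0 ab.
Qed.

Lemma near_line z : Im z = 0 -> \forall w \near z^', w != 0 /\ `|Im w| < 4^-1.
Proof.
move=> hz; have p4 : 0 < 4^-1 :> R by rewrite invr_gt0.
have h1 := near_dnbhs (Im_near z p4).
have h2 : \forall w \near z^', w != 0.
  have [->|z0] := eqVneq z 0.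
    by apply: filterS (near_dnbhs_neq 0) => w; rewrite subr0.
  exact: cvgC_neq0 (@cvg_id_dnbhs _ z) z0.
by apply: filterS2 h1 h2 => w; rewrite hz subr0.
Qed.

Lemma X_cont s : strip s -> X w @[w --> s] --> X s.
Proof. by move=> hs; apply: analytic_continuous; exact: X_analytic. Qed.

Lemma dX_cont s : strip s -> dX w @[w --> s] --> dX s.
Proof.
by move=> hs; apply: analytic_continuous; have [_ h] := analytic_cder (X_analytic hs).
Qed.

(* The weights do not depend on t: either X does not vanish at the point, and
   they are H, H - 1, -H with H = X / (X - X'); or X has a zero there, and
   H tends to 0; or X vanishes identically, and the quotients take the value
   x / 0 = 0. *)
Lemma Sraw_weights z : Im z = 0 -> exists h1 h2 h3 : C,
  [/\ cabs h1 <= 1, cabs h2 <= 1, cabs h3 <= 1 &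
   forall t N, 0 <= t -> (Num.truncn (expR t) < N)%N -> Sraw t w @[w --> z^'] --> Sform N t z h1 h2 h3].
Proof.
move=> hz; have hs := strip_line hz; have nl := near_line hz.
have c1 := @X_cont _ hs; have c2 := @dX_cont _ hs.
have [X0|X0] := eqVneq (X (sline z)) 0; last first.
  (* [dX] is imaginary here, so the real part of the difference is that of [X], which is real and
     nonzero. *)
  have d0 : X (sline z) - dX (sline z) != 0.
    apply: contraNneq X0 => /(congr1 (@complex.Re R)); rewrite ReD ReN dX_line_Re // subr0 => h.
    by apply/eqP; apply: complexP => //; rewrite X_line_Im.
  have [b1 b2] := H_bounds (X_line_Im hz) (dX_line_Re hz) d0.
  exists (X (sline z) / (X (sline z) - dX (sline z))), (X (sline z) / (X (sline z) - dX (sline z)) - 1),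
     (- (X (sline z) / (X (sline z) - dX (sline z)))).
  split; [exact: b1|exact: b2|by rewrite cabsN|move=> t N t0 tN].
  have cd : X s - dX s @[s --> sline z] --> X (sline z) - dX (sline z) by exact: cvgCB c1 c2.
  have ch : X s / (X s - dX s) @[s --> sline z] --> X (sline z) / (X (sline z) - dX (sline z)).
    exact: (cvgCM c1 (cvgCV cd d0)).
  have ch' := cvg_sline (cvgC_punctured ch).
  apply: (Sraw_lim t0 hz _ ch' (cvgCB ch' (cvgCc 1)) (cvgCN ch')).
  pose proof (near_sline' (near_dnbhs (cvgC_neq0 c1 X0))) as n1.
  pose proof (near_sline' (near_dnbhs (cvgC_neq0 cd d0))) as n2.
  apply: filterS3 nl n1 n2 => w [w0 hw] a b; exact: Sraw_E1.
have [Xz|[m [g [ga g0 gE]]]] := analytic_dichotomy (X_analytic hs).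
  have dz : \forall s \near sline z, X s = 0 /\ dX s = 0.
    have /nbhsCP[e e0 he] := Xz; apply/nbhsCP; exists e; first exact: e0.
    move=> s se; split; first exact: he.
    apply: cderive_val; apply: (cder_near _ (cder_cst 0 s)).
    apply/nbhsCP; exists (e - cabs (s - sline z)); first by rewrite subr_gt0.
    move=> w ws; apply/esym/he; rewrite -[w](subrK s) -addrA.
    by apply: (le_lt_trans (cabsD _ _)); rewrite -ltrBrDr.
  (* With [X] and [dX] both 0, the quotients [sharp Theta_xi] and zeta'/zeta take the value 0, and
     S_t reduces to i / 2 times [RR]. *)
  exists (1 / 2), 0, 0; split; [|by rewrite cabs0|by rewrite cabs0|move=> t N t0 tN].
    by rewrite mul1r cabsV cabs_nat invf_le1 // ler1n.
  apply: (Sraw_lim (k1 := fun=> 1 / 2) (k2 := fun=> 0) (k3 := fun=> 0) t0 hz); try exact: cvgCc.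
  have n1 := near_sline' (near_dnbhs dz); have n2 := near_sline' (near_dnbhs (strip_near hs)).
  apply: filterS3 nl n1 n2 => w [w0 hw] [a b] hsw.
  rewrite (Sraw_E t0 tN w0 hw) a b /zlog (zeta_X0 hsw a) invr0 /Sform !(mulr0, mul0r, addr0).
  by move: (RR N t w) => r; field.
have m0 : (0 < m)%N.
  rewrite lt0n; apply: contraNneq g0 => m0; move: gE; rewrite m0 => /nbhsCP[e e0 he].
  by have := he (sline z); rewrite subrr cabs0 X0 expr0 mul1r => /(_ e0) <-.
case: m m0 gE => // p _ gE;
have [gd ga'] := analytic_cder ga; have cg := analytic_continuous ga.
have cg' := analytic_continuous ga'.
have dXE1 : \forall s \near sline z, dX s = (s - sline z) ^+ p * (p.+1%:R * g s + (s - sline z) * derive1 g s).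
  have /nbhsCP[e e0 he] := gE; have /nbhsCP[e' e0' he'] := gd.
  apply/nbhsCP; exists (Num.min e e'); first by rewrite lt_min e0.
  move=> s; rewrite lt_min => /andP[se se']; apply: cderive_val.
  have pw : cder (fun w => (1 * w + (- sline z)) ^+ p.+1) s (1 * (p.+1%:R * (1 * s + - sline z) ^+ p)).
    exact: cder_affine (@cder_exp R p.+1 (1 * s - sline z)).
  have H := cderM pw (he' s se'); rewrite !mul1r in H.
  have -> : (s - sline z) ^+ p * (p.+1%:R * g s + (s - sline z) * derive1 g s) =
     p.+1%:R * (s - sline z) ^+ p * g s + (s - sline z) ^+ p.+1 * derive1 g s by rewrite exprS; ring.
  apply: cder_near H.
  apply/nbhsCP; exists (e - cabs (s - sline z)); first by rewrite subr_gt0.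
  move=> w ws; rewrite mul1r; apply/esym/he; rewrite -[w](subrK s) -addrA.
  by apply: (le_lt_trans (cabsD _ _)); rewrite -ltrBrDr.
(* For a zero of order p + 1 the derivative has order p, so [X - dX] is [(s - sline z) ^ p * q s],
   and [q] equals -(p + 1) g, which is nonzero, at the zero itself. Hence H = (s - sline z) g / q
   tends to 0. *)
pose q s := (s - sline z) * g s - p.+1%:R * g s - (s - sline z) * derive1 g s.
have cs : s - sline z @[s --> sline z] --> (0 : C).
  rewrite -(subrr (sline z)); have h : s @[s --> sline z] --> sline z by exact: cvg_id.
  exact: (cvgCB h (cvgCc (sline z))).
have cq : q s @[s --> sline z] --> - (p.+1%:R * g (sline z)).
  have -> : - (p.+1%:R * g (sline z)) = 0 * g (sline z) - p.+1%:R * g (sline z) - 0 * derive1 g (sline z) by ring.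
  exact: (cvgCB (cvgCB (cvgCM cs cg) (cvgCM (cvgCc _) cg)) (cvgCM cs cg')).
have q0 : - (p.+1%:R * g (sline z)) != 0 by rewrite oppr_eq0 mulf_neq0 // pnatr_eq0.
have H0 : (s - sline z) * g s / q s @[s --> (sline z)^'] --> (0 : C).
  apply: cvgC_punctured; have -> : (0 : C) = 0 * g (sline z) / - (p.+1%:R * g (sline z)) by rewrite !mul0r.
  exact: (cvgCM (cvgCM cs cg) (cvgCV cq q0)).
have E1 : \forall s \near (sline z)^', [/\ X s != 0, X s - dX s != 0 & X s / (X s - dX s) = (s - sline z) * g s / q s].
  have a1 := near_dnbhs gE; have a2 := near_dnbhs dXE1; have a3 := near_dnbhs_neq (sline z).
  pose proof (near_dnbhs (cvgC_neq0 cg g0)) as a4; pose proof (near_dnbhs (cvgC_neq0 cq q0)) as a5.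
  pose proof (filterI a1 a2) as a12; pose proof (filterI a4 a5) as a45.
  apply: filterS3 a12 a3 a45 => s [e1 e2] sn [gn qn].
  have e3 : X s - dX s = (s - sline z) ^+ p * q s by rewrite e1 e2 /q exprS; ring.
  have pn : (s - sline z) ^+ p != 0 by rewrite expf_neq0.
  split; [by rewrite e1 mulf_neq0 // expf_neq0|by rewrite e3 mulf_neq0|].
  rewrite e3 e1 exprS; move: pn qn; move: ((s - sline z) ^+ p) (q s) (g s) => P Q G pn qn.
  by field; rewrite pn qn.
(* The weights H, H - 1 and -H at the limit H = 0, left unsimplified so that they match the
   limits. *)
exists 0, (0 - 1), (- 0); split; [by rewrite cabs0|by rewrite sub0r cabsN cabs1|by rewrite cabsN cabs0|].
move=> t N t0 tN.
have Hk : X s / (X s - dX s) @[s --> (sline z)^'] --> (0 : C).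
  by apply: (cvgC_eq_near _ H0); apply: filterS E1 => s [_ _ ->].
have ch' := cvg_sline Hk.
apply: (Sraw_lim t0 hz _ ch' (cvgCB ch' (cvgCc 1)) (cvgCN ch')).
have n1 := near_sline' E1.
apply: filterS2 nl n1 => w [w0 hw] [a b _]; exact: Sraw_E1.
Qed.

End Kernel.

(** * Bounds on the real line *)

Section Bounds.
Context {R : realType}.
Local Notation C := R[i].
Local Notation mu := (@lebesgue_measure R).
Implicit Types (s z w : C) (x y t u : R).

(** The rate of decay shared by all terms: bounded near the origin, and with an integrable square on
    the line. *)
Definition rr z : R := if cabs z <= 1 then 1 else rpw (- (3 / 4)) (cabs z).

Lemma rr_ge0 z : 0 <= rr z.
Proof. by rewrite /rr; case: ifP => // _; exact: rpw_ge0. Qed.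

Lemma rr_le1 z : rr z <= 1.
Proof.
rewrite /rr; case: ifPn => [//|]; rewrite -ltNge => h; rewrite /rpw expR_le1 mulNr oppr_le0 mulr_ge0 //.
by rewrite ln_ge0 // ltW.
Qed.

Lemma rr_small z : cabs z <= 1 -> rr z = 1.
Proof. by rewrite /rr => ->. Qed.

Lemma rr_big z : 1 < cabs z -> rr z = rpw (- (3 / 4)) (cabs z).
Proof. by rewrite /rr ltNge => /negbTE ->. Qed.

Lemma rr_inv z : 1 < cabs z -> (cabs z)^-1 <= rr z.
Proof.
move=> h; have h0 : 0 < cabs z by apply: lt_trans h.
rewrite rr_big // -rpwN1 //; apply: ler_rpw; [exact: ltW|lra].
Qed.

Lemma bnd_lin (c : R) z : Im z = 0 -> 1 <= `|c| -> cabs (1 + c%:C * 'i%C * z)^-1 <= rr z.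
Proof.
move=> hz hc; rewrite cabsV.
have e : 1 + c%:C * 'i%C * z = 1 +i* (c * Re z).
  apply: complexP; rewrite ?ReD ?ImD -mulrA ?ReZ ?ImZ ?ReM ?ImM hz /=; ring.
rewrite e; have h1 : 1 <= cabs (1 +i* (c * Re z)).
  by have := cabs_Re (1 +i* (c * Re z)); rewrite /= normr1.
have h0 : 0 < cabs (1 +i* (c * Re z)) by apply: lt_le_trans h1.
have [z1|z1] := leP (cabs z) 1; first by rewrite rr_small // invf_le1.
apply: le_trans (rr_inv z1); rewrite lef_pV2 ?posrE //; last by apply: lt_trans z1.
have := cabs_Im (1 +i* (c * Re z)) => /=; apply: le_trans.
by rewrite normrM cabs_real_line // ler_peMl.
Qed.

Lemma bnd_ee (T u : R) z : Im z = 0 -> `|u| <= T -> cabs (ee u z) <= (T + 2) * rr z.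
Proof.
move=> hz uT; have T0 : 0 <= T by exact: le_trans uT.
have [z1|z1] := leP (cabs z) 1.
  rewrite rr_small // mulr1; apply: (le_trans (ee_le1 u hz)); lra.
have z0 : z != 0 by rewrite -cabs_gt0; apply: lt_trans z1.
apply: (le_trans (ee_le2 u hz z0)); apply: (@le_trans _ _ (2 * rr z)).
  by apply: ler_wpM2l => //; exact: rr_inv.
by apply: ler_wpM2r; [exact: rr_ge0|lra].
Qed.

Lemma bnd_Msum : exists2 K : R, 0 <= K & forall x z, 0 <= x <= 1 -> Im z = 0 ->
  cabs (Msum x z) <= K * rr z.
Proof.
have [K K0 hK] := @Msum_decay R.
have h x z : 0 <= x <= 1 -> Im z = 0 -> cabs (Msum x z) <= limn (series (@Mbound R)).
  by move=> hx hz; apply: Msum_le => //; rewrite hz oppr_le0 invr_ge0.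
have S0 : 0 <= limn (series (@Mbound R)).
  by apply: le_trans (h 0 0 _ _); rewrite ?cabs_ge0 // lexx ler01.
exists (K + limn (series (@Mbound R))); first exact: addr_ge0.
move=> x z hx hz; have [z1|z1] := leP (cabs z) 1.
  by rewrite rr_small // mulr1; apply: (le_trans (h x z hx hz)); rewrite lerDr.
have z0 : z != 0 by rewrite -cabs_gt0; apply: lt_trans z1.
apply: (le_trans (hK x z hx hz z0)); rewrite -rr_big //.
by apply: ler_wpM2r; [exact: rr_ge0|rewrite lerDl].
Qed.

Lemma max_ln_bound (T t : R) (n : nat) : (0 < n)%N -> 0 <= t <= T ->
  `|Num.max (t - ln n%:R) 0| <= T.
Proof.
move=> n0 /andP[t0 tT]; rewrite ger0_norm; last by rewrite le_max lexx orbT.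
rewrite ge_max (le_trans t0 tT) andbT; apply: le_trans tT; rewrite gerBl.
by apply: ln_ge0; rewrite ler1n.
Qed.

Lemma bnd_VS (N : nat) (T : R) : 0 <= T -> exists2 K : R, 0 <= K & forall t z, 0 <= t <= T -> Im z = 0 ->
  cabs (VS N t z) <= K * rr z.
Proof.
move=> T0; exists (\sum_(1 <= n < N) cabs (@vM R n) * (T + 2)).
  by apply: sumr_ge0 => n _; rewrite mulr_ge0 ?cabs_ge0 // addr_ge0.
move=> t z ht hz; rewrite /VS mulr_suml; apply: (le_trans (cabs_sum _ _ _)).
rewrite !big_seq; apply: ler_sum => n; rewrite mem_index_iota => /andP[n1 _].
rewrite cabsM -mulrA ler_wpM2l ?cabs_ge0 //.
by apply: bnd_ee => //; exact: max_ln_bound.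
Qed.

Lemma bnd_RR (N : nat) (T : R) : 0 <= T -> exists2 K : R, 0 <= K & forall t z, 0 <= t <= T -> Im z = 0 ->
  cabs (RR N t z) <= K * rr z.
Proof.
move=> T0; have [K1 K10 h1] := bnd_VS N T0; have [K2 K20 h2] := bnd_Msum.
exists (4 * expR T + 4 + K1 + K2 + K2).
  by rewrite !addr_ge0 // mulr_ge0 // expR_ge0.
move=> t z ht hz; have /andP[t0 tT] := ht; have r0 := rr_ge0 z.
have q4 : cabs (1 / 4 : C) = 4^-1 by rewrite quarter cabs_real ger0_norm // invr_ge0.
have e1 : cabs ((4 * (expR (t / 2) - 1))%:C / (1 + 2 * 'i%C * z)) <= 4 * expR T * rr z.
  rewrite cabsM; apply: ler_pM; rewrite ?cabs_ge0 //; last first.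
    by rewrite twoC; apply: bnd_lin => //; rewrite ger0_norm // ler1n.
  have p : 1 <= expR (t / 2) by rewrite -expR0 ler_expR divr_ge0.
  rewrite cabs_real ger0_norm; last by rewrite mulr_ge0 // subr_ge0.
  rewrite ler_pM2l //; apply: (@le_trans _ _ (expR (t / 2))); first by rewrite gerBl.
  by rewrite ler_expR; lra.
have e2 : cabs ((4 * (expR (- t / 2) - 1))%:C / (1 - 2 * 'i%C * z)) <= 4 * rr z.
  rewrite cabsM; apply: ler_pM; rewrite ?cabs_ge0 //; last first.
    have -> : 1 - 2 * 'i%C * z = 1 + (- 2)%:C * 'i%C * z by rewrite rmorphN /= -twoC !mulNr.
    by apply: bnd_lin => //; rewrite normrN ger0_norm // ler1n.
  have p : expR (- t / 2) <= 1 by rewrite expR_le1; lra.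
  have p0 := expR_ge0 (- t / 2).
  rewrite cabs_real normrM ger0_norm // -[leRHS]mulr1 ler_pM2l // ler_norml; lra.
have x1 : 0 <= (1 : R) <= 1 by rewrite ler01 lexx.
have x2 : 0 <= expR (- 2 * t) <= 1 by rewrite expR_ge0 /= expR_le1; lra.
have e4 : cabs (1 / 4 * Msum 1 z) <= K2 * rr z.
  rewrite cabsM q4; apply: le_trans (h2 1 z x1 hz).
  by apply: ler_piMl; [exact: cabs_ge0|rewrite invf_le1 // ler1n].
have e5 : cabs (1 / 4 * (expR (- t / 2))%:C * Msum (expR (- 2 * t)) z) <= K2 * rr z.
  rewrite cabsM cabsM q4 cabs_real ger0_norm ?expR_ge0 //; apply: le_trans (h2 _ z x2 hz).
  have p : expR (- t / 2) <= 1 by rewrite expR_le1; lra.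
  apply: ler_piMl; first exact: cabs_ge0.
  by apply: mulr_ile1; rewrite ?expR_ge0 ?invr_ge0 // invf_le1 // ler1n.
have e3 := h1 t z ht hz.
have -> : (4 * expR T + 4 + K1 + K2 + K2) * rr z =
    4 * expR T * rr z + 4 * rr z + K1 * rr z + K2 * rr z + K2 * rr z by ring.
rewrite /RR; apply: (le_trans (cabsB _ _)); apply: lerD => //.
apply: (le_trans (cabsD _ _)); apply: lerD => //.
apply: (le_trans (cabsD _ _)); apply: lerD => //.
by apply: (le_trans (cabsD _ _)); apply: lerD.
Qed.

(** For large [z] the only growing part of [Aline] is [z * Msum], of size |z| rr(z). The bound 2 /
    |z| for [ee] removes the factor |z| and leaves rr(z). *)
Lemma bnd_Aee (T : R) : 0 <= T -> exists2 K : R, 0 <= K & forall t z, 0 <= t <= T -> Im z = 0 ->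
  cabs (Aline z * ee t z) <= K * rr z.
Proof.
move=> T0; have [K2 K20 h2] := bnd_Msum.
pose A0 : R := 2 + 2 + cabs ((ln pi)%:C / 2 : C) + cabs (digamma (1 / 4 : C)).
have A00 : 0 <= A0 by rewrite !addr_ge0 ?cabs_ge0.
have x1 : 0 <= (1 : R) <= 1 by rewrite ler01 lexx.
have half1 : cabs (2^-1 : C) = 2^-1 by rewrite cabsV cabs_nat.
have hA z : Im z = 0 -> cabs (Aline z) <= A0 + cabs z * (K2 * rr z).
  move=> hz; have b1 : cabs (sline z)^-1 <= 2.
    rewrite cabsV invf_ple ?posrE //; last by rewrite cabs_gt0 strip_neq0 // strip_line.
    apply: le_trans (cabs_Re _); rewrite Re_sline hz addr0 ger0_norm // invr_ge0 //.
  have b2 : cabs (sline z - 1)^-1 <= 2.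
    rewrite cabsV invf_ple ?posrE //; last by rewrite cabs_gt0 subr_eq0 strip_neq1 // strip_line.
    apply: le_trans (cabs_Re _); rewrite ReD ReN Re_sline hz addr0 /= ler_normr; apply/orP; right; lra.
  have b3 : cabs ((digamma (1 / 4) - 'i%C * z / 2 * Msum 1 z) / 2) <= cabs (digamma (1 / 4 : C)) + cabs z * (K2 * rr z).
    rewrite cabsM half1; apply: (@le_trans _ _ (cabs (digamma (1 / 4) - 'i%C * z / 2 * Msum 1 z))).
      by apply: ler_piMr; [exact: cabs_ge0|rewrite invf_le1 // ler1n].
    apply: (le_trans (cabsB _ _)); rewrite lerD2l !cabsM cabs_i mul1r half1 -mulrA.
    apply: ler_wpM2l; first exact: cabs_ge0.
    apply: le_trans (h2 1 z x1 hz).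
    by apply: ler_piMl; [exact: cabs_ge0|rewrite invf_le1 // ler1n].
  rewrite /Aline /A0 -[in leRHS]addrA; apply: (le_trans (cabsD _ _)); apply: lerD => //.
  apply: (le_trans (cabsB _ _)); apply: lerD => //.
  by apply: (le_trans (cabsD _ _)); apply: lerD.
exists ((A0 + K2) * (T + 2) + 2 * K2).
  by apply: addr_ge0; apply: mulr_ge0 => //; apply: addr_ge0.
move=> t z ht hz; have /andP[t0 tT] := ht; have r0 := rr_ge0 z; have r1 := rr_le1 z.
have tn : `|t| <= T by rewrite ger0_norm.
have be := bnd_ee hz tn; have ce := cabs_ge0 (ee t z); have cz := cabs_ge0 z.
rewrite cabsM; have bA := hA z hz; have cA := cabs_ge0 (Aline z).
have [z1|z1] := leP (cabs z) 1.
  apply: (@le_trans _ _ ((A0 + K2) * ((T + 2) * rr z))).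
    apply: ler_pM => //; apply: (le_trans bA); rewrite lerD2l.
    rewrite -[leRHS]mul1r; apply: ler_pM => //; first exact: mulr_ge0.
    by rewrite -[leRHS]mulr1; apply: ler_wpM2l.
  by rewrite mulrA ler_wpM2r // lerDl mulr_ge0.
have z0 : z != 0 by rewrite -cabs_gt0; apply: lt_trans z1.
have be2 := ee_le2 t hz z0; have zp : 0 < cabs z by rewrite cabs_gt0.
apply: (@le_trans _ _ (A0 * ((T + 2) * rr z) + cabs z * (K2 * rr z) * (2 / cabs z))).
  apply: (le_trans (ler_wpM2r ce bA)); rewrite mulrDl; apply: lerD; apply: ler_wpM2l => //.
  by rewrite !mulr_ge0.
have -> : cabs z * (K2 * rr z) * (2 / cabs z) = 2 * K2 * rr z by field; rewrite gt_eqF.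
rewrite mulrA -mulrDl ler_wpM2r // lerD2r ler_wpM2r ?addr_ge0 // lerDl //.
Qed.

Lemma bnd_Sform (N : nat) (T : R) : 0 <= T -> exists2 K : R, 0 <= K & forall t z (h1 h2 h3 : C),
  0 <= t <= T -> Im z = 0 -> cabs h1 <= 1 -> cabs h2 <= 1 -> cabs h3 <= 1 ->
  cabs (Sform N t z h1 h2 h3) <= K * rr z.
Proof.
move=> T0; have [K1 K10 b1] := bnd_RR N T0; have [K3 K30 b3] := bnd_Aee T0.
exists (K1 + (T + 2) + K3); first by rewrite !addr_ge0.
move=> t z h1 h2 h3 ht hz c1 c2 c3; have /andP[t0 tT] := ht.
have tn : `|t| <= T by rewrite ger0_norm.
have p (h w : C) (M : R) : cabs h <= 1 -> cabs w <= M -> cabs (h * w) <= M.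
  by move=> hh hw; rewrite cabsM; apply: le_trans hw; apply: ler_piMl => //; exact: cabs_ge0.
have -> : (K1 + (T + 2) + K3) * rr z = K1 * rr z + (T + 2) * rr z + K3 * rr z by ring.
rewrite /Sform cabsM cabs_i mul1r.
apply: (le_trans (cabsD _ _)); apply: lerD; last by apply: (p _ _ _ c3); exact: b3.
apply: (le_trans (cabsD _ _)); apply: lerD; [apply: (p _ _ _ c1)|apply: (p _ _ _ c2)].
  exact: b1.
exact: bnd_ee.
Qed.

Lemma cmeas_Sform (N : nat) z (h1 h2 h3 : C) : Im z = 0 -> cmeas setT (fun t => Sform N `|t| z h1 h2 h3).
Proof.
move=> hz; have ma : measurable_fun setT (fun t : R => `|t|) by exact: normr_measurable.
have me (c : R) : measurable_fun setT (fun t : R => expR (c * `|t|)).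
  apply: measurableT_comp; first exact: measurable_expR.
  by apply: measurable_funM; [exact: measurable_cst|].
have me' : cmeas setT (fun t : R => (expR (- `|t| / 2))%:C).
  apply: cmeas_real; rewrite (_ : (fun t => _) = fun t : R => expR (- 2^-1 * `|t|)) //.
  by apply/funext => t; congr expR; ring.
have hz' : - 4^-1 <= Im z by rewrite hz oppr_le0 invr_ge0.
have mE (f : R -> R) : measurable_fun setT f -> cmeas setT (fun t => ee (f t) z) by exact: cmeas_ee.
apply: cmeasM; first exact: cmeas_cst.
apply: cmeasD; [apply: cmeasD|]; (apply: cmeasM; first exact: cmeas_cst).
- apply: cmeasB; [apply: cmeasD; [apply: cmeasD; [apply: cmeasD|]|]|].
  + apply: cmeasM; last exact: cmeas_cst.
    apply: cmeas_real; apply: measurable_funM; first exact: measurable_cst.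
    apply: measurable_funB; last exact: measurable_cst.
    rewrite (_ : (fun t => _) = fun t : R => expR (2^-1 * `|t|)) //.
    by apply/funext => t; rewrite mulrC.
  + apply: cmeasM; last exact: cmeas_cst.
    apply: cmeas_real; apply: measurable_funM; first exact: measurable_cst.
    apply: measurable_funB; last exact: measurable_cst.
    rewrite (_ : (fun t => _) = fun t : R => expR (- 2^-1 * `|t|)) //.
    by apply/funext => t; congr expR; ring.
  + apply: cmeas_sum => n; apply: cmeasM; first exact: cmeas_cst.
    apply: mE; apply: measurable_maxr; last exact: measurable_cst.
    by apply: measurable_funB => //; exact: measurable_cst.
  + exact: cmeas_cst.
  + apply: cmeasM; first by apply: cmeasM => //; exact: cmeas_cst.
    apply: cmeas_Msum => // t _; rewrite expR_ge0 /= expR_le1.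
    by rewrite mulNr oppr_le0 mulr_ge0.
- exact: mE.
- by apply: cmeasM; [exact: cmeas_cst|exact: mE].
Qed.

Lemma frakS_lim t z : Im z = 0 -> Sraw `|t| w @[w --> z^'] --> frakS t z.
Proof.
move=> hz; have [h1 [h2 [h3 [_ _ _ H]]]] := Sraw_weights hz.
have h := H `|t| (Num.truncn (expR `|t|)).+1 (normr_ge0 t) (ltnSn _).
by have -> : frakS t z = Sform (Num.truncn (expR `|t|)).+1 `|t| z h1 h2 h3 by exact: limC h.
Qed.

(** At a given [z] a single triple of weights serves all [t] and [N]. This makes S_t(z) measurable
    in [t] and bounded uniformly for [t] in a compact set. *)
Lemma frakS_form z : Im z = 0 -> exists h1 h2 h3 : C,
  [/\ cabs h1 <= 1, cabs h2 <= 1, cabs h3 <= 1 &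
   forall t N, (Num.truncn (expR `|t|) < N)%N -> frakS t z = Sform N `|t| z h1 h2 h3].
Proof.
move=> hz; have [h1 [h2 [h3 [b1 b2 b3 H]]]] := Sraw_weights hz.
exists h1, h2, h3; split; [exact: b1|exact: b2|exact: b3|move=> t N tN].
by apply: limC; exact: (H _ _ (normr_ge0 t) tN).
Qed.

(** Near [x], the values of [f] away from [x] are close to [g x], and [g (u n)] is a limit of such
    values. Thus [frakS] is continuous along the real line, across zeros of xi too, without a look
    at how the weights vary. *)
Lemma punctured_lim_continuous (f : C -> C) (g : R -> C) :
  (forall x, f w @[w --> (x%:C)^'] --> g x) ->
  forall x (u : nat -> R), u n @[n --> \oo] --> x -> g (u n) @[n --> \oo] --> g x.
Proof.
move=> fg x u ux; apply/cvgCP => e e0; have e2 : 0 < e / 2 by rewrite divr_gt0.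
have /cvgC_dnbhs/(_ _ e2)[r r0 hr] := fg x.
have /cvgrPdist_lt/(_ _ r0) hu := ux.
apply: filterS hu => n hn; apply: (@le_lt_trans _ _ (e / 2)); last by lra.
pose proof (cvgCB (fg (u n)) (cvgCc (g x))) as H.
apply: (cabs_lim_le H).
have d0 : 0 < r - `|x - u n| by rewrite subr_gt0.
(* [hr] says nothing about the point [x]; it is avoided close to [u n], whether or not [u n] equals
   [x]. *)
have near1 : \forall w \near (u n)%:C^', w != x%:C.
  have [->|ne] := eqVneq (u n) x.
    by apply: filterS (near_dnbhs_neq x%:C) => w; rewrite subr_eq0.
  pose proof (cvgC_neq0 (cvgCB (@cvg_id_dnbhs _ (u n)%:C) (cvgCc x%:C))) as H2.
  have nz : (u n)%:C - x%:C != 0 by rewrite -rmorphB (inj_eq (@complexI R)) subr_eq0.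
  by apply: filterS (H2 nz) => w; rewrite subr_eq0.
have near2 : \forall w \near (u n)%:C^', cabs (w - (u n)%:C) < r - `|x - u n|.
  by apply/dnbhsCP; exists (r - `|x - u n|).
apply: filterS2 near1 near2 => w w1 w2; apply/ltW/hr => //.
have -> : w - x%:C = (w - (u n)%:C) - (x - u n)%:C by rewrite rmorphB; ring.
by apply: (le_lt_trans (cabsB _ _)); rewrite cabs_real -ltrBrDr.
Qed.

Lemma frakS_seq t x (u : nat -> R) : u n @[n --> \oo] --> x ->
  frakS t (u n)%:C @[n --> \oo] --> frakS t x%:C.
Proof.
move=> ux; apply: (@punctured_lim_continuous (Sraw `|t|) (fun x => frakS t x%:C) _ x u ux) => y.
exact: frakS_lim.
Qed.

End Bounds.

(** * Square integrability *)

Section Main.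
Context {R : realType}.
Local Notation C := R[i].
Local Notation mu := (@lebesgue_measure R).
Implicit Types (z w : C) (x y t u : R).

Lemma rpw_integrableNy (b : R) : 0 < b -> mu.-integrable `]-oo, (-1)[ (EFin \o (fun x => rpw (- 1 - b) (- x))).
Proof.
move=> b0; pose E (n : nat) : set R := `[- n.+2%:R, - 1]%classic.
have n1 (n : nat) : 1 < (n.+2%:R : R) by rewrite ltr1n.
have EU : `]-oo, (- 1)]%classic = \bigcup_n E n.
  apply/seteqP; split => x /=; rewrite in_itv /= ?andbT.
    move=> x1; exists (Num.truncn (- x)) => //=; rewrite /E /= in_itv /= x1 andbT.
    by rewrite lerNl; apply: (le_trans (ltW (truncnS_gt _))); rewrite ler_nat.
  by move=> [n _]; rewrite /E /= in_itv /= => /andP[].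
have mN : measurable_fun setT (fun x : R => rpw (- 1 - b) (- x)).
  by apply: measurableT_comp; [exact: measurable_rpw|exact: oppr_measurable].
apply: (@integrableS _ _ _ mu `]-oo, (- 1)]%classic) => //.
  by move=> x /=; rewrite !in_itv /=; exact: ltW.
rewrite EU; apply: (@integrable_incr _ E _ b^-1).
- by move=> n; exact: measurable_itv.
- move=> m n mn; rewrite /E; apply/subsetPset => x /=; rewrite !in_itv /= => /andP[h ->].
  by rewrite andbT; apply: le_trans h; rewrite lerN2 ler_nat !ltnS.
- by move=> n; exact: measurable_funTS.
- by move=> n x _; exact: rpw_ge0.
(* Reflection brings the integral to the positive half-line, where [rpw_FTC] evaluates it. *)
move=> n; rewrite integration_by_substitution_oppr; first last.
- apply: continuous_in_subspaceT => x; rewrite inE /= in_itv /= => /andP[_ x1].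
  have x0 : 0 < - x by lra.
  have cN : - y @[y --> x] --> - x by apply: cvgN; exact: cvg_id.
  exact: (continuous_cvg _ (is_derive_cont (is_derive_rpw (- 1 - b) x0)) cN).
- exact: ltW.
under eq_integral do rewrite /= opprK.
rewrite addrC rpw_FTC ?oppr_eq0 ?gt_eqF // lee_fin {2}/rpw ln1 mulr0 expR0.
rewrite invrN mulrN -mulNr opprB ler_pdivrMr // mulVf ?gt_eqF //.
by rewrite gerBl expR_ge0.
Qed.

(** An integrable majorant for the square of [rr] on the line; the exponent is 2 * (-3/4) = -1 -
    1/2. *)
Definition sqdom x : R :=
  ((cst 1 : R -> R) \_ `[-1, 1]%classic) x + (rpw (- 1 - 2^-1) \_ `]1, +oo[%classic) x +
  ((fun x => rpw (- 1 - 2^-1) (- x)) \_ `]-oo, (-1)[%classic) x.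

Lemma sqdom_integrable : mu.-integrable setT (EFin \o sqdom).
Proof.
have h0 : 0 < 2^-1 :> R by rewrite invr_gt0.
pose f0 : R -> R := (cst 1 : R -> R) \_ `[-1, 1]%classic.
pose f1 : R -> R := rpw (- 1 - 2^-1) \_ `]1, +oo[%classic.
pose f2 : R -> R := (fun x => rpw (- 1 - 2^-1) (- x)) \_ `]-oo, (-1)[%classic.
rewrite (_ : _ \o _ = (((EFin \o f0) \+ (EFin \o f1)) \+ (EFin \o f2))%E); last first.
  by apply/funext => x /=; rewrite /sqdom !EFinD.
apply: integrableD => //; [apply: integrableD => //|].
- have i : mu.-integrable `[-1, 1] (EFin \o (cst 1 : R -> R)).
    apply: continuous_compact_integrable; first exact: segment_compact.
    by apply: continuous_subspaceT => x; exact: cvg_cst.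
  have /(integrable_mkcond _ _).1 := i.
  by rewrite restrict_EFin; apply; exact: measurable_itv.
- have /(integrable_mkcond _ _).1 := rpw_integrable1y h0.
  by rewrite restrict_EFin; apply; exact: measurable_itv.
- have /(integrable_mkcond _ _).1 := rpw_integrableNy h0.
  by rewrite restrict_EFin; apply; exact: measurable_itv.
Qed.

Lemma rr_sqdom x : rr x%:C ^+ 2 <= sqdom x.
Proof.
have p (D : set R) (f : R -> R) : (forall x, 0 <= f x) -> 0 <= (f \_ D) x.
  by move=> f0; rewrite /patch; case: ifP.
have p0 := p `[-1, 1]%classic (cst 1) (fun=> ler01).
have p1 := p `]1, +oo[%classic _ (rpw_ge0 (- 1 - 2^-1)).
have p2 := p `]-oo, (-1)[%classic _ (fun x => rpw_ge0 (- 1 - 2^-1) (- x)).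
have sq (y : R) : rpw (- (3 / 4)) y ^+ 2 = rpw (- 1 - 2^-1) y.
  have e : - (3 / 4) - 3 / 4 = - 1 - 2^-1 :> R.
    by clear; lra.
  rewrite expr2.
  rewrite -rpwD.
  by rewrite e.
have c : cabs (x%:C : C) = `|x| by rewrite cabs_real.
rewrite /sqdom; have [h|h] := leP `|x| 1.
  rewrite rr_small ?c // expr1n; move: p0; rewrite [in X in X -> _]/patch /patch ifT; last first.
    by rewrite inE /= in_itv /=; move: h; rewrite ler_norml.
  move=> _; rewrite -addrA lerDl addr_ge0 //.
rewrite rr_big c // sq; have [x0|x0] := leP 0 x.
  rewrite (ger0_norm x0) in h *.
  have -> : rpw (- 1 - 2^-1) x = (rpw (- 1 - 2^-1) \_ `]1, +oo[%classic) x.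
    by rewrite /patch ifT // inE /= in_itv /= h.
  by rewrite addrAC lerDr addr_ge0.
rewrite (ltr0_norm x0) in h *.
have -> : rpw (- 1 - 2^-1) (- x) = ((fun x => rpw (- 1 - 2^-1) (- x)) \_ `]-oo, (-1)[%classic) x.
  by rewrite /patch ifT // inE /= in_itv /= ltrNr.
by rewrite lerDr addr_ge0.
Qed.

(** * The transform of a test function *)

Section TestFunction.
Variables (phi : R -> C) (T : R).
Hypotheses (T0 : 0 <= T) (phi_supp : forall t, T < `|t| -> phi t = 0).
Hypotheses (phi_Re : continuous (fun t => Re (phi t))) (phi_Im : continuous (fun t => Im (phi t))).

Let G t : R := `|Re (phi t)| + `|Im (phi t)|.

Let G0 t : 0 <= G t. Proof. by rewrite addr_ge0. Qed.

Let phi_G t : cabs (phi t) <= G t. Proof. exact: cabs_ReIm. Qed.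

Let mphi : cmeas setT phi.
Proof. by split; exact: continuous_measurable_fun. Qed.

Let iG : mu.-integrable setT (EFin \o G).
Proof.
have mD : measurable (`[- T, T]%classic : set R) by exact: measurable_itv.
have i : cintegrable `[- T, T] phi.
  by split; apply: continuous_compact_integrable; try exact: segment_compact; exact: continuous_subspaceT.
have i2 := cintegrable_dominator mD i.
have e : (EFin \o G) = ((EFin \o G) \_ `[- T, T]%classic).
  apply/funext => t; rewrite /patch; case: ifPn => //.
  rewrite notin_setE /= in_itv /= -ler_norml => /negP; rewrite -ltNge => /phi_supp h.
  by rewrite /= /G h /= normr0 addr0.
have /(integrable_mkcond _ _).1 := i2.
move=> /(_ mD) h; rewrite e; exact: h.
Qed.

Let N := (Num.truncn (expR T)).+1.

Let tN t : `|t| <= T -> (Num.truncn (expR `|t|) < N)%N.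
Proof. by move=> h; rewrite ltnS; apply: le_truncn; rewrite ler_expR. Qed.

Let integrandE z t : hatP_integrand phi z t = conjc (frakS t (conjc z)) * phi t.
Proof. by []. Qed.

Let integrand_real x t : hatP_integrand phi x%:C t = conjc (frakS t x%:C) * phi t.
Proof. by rewrite integrandE conjc_real. Qed.

(** Beyond [T] the factor [phi t] vanishes, so the length [N] chosen for [T] is correct for every
    [t]. *)
Let integrand_form x : exists h1 h2 h3 : C,
  [/\ cabs h1 <= 1, cabs h2 <= 1, cabs h3 <= 1 &
   forall t, hatP_integrand phi x%:C t = conjc (Sform N `|t| x%:C h1 h2 h3) * phi t].
Proof.
have [h1 [h2 [h3 [b1 b2 b3 H]]]] := @frakS_form R x%:C erefl.
exists h1, h2, h3; split; [exact: b1|exact: b2|exact: b3|move=> t].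
rewrite integrand_real; have [h|h] := leP `|t| T; first by rewrite (H t N (tN h)).
by rewrite phi_supp // !mulr0.
Qed.

Let integrand_meas x : cmeas setT (hatP_integrand phi x%:C).
Proof.
have [h1 [h2 [h3 [_ _ _ H]]]] := integrand_form x.
by rewrite (funext H); apply: cmeasM => //; apply: cmeasJ; exact: cmeas_Sform.
Qed.

Let integrand_bound : exists2 K : R, 0 <= K & forall x t,
  cabs (hatP_integrand phi x%:C t) <= K * rr x%:C * G t.
Proof.
have [K K0 bK] := @bnd_Sform R N T T0; exists K => // x t.
have [h1 [h2 [h3 [b1 b2 b3 H]]]] := integrand_form x.
have [h|h] := leP `|t| T; last first.
  by rewrite integrand_real phi_supp // mulr0 cabs0 !mulr_ge0 // rr_ge0.
rewrite H cabsM cabsJ; apply: ler_pM; rewrite ?cabs_ge0 //.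
by apply: bK => //; rewrite normr_ge0.
Qed.

Let iKG (K : R) : mu.-integrable setT (EFin \o (fun t => K * G t)).
Proof.
rewrite (_ : _ \o _ = fun t => (K%:E * (EFin \o G) t)%E); last by apply/funext => t /=; rewrite EFinM.
by apply: integrableZl => //; exact: iG.
Qed.

Let integrand_integrable x : cintegrable setT (hatP_integrand phi x%:C).
Proof.
have [K K0 bK] := integrand_bound.
by apply: (cintegrable_dom _ (integrand_meas x) (iKG (K * rr x%:C))) => // t _; exact: bK.
Qed.

Let hatP_bound : exists2 K : R, 0 <= K & forall x, cabs (hatP phi x%:C) <= K * rr x%:C.
Proof.
have [K K0 bK] := integrand_bound.
have I0 : 0 <= \int[mu]_t G t by apply: Rintegral_ge0.
exists (2 * (K * \int[mu]_t G t)); first by rewrite !mulr_ge0.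
move=> x; have h := @cabs_cintegral_le R setT _ (fun t => K * rr x%:C * G t) measurableT (integrand_integrable x) (iKG _) (fun t _ => bK x t).
apply: (le_trans h); rewrite RintegralZl //.
by rewrite le_eqVlt; apply/orP; left; apply/eqP; ring.
Qed.

(** Dominated convergence in [t], where [rr <= 1] makes the majorant independent of the point. The
    resulting continuity supplies the measurability in [hatP_meas]. *)
Let hatP_seq x (u : nat -> R) : u n @[n --> \oo] --> x ->
  hatP phi (u n)%:C @[n --> \oo] --> hatP phi x%:C.
Proof.
move=> ux; have [K K0 bK] := integrand_bound.
apply: (@cintegral_dominated R setT _ _ (fun t => K * G t)).
- exact: measurableT.
- by move=> n; exact: integrand_meas.
- move=> t _; rewrite integrand_real.
  pose proof (cvgCM (cvgC_conj (@frakS_seq R t x u ux)) (cvgCc (phi t))) as H.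
  by apply: cvgC_ext H => n; rewrite integrand_real.
- exact: iKG.
- move=> n t _; apply: (le_trans (bK _ _)); apply: ler_wpM2r => //.
  by apply: ler_piMr => //; exact: rr_le1.
Qed.

Let hatP_meas : cmeas setT (fun x => hatP phi x%:C).
Proof.
split; apply: continuous_measurable_fun => x; apply/continuous_withinNx/cvgr_dnbhsP => u [_ ux].
  exact: cvgC_Re (hatP_seq ux).
exact: cvgC_Im (hatP_seq ux).
Qed.

Lemma hatP_square_integrable : (forall x, cintegrable setT (hatP_integrand phi x%:C)) /\
  square_integrable (fun x => hatP phi x%:C).
Proof.
split; first exact: integrand_integrable.
have [m1 m2] := hatP_meas; split => //.
have [K K0 bK] := hatP_bound.
have iq : mu.-integrable setT (EFin \o (fun x => K ^+ 2 * sqdom x)).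
  rewrite (_ : _ \o _ = fun x => ((K ^+ 2)%:E * (EFin \o sqdom) x)%E); last by apply/funext => t /=; rewrite EFinM.
  by apply: integrableZl => //; exact: sqdom_integrable.
have ms : cmeas setT (fun x => (Re (hatP phi x%:C) ^+ 2 + Im (hatP phi x%:C) ^+ 2)%:C : C).
  by apply: cmeas_real; apply: measurable_funD; exact: measurable_funX.
have [i _] : cintegrable setT (fun x => (Re (hatP phi x%:C) ^+ 2 + Im (hatP phi x%:C) ^+ 2)%:C : C).
  apply: (cintegrable_dom _ ms iq) => // x _.
  rewrite cabs_real ger0_norm ?addr_ge0 ?sqr_ge0 // -cabs_sqr.
  apply: (@le_trans _ _ ((K * rr x%:C) ^+ 2)).
    by apply: lerXn2r; rewrite ?nnegrE ?cabs_ge0 ?mulr_ge0 ?rr_ge0.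
  by rewrite exprMn ler_wpM2l ?sqr_ge0 // rr_sqdom.
exact: integrable_lty i.
Qed.

End TestFunction.

End Main.

(** [cintegral] is a total operation, so the first conjunct records that the integral defining the
    transform exists at every real point. *)
Theorem proposition1p3 (R : realType) (phi : R -> R[i])
    (phi_smooth : smooth phi) (phi_cpt : compactly_supported phi) :
  (forall z : R, cintegrable setT (hatP_integrand phi z%:C)) /\
  square_integrable (fun z : R => hatP phi z%:C).
Proof.
have [M [_ hM]] := compact_bounded phi_cpt.
have [cR cI] : continuous (fun t => complex.Re (phi t)) /\ continuous (fun t => complex.Im (phi t)).
  by split => t; have [d1 d2] := phi_smooth 0%N t; apply: differentiable_continuous; exact/derivable1_diffP.
(* [compact_bounded] bounds the support by every number greater than [M], hence the added 1; the
   maximum with 0 makes the radius nonnegative. *)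
apply: (@hatP_square_integrable R phi (Num.max M 0 + 1)) => //.
  by rewrite addr_ge0 // le_max lexx orbT.
move=> t ht; apply/eqP; apply: contraTT ht => pt; rewrite -leNgt.
apply: (hM (Num.max M 0 + 1)); first by rewrite ltr_pwDr // le_max lexx.
exact: subset_closure.
Qed.
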